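(* Suppose $M$ and $F$ satisfy assumptions (A1)--(A4) listed in the context, and let $(X^\epsilon,Y^\epsilon)$, $0<\epsilon\le1$, be the solution of the slow-fast system in the context. Then for each $1\le p<\infty$ there is a constant $C$, independent of $\epsilon\in(0,1]$ and of $s,t$, such that for all $0\le s\le t\le T$ and all $0<\epsilon\le 1$: (i) $\displaystyle \mathbb{E}|X^\epsilon_t-X^\epsilon_s|^p\le C|t-s|^{p/2}$; (ii) $\displaystyle \mathbb{E}\Big|\int_s^t X^\epsilon_{s,u}\otimes dX^\epsilon_u\Big|^p\le C|t-s|^p$.
   Context: Fix $0<T<\infty$ and $d\ge 1$. Let $(\Omega,\mathcal{F},(\mathcal{F}_t)_{0\le t\le T},P)$ be a complete stochastic basis carrying a $d$-dimensional standard Brownian motion $W$. Let $M:\mathbb{R}^d\to\mathbb{R}^{d\times d}$ and $F:\mathbb{R}^d\to\mathbb{R}^d$; $M^{-1}(x)$ denotes the inverse matrix of $M(x)$, and $|\cdot|$ is the Euclidean norm of a vector or matrix. Assumptions: (A1) There is a constant $\lambda>0$ such that for every $x\in\mathbb{R}^d$ the smallest eigenvalue of $\frac{M(x)+M(x)^\top}{2}$ is at least $\lambda$. (A2) $M\in C^2(\mathbb{R}^d;\mathbb{R}^{d\times d})$ and $M^{-1}\in C^3(\mathbb{R}^d;\mathbb{R}^{d\times d})$. (A3) $M$, $M^{-1}$ and $\partial_{x_j}M^{-1}_{ik}$ ($1\le i,j,k\le d$) are globally Lipschitz, and $M^{-1}$ is bounded. (A4) $F$ is globally Lipschitz and bounded.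 Slow-fast system: for $0<\epsilon\le1$, $(X^\epsilon,Y^\epsilon)$ solves on $[0,T]$ $$dX^\epsilon_t=\tfrac1\epsilon Y^\epsilon_t\,dt,\quad X^\epsilon_0=0;\qquad dY^\epsilon_t=-\tfrac1{\epsilon^2}M(X^\epsilon_t)Y^\epsilon_t\,dt+\tfrac1\epsilon F(X^\epsilon_t)\,dt+\tfrac1\epsilon dW_t,\quad Y^\epsilon_0=0.$$ Notation: $X^\epsilon_{s,u}:=X^\epsilon_u-X^\epsilon_s$; $\int_s^t X^\epsilon_{s,u}\otimes dX^\epsilon_u$ is the $d\times d$ matrix of Riemann--Stieltjes integrals with $(i,j)$ entry $\int_s^t X^{\epsilon,i}_{s,u}\,dX^{\epsilon,j}_u$ (recall $X^\epsilon$ has finite variation). *)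

(* Defs.v *)
From HB Require Import structures.
From mathcomp Require Import all_boot all_order all_algebra.
From mathcomp Require Import all_classical all_reals all_analysis.

Set Implicit Arguments.
Unset Strict Implicit.
Unset Printing Implicit Defensive.

Import Order.TTheory GRing.Theory Num.Theory.
Import numFieldNormedType.Exports.

Local Open Scope classical_set_scope.
Local Open Scope ring_scope.

(* The norm `|A| provided by the library on matrices is the sup norm, hence
   a separate definition for the Euclidean (Frobenius) one. *)
Definition enorm (R : realType) (m n : nat) (A : 'M[R]_(m, n)) : R :=
  Num.sqrt (\sum_(i < m) \sum_(j < n) A i j ^+ 2).

Definition elipschitz (R : realType) (d m n : nat)
    (f : 'cV[R]_d -> 'M[R]_(m, n)) : Prop :=
  exists L : R, forall x y, enorm (f x - f y) <= L * enorm (x - y).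

Definition ebounded (R : realType) (d m n : nat)
    (f : 'cV[R]_d -> 'M[R]_(m, n)) : Prop :=
  exists K : R, forall x, enorm (f x) <= K.

Definition partial (R : realType) (d : nat) (V : normedModType R)
    (i : 'I_d) (f : 'cV[R]_d -> V) : 'cV[R]_d -> V :=
  'D_(delta_mx i 0) f.

(* All partial derivatives of order at most k exist and are continuous. *)
Fixpoint C_class (R : realType) (d : nat) (V : normedModType R) (k : nat)
    (f : 'cV[R]_d -> V) : Prop :=
  continuous f /\
  match k with
  | 0 => True
  | k'.+1 => forall i : 'I_d,
      (forall x, derivable f x (delta_mx i 0)) /\ C_class k' (partial i f)
  end.

Definition assumption_A1 (R : realType) (d : nat)
    (M : 'cV[R]_d -> 'M[R]_d) : Prop :=
  exists2 lambda : R, 0 < lambda &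
    forall x a, eigenvalue (2^-1 *: (M x + (M x)^T)) a -> lambda <= a.

Definition assumption_A2 (R : realType) (d : nat)
    (M : 'cV[R]_d -> 'M[R]_d) : Prop :=
  C_class 2 M /\ C_class 3 (fun x => invmx (M x)).

Definition assumption_A3 (R : realType) (d : nat)
    (M : 'cV[R]_d -> 'M[R]_d) : Prop :=
  [/\ elipschitz M,
      elipschitz (fun x => invmx (M x)),
      (forall i j k : 'I_d, exists L : R, forall x y,
         `|partial j (fun z => invmx (M z) i k) x
           - partial j (fun z => invmx (M z) i k) y| <= L * enorm (x - y)) &
      ebounded (fun x => invmx (M x))].

Definition assumption_A4 (R : realType) (d : nat)
    (F : 'cV[R]_d -> 'cV[R]_d) : Prop :=
  elipschitz F /\ ebounded F.

(* No right-continuity of the filtration is required. *)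
Record complete_basis (R : realType) (T : R) (disp : measure_display)
    (Omega : measurableType disp) (P : probability Omega R)
    (Ft : R -> set (set Omega)) : Prop := CompleteBasis {
  basis_complete : measure_is_complete P ;
  basis_sigma : forall t : R, 0 <= t <= T -> sigma_algebra setT (Ft t) ;
  basis_sub : forall t : R, 0 <= t <= T -> Ft t `<=` measurable ;
  basis_mono : forall s t : R, 0 <= s -> s <= t -> t <= T -> Ft s `<=` Ft t ;
  basis_null : P.-negligible `<=` Ft 0 }.

Definition borel_set (R : realType) (d : nat) : set (set 'cV[R]_d) :=
  <<s [set U : set 'cV[R]_d | open U] >>.

Definition adapted (R : realType) (T : R) (d : nat) (Omega : Type)
    (Ft : R -> set (set Omega)) (Z : R -> Omega -> 'cV[R]_d) : Prop :=
  forall (t : R) B, 0 <= t <= T -> borel_set B -> Ft t (Z t @^-1` B).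

Definition increment (R : realType) (d : nat) (Omega : Type)
    (Z : R -> Omega -> 'cV[R]_d) (s t : R) : Omega -> 'cV[R]_d :=
  fun w => Z t w - Z s w.

(* The second parameter of normal_prob is the standard deviation; bm_gauss says
   that the increment over [s, t] has law N(0, (t - s) I_d). *)
Record is_brownian_motion (R : realType) (T : R) (d : nat)
    (disp : measure_display) (Omega : measurableType disp)
    (P : probability Omega R) (Ft : R -> set (set Omega))
    (W : R -> Omega -> 'cV[R]_d) : Prop := IsBrownianMotion {
  bm_adapted : adapted T Ft W ;
  bm_start : {ae P, forall w, W 0 w = 0} ;
  bm_continuous : {ae P, forall w, {within `[0, T], continuous (W ^~ w)}} ;
  bm_indep : forall s t : R, 0 <= s -> s <= t -> t <= T ->
    forall A B, Ft s A -> borel_set B ->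
    (P (A `&` increment W s t @^-1` B)
     = P A * P (increment W s t @^-1` B))%E ;
  bm_gauss : forall s t : R, 0 <= s -> s < t -> t <= T ->
    forall B : 'I_d -> set R, (forall i, measurable (B i)) ->
    (P [set w | forall i, B i (increment W s t w i 0%R)]
     = \prod_(i < d) normal_prob 0%R (Num.sqrt (t - s)%R) (B i))%E }.

Definition vintegral (R : realType) (d : nat) (t : R) (f : R -> 'cV[R]_d) :
    'cV[R]_d :=
  \col_i \int[@lebesgue_measure R]_(u in `[0, t]) f u i 0.

(* The noise being additive, the stochastic differential equation is an
   integral equation that holds path by path. *)
Record is_solution (R : realType) (T : R) (d : nat)
    (disp : measure_display) (Omega : measurableType disp)
    (P : probability Omega R) (Ft : R -> set (set Omega))
    (W : R -> Omega -> 'cV[R]_d)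
    (M : 'cV[R]_d -> 'M[R]_d) (F : 'cV[R]_d -> 'cV[R]_d)
    (eps : R) (X Y : R -> Omega -> 'cV[R]_d) : Prop := IsSolution {
  sol_adaptedX : adapted T Ft X ;
  sol_adaptedY : adapted T Ft Y ;
  sol_continuousX : {ae P, forall w, {within `[0, T], continuous (X ^~ w)}} ;
  sol_continuousY : {ae P, forall w, {within `[0, T], continuous (Y ^~ w)}} ;
  sol_eqX : {ae P, forall w, forall t : R, 0 <= t <= T ->
    X t w = eps^-1 *: vintegral t (fun u => Y u w)} ;
  sol_eqY : {ae P, forall w, forall t : R, 0 <= t <= T ->
    Y t w = - (eps ^- 2 *: vintegral t (fun u => M (X u w) *m Y u w))
            + eps^-1 *: vintegral t (fun u => F (X u w))
            + eps^-1 *: W t w} }.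

(* I is the limit, as the mesh tends to 0, of the Riemann-Stieltjes sums of
   f dg over the tagged partitions of [a, b]: the partition points are a :: l
   and tag i is the tag of the i-th subinterval. *)
Definition is_RS_integral (R : realType) (a b : R) (f g : R -> R) (I : R) :
    Prop :=
  forall e : R, 0 < e -> exists2 delta : R, 0 < delta &
  forall (l : seq R) (tag : nat -> R), itv_partition a b l ->
  (forall i, (i < size l)%N ->
     nth b (a :: l) i <= tag i <= nth b l i /\
     nth b l i - nth b (a :: l) i < delta) ->
  `|\sum_(0 <= i < size l) f (tag i) * (g (nth b l i) - g (nth b (a :: l) i))
    - I| < e.

(* Meaningful only when the integral exists, e.g. for f continuous and g of
   finite variation; the value is 0 otherwise. *)
Definition RS_integral (R : realType) (a b : R) (f g : R -> R) : R :=
  xget 0 [set I | is_RS_integral a b f g I].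

Definition iterated_integral (R : realType) (d : nat) (x : R -> 'cV[R]_d)
    (s t : R) : 'M[R]_d :=
  \matrix_(i, j) RS_integral s t (fun u => (x u - x s) i 0) (fun u => x u j 0).

(* Main.v *)
(* Stochastic calculus is replaced by sums over uniform grids.  For an adapted
   discrete stochastic sum S with bracket V, conditioning on the past shows
   E exp (S - V) <= 1, which bounds the moments of S by those of V.  A version
   of this estimate for |Y|^2 with the weights exp (- (l / eps^2) (t - u)),
   combined with the coercivity of M, bounds E exp (l |Y_t|^2 / 8) uniformly in
   eps and t.

   With N = M^-1, the equation for Y reads
     dX = N(X) dW + N(X) F(X) dt - eps N(X) dY,
     eps N(X) dY = d (eps N(X) Y) - eps (dN(X)) Y,
   and |dN(X)| <= L |Y| dt / eps, so that no term is singular in eps.  When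
   eps <= sqrt (t - s) this bounds X_t - X_s by sqrt (t - s) in every L^p; when
   eps > sqrt (t - s) the bound |dX| <= |Y| dt / eps is enough.  The same
   decomposition of dX, with a summation by parts of the term X d (eps N(X) Y),
   bounds the Riemann-Stieltjes sums of X dX.  The estimates pass to the limit
   by Fatou's lemma; the iterated integral need not be measurable for this. *)

Require Import Defs.
From HB Require Import structures.
From mathcomp Require Import all_boot all_order all_algebra.
From mathcomp Require Import all_classical all_reals all_analysis measurable_realfun.
From mathcomp Require Import ring lra.

Set Implicit Arguments.
Unset Strict Implicit.
Unset Printing Implicit Defensive.

Import Order.TTheory GRing.Theory Num.Theory.
Import numFieldNormedType.Exports.

Local Open Scope classical_set_scope.
Local Open Scope ring_scope.

(** * Conditioning on the past *)

(** Pathwise inequalities hold on a grid only once its mesh is below a threshold given by the moduli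
    of continuity of the path, hence depending on the sample point. The moment bounds for discrete
    stochastic sums, in contrast, have constants that do not see the mesh. Fatou's lemma joins the
    two, because it asks for the inequality only for all large n at almost every sample point, so
    the threshold may vary with the point. The target for Y is an exponential moment because in the
    exponent the bracket of the stochastic sum is quadratic in Y, exactly like the dissipation,
    which can therefore absorb it; all powers then follow at once. Expanding |Y|^2 over a grid step
    leaves squared Brownian increments, which are compensated inside the same exponential
    supermartingale. The regimes meet at eps = sqrt (t - s) because the boundary term eps M^-1(X) Y
    is of size sqrt (t - s) below that value, and (t - s) / eps is at most sqrt (t - s) above it. *)

Section SubSigmaAlgebra.
Context (disp : measure_display) (R : realType) (Omega : measurableType disp).

Definition measurable_wrt (G : set (set Omega)) (f : Omega -> R) : Prop :=
  measurable_fun setT (f : g_sigma_algebraType G -> R).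

Lemma measurable_wrt_sub (G H : set (set Omega)) (f : Omega -> R) :
  G `<=` <<s H >> -> measurable_wrt G f -> measurable_wrt H f.
Proof.
move=> GH mf _ B mB; have := mf measurableT B mB; rewrite !setTI.
by apply: smallest_sub => //; exact: smallest_sigma_algebra.
Qed.

Lemma measurable_wrt_measurable (G : set (set Omega)) (f : Omega -> R) :
  G `<=` measurable -> measurable_wrt G f -> measurable_fun setT f.
Proof.
move=> GH mf _ B mB; have := mf measurableT B mB; rewrite !setTI.
by apply: smallest_sub => //; exact: sigma_algebra_measurable.
Qed.

End SubSigmaAlgebra.

Section Freezing.
Context (disp disp' : measure_display) (R : realType).
Context (Omega : measurableType disp) (S : measurableType disp').
Variable P : probability Omega R.

Local Open Scope ereal_scope.

(* Given G, the integrand is frozen at the G-measurable argument [a]; this is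
   Tonelli for the joint law of (U, a) and xi, which is a product measure. *)
Lemma independent_expectation_le (G : set (set Omega)) (N : probability S R)
    (U a : Omega -> R) (xi : Omega -> S) (g : R * S -> R) :
  G `<=` measurable -> measurable_wrt G U -> measurable_wrt G a ->
  measurable_fun setT xi -> (forall w, 0 <= U w)%R ->
  measurable_fun setT g -> (forall z, 0 <= g z)%R ->
  (forall x, \int[N]_y (g (x, y))%:E <= 1) ->
  (forall A B, <<s G >> A -> measurable B ->
    P (A `&` xi @^-1` B) = P A * N B) ->
  \int[P]_w (U w * g (a w, xi w))%:E <= \int[P]_w (U w)%:E.
Proof.
move=> Gm mU ma mxi U0 mg g0 g1 ind.
pose V w := (U w, a w).
have mV' : measurable_fun setT (V : g_sigma_algebraType G -> (R * R)%type).
  by apply: measurable_fun_pair; [exact: mU|exact: ma].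
have mV : measurable_fun setT V.
  by apply: measurable_fun_pair; exact: (measurable_wrt_measurable Gm).
pose phi w := (V w, xi w).
have mphi : measurable_fun setT phi by exact: measurable_fun_pair.
pose phiM : {mfun Omega >-> ((R * R) * S)%type} :=
  HB.pack phi (isMeasurableFun.Build _ _ _ _ phi mphi).
pose VM : {mfun Omega >-> (R * R)%type} :=
  HB.pack V (isMeasurableFun.Build _ _ _ _ V mV).
pose L := distribution P VM.
pose L2 := distribution P phiM.
have L2E X : measurable X -> (L \x N) X = L2 X.
  apply: product_measure_unique => A B mA mB.
  rewrite /L2 /L /distribution /pushforward /=.
  rewrite -ind//; last by have := mV' measurableT A mA; rewrite setTI.
(* [U] is nonnegative along its own values only; the absolute value makes the integrand nonnegative
   on the whole product space, as Tonelli requires. *)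
have [f' f'E] : exists f' : (R * R) * S -> \bar R,
    f' = fun z => (`|z.1.1| * g (z.1.2, z.2))%:E by eexists.
have mg' : measurable_fun setT (fun z : (R * R) * S => g (z.1.2, z.2)).
  apply: measurableT_comp => //; apply: measurable_fun_pair => //.
  exact: measurableT_comp.
have mf' : measurable_fun [set: (R * R) * S] f'.
  rewrite f'E.
  apply/measurable_EFinP; apply: measurable_funM => //.
  by apply: measurableT_comp => //; exact: measurableT_comp.
have f'0 z : 0 <= f' z by rewrite f'E lee_fin mulr_ge0.
have -> : \int[P]_w (U w * g (a w, xi w))%:E = \int[L2]_z f' z.
  rewrite ge0_integral_distribution//.
  by apply: eq_integral => w _ /=; rewrite f'E /= ger0_norm.
have -> : \int[L2]_z f' z = \int[L \x N]_z f' z.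
  by apply: eq_measure_integral => A mA _; apply: esym; exact: L2E.
rewrite fubini_tonelli1//.
have -> : \int[P]_w (U w)%:E = \int[L]_z `|z.1|%:E.
  rewrite ge0_integral_distribution//; last first.
    by apply/measurable_EFinP; apply: measurableT_comp.
  by apply: eq_integral => w _ /=; rewrite ger0_norm.
apply: ge0_le_integral => //.
- by move=> z _; apply: integral_ge0 => y _; exact: f'0.
- exact: measurable_fun_fubini_tonelli_F.
- by apply/measurable_EFinP; apply: measurableT_comp.
move=> [u x] _; rewrite /fubini_F f'E /=.
under eq_integral do rewrite EFinM.
rewrite ge0_integralZl//; last 2 first.
- apply/measurable_EFinP; apply: (measurableT_comp (g := fun y => (x, y))) => //.
  exact: measurable_fun_pair.
- by move=> y _; rewrite lee_fin.
rewrite -[leRHS]mule1 lee_pmul// ?lee_fin//.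
by apply: integral_ge0 => y _; rewrite lee_fin.
Qed.

End Freezing.

Section CoordinateIndependence.
Context (disp disp' : measure_display) (R : realType).
Context (Omega : measurableType disp) (S : measurableType disp').
Variables (P : probability Omega R) (d : nat) (G : set (set Omega)).
Variables (N : probability S R) (xi : 'I_d -> Omega -> S).

Let box (B : 'I_d -> set S) : set Omega := [set w | forall i, B i (xi i w)].

Hypothesis sG : sigma_algebra setT G.
Hypothesis Gm : G `<=` measurable.
Hypothesis mxi : forall i, measurable_fun setT (xi i).
Hypothesis indG : forall A B, G A -> (forall i, measurable (B i)) ->
  (P (A `&` box B) = P A * \prod_(i < d) N (B i))%E.

Let GT : G setT.
Proof. by case: sG => G0 GC _; rewrite -(setD0 setT); exact: GC. Qed.

Let GI : setI_closed G.
Proof.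
move=> A B GA GB.
have := @measurableI _ (g_sigma_algebraType G) A B.
by rewrite measurable_g_measurableTypeE//; apply.
Qed.

Let mbox (B : 'I_d -> set S) : (forall i, measurable (B i)) ->
  measurable (box B).
Proof.
move=> mB; rewrite (_ : box B = \bigcap_(i in [set: 'I_d]) (xi i @^-1` B i)).
  apply: fin_bigcap_measurable => // i _.
  by rewrite -[X in measurable X]setTI; exact: mxi.
by apply/seteqP; split => [w Bw i _|w Bw i]; exact: Bw.
Qed.

(** A pi-system generating the information available just before coordinate [j] is integrated out:
    the past [G] together with the coordinates of index below [j]. *)
Definition coord_pi_system (j : nat) : set (set Omega) :=
  [set E | exists A B, [/\ G A, (forall i, measurable (B i)),
    (forall i : 'I_d, (j <= i)%N -> B i = setT) & E = A `&` box B]].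

Lemma coord_pi_systemI j : setI_closed (coord_pi_system j).
Proof.
move=> _ _ [A [B [GA mB BT ->]]] [A' [B' [GA' mB' BT' ->]]].
exists (A `&` A'), (fun i => B i `&` B' i); split.
- exact: GI.
- by move=> i; exact: measurableI.
- by move=> i ji; rewrite BT// BT'// setTI.
apply/seteqP; split => [w [[Aw Bw] [A'w B'w]]|w [[Aw A'w] BB]].
  by split => // i; split.
by split; split => // i; have [] := BB i.
Qed.

Lemma sub_coord_pi_system j : G `<=` coord_pi_system j.
Proof.
move=> A GA; exists A, (fun=> setT); split => //.
by apply/seteqP; split => [w Aw|w []//]; split.
Qed.

Lemma coord_pi_system_measurable j : coord_pi_system j `<=` measurable.
Proof.
by move=> _ [A [B [GA mB _ ->]]]; apply: measurableI; [exact: Gm|exact: mbox].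
Qed.

Lemma coord_measurable_wrt (j : nat) (i : 'I_d) : (i < j)%N ->
  measurable_fun setT (xi i : g_sigma_algebraType (coord_pi_system j) -> S).
Proof.
move=> ij _ B mB; rewrite setTI; apply: sub_sigma_algebra.
exists setT, (fun k => if k == i then B else setT); split => //.
- by move=> k; case: ifP.
- by move=> k jk; case: eqP => // ki; move: jk; rewrite ki leqNgt ij.
apply/seteqP; split => [w Bw|w [_ /(_ i)]]; last by rewrite eqxx.
by split => // k; case: eqP => // ->.
Qed.

(** Uniqueness of measures: both sides are finite measures in [A], and on the pi-system they agree
    by the product formula [indG], whose factor at [j] is free there. *)
Lemma coord_independent (j : 'I_d) A D : <<s coord_pi_system j >> A ->
  measurable D -> (P (A `&` xi j @^-1` D) = P A * N D)%E.
Proof.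
move=> sA mD.
have mxD : measurable (xi j @^-1` D).
  by rewrite -[X in measurable X]setTI; exact: mxi.
pose m1 : {measure set Omega -> \bar R} := mrestr P mxD.
pose r : {nonneg R} := NngNum (fine_ge0 (measure_ge0 N D)).
pose m2 : {measure set Omega -> \bar R} := mscale r P.
have NDE : N D = (r%:num)%:E by rewrite /= fineK// fin_num_measure.
suff -> : (P (A `&` xi j @^-1` D) = m2 A)%E.
  by rewrite /m2 /= /mscale NDE muleC.
have -> : P (A `&` xi j @^-1` D) = m1 A by [].
apply: (g_sigma_algebra_measure_unique (coord_pi_system j)
  (@coord_pi_system_measurable j) (fun=> setT)) sA => //.
- by move=> n; exact: sub_coord_pi_system.
- by apply/seteqP; split => // w _; exists 0%N.
- exact: coord_pi_systemI.
- move=> _ [E [B [GE mB BT ->]]].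
  rewrite /m1 /m2 /= /mrestr /mscale -NDE.
  pose B' k := if k == j then D else B k.
  have -> : E `&` box B `&` xi j @^-1` D = E `&` box B'.
    rewrite /B'; apply/seteqP; split => [w [[Ew Bw] Dw]|w [Ew Bw]].
      by split => // k; case: eqP => // ->.
    split; last by have := Bw j; rewrite eqxx.
    by split => // k; have := Bw k; case: eqP => // -> _; rewrite BT.
  have mB' k : measurable (B' k) by rewrite /B'; case: ifP.
  have IB' := indG GE mB'; have IB := indG GE mB.
  transitivity (N D * (P E * \prod_(i < d) N (B i)))%E; last by rewrite -IB.
  rewrite IB' (bigD1 j)//= [in RHS](bigD1 j)//= BT// probability_setT mul1e.
  rewrite /B' eqxx muleCA; congr (_ * (_ * _))%E.
  by apply: eq_bigr => k /negbTE ->.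
- by move=> n; rewrite (le_lt_trans (@probability_le1 _ _ _ P _ _)) ?ltry//;
    exact: measurableI.
Qed.

(** The factors are removed one at a time, the last one first: given [G] and the preceding
    coordinates, the rest of the product is frozen and the last factor has conditional mean at most
    1. *)
Lemma independent_prod_expectation_le (U : Omega -> R) (a : 'I_d -> Omega -> R)
    (g : R * S -> R) :
  measurable_wrt G U -> (forall i, measurable_wrt G (a i)) ->
  (forall w, 0 <= U w) -> measurable_fun setT g -> (forall z, 0 <= g z) ->
  (forall x, \int[N]_y (g (x, y))%:E <= 1)%E ->
  (\int[P]_w (U w * \prod_(i < d) g (a i w, xi i w))%:E
   <= \int[P]_w (U w)%:E)%E.
Proof.
move=> mU ma U0 mg g0 g1.
suff H j : (j <= d)%N ->
  (\int[P]_w (U w * \prod_(i < d | (i < j)%N) g (a i w, xi i w))%:E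
    <= \int[P]_w (U w)%:E)%E.
  rewrite (le_trans _ (H d (leqnn d)))// le_eqVlt; apply/orP; left; apply/eqP.
  apply: eq_integral => w _; congr (_ * _)%:E.
  by apply: eq_bigl => i; rewrite ltn_ord.
elim: j => [_|j IH jd].
  rewrite le_eqVlt; apply/orP; left; apply/eqP.
  by apply: eq_integral => w _; rewrite big_pred0// mulr1.
apply: le_trans (IH (ltnW jd)).
pose i0 := Ordinal jd.
pose V w := U w * \prod_(i < d | (i < j)%N) g (a i w, xi i w).
under eq_integral => w _.
  rewrite (_ : _ * _ = V w * g (a i0 w, xi i0 w)); last first.
    rewrite /V (bigD1 i0)/= ?ltnS// -mulrA; congr (_ * _).
    rewrite mulrC; congr (_ * _); apply: eq_bigl => i.
    by rewrite ltnS ltn_neqAle andbC -(inj_eq val_inj).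
  over.
have subG f : measurable_wrt G f -> measurable_wrt (coord_pi_system j) f.
  apply: measurable_wrt_sub => A GA; apply: sub_sigma_algebra.
  exact: sub_coord_pi_system.
apply: (@independent_expectation_le _ _ _ _ _ _ (coord_pi_system j) N) => //.
- exact: coord_pi_system_measurable.
- apply: measurable_funM; first exact: subG.
  under eq_fun do rewrite -big_filter.
  apply: measurable_prod => i; rewrite mem_filter => /andP[ij _].
  apply: (measurableT_comp mg); apply: measurable_fun_pair.
    exact: subG.
  exact: coord_measurable_wrt.
- exact: subG.
- by move=> w; rewrite mulr_ge0// prodr_ge0.
- by move=> A B sA mB; exact: coord_independent.
Qed.

End CoordinateIndependence.

(** * Densities and Gaussian exponential moments *)

Section Density.
Context (disp : measure_display) (T : measurableType disp) (R : realType).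
Variables (mu nu : {measure set T -> \bar R}) (g : T -> R).
Hypotheses (mg : measurable_fun setT g) (g0 : forall x, 0 <= g x).
Hypothesis nuE : forall A, measurable A -> nu A = (\int[mu]_(x in A) (g x)%:E)%E.

Import HBNNSimple.

Let integral_density_nnsfun (h : {nnsfun T >-> R}) :
  (\int[nu]_x (h x)%:E = \int[mu]_x ((h x)%:E * (g x)%:E))%E.
Proof.
transitivity (\int[nu]_x
    (\sum_(y \in range h) (y * \1_(h @^-1` [set y]) x)%:E))%E.
  by apply: eq_integral => x _; rewrite fsumEFin// -fimfunE.
have mind y : measurable_fun setT (fun x => (y * \1_(h @^-1` [set y]) x)%:E).
  by apply/measurable_EFinP; exact: measurable_funM.
rewrite ge0_integral_fsum//; last first.
  by move=> y x _; rewrite EFinM; exact: nnfun_muleindic_ge0.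
transitivity (\int[mu]_x
    (\sum_(y \in range h) ((y * \1_(h @^-1` [set y]) x)%:E * (g x)%:E)))%E;
    last first.
  apply: eq_integral => x _; rewrite -ge0_mule_fsuml ?fsumEFin -?fimfunE//.
  by move=> y; rewrite EFinM; exact: nnfun_muleindic_ge0.
rewrite ge0_integral_fsum//; last 2 first.
- by move=> y; apply: emeasurable_funM => //; exact/measurable_EFinP.
- by move=> y x _; rewrite mule_ge0 ?lee_fin// -lee_fin EFinM nnfun_muleindic_ge0.
apply: eq_fsbigr => y /[!inE] -[x _ <-].
under eq_integral do rewrite EFinM.
rewrite integralZl_indic_nnsfun//.
under [RHS]eq_integral do rewrite EFinM -muleA.
have mgi : measurable_fun setT
    (fun z => (\1_(h @^-1` [set h x]) z)%:E * (g z)%:E)%E.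
  by apply: emeasurable_funM; exact/measurable_EFinP.
rewrite ge0_integralZl ?lee_fin//; last first.
  by move=> z _; rewrite mule_ge0 ?lee_fin.
congr (_ * _)%E.
rewrite integral_indic// setIT nuE// [LHS]integral_mkcond.
apply: eq_integral => z _; rewrite epatch_indic muleC//.
Qed.

Lemma ge0_integral_density (f : T -> \bar R) : measurable_fun setT f ->
  (forall x, 0 <= f x)%E -> (\int[nu]_x f x = \int[mu]_x (f x * (g x)%:E))%E.
Proof.
move=> mf f0.
pose f_ := nnsfun_approx measurableT mf.
transitivity (limn (fun n => \int[nu]_x (f_ n x)%:E)%E).
  rewrite -monotone_convergence//=.
  - apply: eq_integral => x _; apply/esym/cvg_lim => //=.
    exact: cvg_nnsfun_approx.
  - by move=> n; exact/measurable_EFinP/measurable_funTS.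
  - by move=> n ? _; rewrite lee_fin.
  - by move=> x _ m n mn; rewrite lee_fin; exact/lefP/nd_nnsfun_approx.
transitivity (limn (fun n => \int[mu]_x ((f_ n x)%:E * (g x)%:E))%E).
  by apply: congr_lim; apply/funext => n /=; exact: integral_density_nnsfun.
rewrite -monotone_convergence//=.
- apply: eq_integral => x _; apply/cvg_lim => //=.
  by apply: cvgeZr => //; exact: cvg_nnsfun_approx.
- move=> n; apply: emeasurable_funM; last exact/measurable_EFinP.
  exact/measurable_EFinP/measurable_funTS.
- by move=> n x _; rewrite mule_ge0// lee_fin.
- move=> x _ m n mn; rewrite lee_wpmul2r ?lee_fin//.
  exact/lefP/nd_nnsfun_approx.
Qed.

End Density.

Section GaussianExponential.
Context (R : realType).

(** Completing the square turns the tilted density into a multiple of a normal density of variance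
    s^2 / (1 - v), with v = 2 q s^2. The multiple is exp (a^2 s^2 / (2 (1 - v))) / sqrt (1 - v), and
    v <= 1/2 bounds it by exp (a^2 s^2 + v). These compensators are not sharp, but they are linear
    in the variance and so add up over a grid. *)
Lemma normal_exp_le1 (s a q : R) : 0 < s -> 0 <= q -> q * s ^+ 2 <= 4^-1 ->
  (\int[normal_prob 0%R s]_y
     (expR (a * y + q * y ^+ 2 - a ^+ 2 * s ^+ 2 - 2 * q * s ^+ 2))%:E <= 1)%E.
Proof.
move=> s0 q0 qs.
have mE : measurable_fun setT
    (fun y : R => expR (a * y + q * y ^+ 2 - a ^+ 2 * s ^+ 2 - 2 * q * s ^+ 2)).
  apply: (measurableT_comp (@measurable_expR R)).
  apply: measurable_funB => //; apply: measurable_funB => //.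
  by apply: measurable_funD; apply: measurable_funM.
rewrite (@ge0_integral_density _ (measurableTypeR R) R lebesgue_measure
  (normal_prob 0 s) (normal_pdf 0 s) (measurable_normal_pdf 0 s)
  (normal_pdf_ge0 0 s) (fun A _ => erefl)); last 2 first.
- exact/measurable_EFinP.
- by move=> y; rewrite lee_fin expR_ge0.
pose v := 2 * q * s ^+ 2.
have v0 : 0 <= v by rewrite /v; have := sqr_ge0 s; nra.
have v1 : v <= 2^-1 by rewrite /v; lra.
pose s' := s / Num.sqrt (1 - v).
have sv0 : 0 < Num.sqrt (1 - v) by rewrite sqrtr_gt0; lra.
have s'0 : 0 < s' by rewrite divr_gt0.
have s'E : s' ^+ 2 = s ^+ 2 / (1 - v) by rewrite expr_div_n sqr_sqrtr//; lra.
pose m := a * s' ^+ 2.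
have pi0 : 0 < pi :> R := pi_gt0 R.
have peakE : normal_peak s = normal_peak s' / Num.sqrt (1 - v).
  rewrite /normal_peak -invfM -sqrtrM; last first.
    by rewrite mulrn_wge0// mulr_ge0 ?sqr_ge0// ltW.
  congr (Num.sqrt _)^-1; rewrite s'E mulrnAl; congr (_ *+ 2).
  by field; lra.
(* Squared and inverted, this follows from exp (2 v) >= 1 + 2 v and (1 + 2 v) (1 - v) >= 1 for 0 <=
   v <= 1/2. *)
have expv : expR (- v) <= Num.sqrt (1 - v).
  have h1 : expR (- v) ^+ 2 <= 1 - v.
    rewrite -expRM_natl mulrN expRN -[leRHS]invrK lef_pV2 ?posrE ?expR_gt0//;
      last by rewrite invr_gt0; lra.
    apply: le_trans (expR_ge1Dx _).
    by rewrite -[leLHS]mul1r ler_pdivrMr; nra.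
  by rewrite -[leLHS]ger0_norm ?expR_ge0// -sqrtr_sqr ler_wsqrtr.
have key y :
    expR (a * y + q * y ^+ 2 - a ^+ 2 * s ^+ 2 - 2 * q * s ^+ 2)
      * normal_pdf 0 s y <= normal_pdf m s' y.
  rewrite !normal_pdfE ?gt_eqF// /normal_fun peakE.
  rewrite mulrCA -!mulrA ler_wpM2l ?normal_peak_ge0//.
  rewrite -expRD ler_pdivrMl//.
  set e := (X in expR X <= _).
  have -> : e = (a ^+ 2 * s' ^+ 2 / 2 - a ^+ 2 * s ^+ 2 - v)
      + - (y - m) ^+ 2 / (s' ^+ 2 *+ 2).
    by rewrite /e /m s'E; rewrite /v; field; rewrite gt_eqF //=; lra.
  rewrite expRD ler_wpM2r ?expR_ge0//; apply: le_trans expv.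
  rewrite ler_expR.
  suff : a ^+ 2 * s' ^+ 2 / 2 <= a ^+ 2 * s ^+ 2 by lra.
  rewrite -mulrA ler_wpM2l ?sqr_ge0// s'E -mulrA -[leRHS]mulr1.
  by rewrite ler_wpM2l ?sqr_ge0// -invfM invf_le1; lra.
apply: (@le_trans _ _ (\int[lebesgue_measure]_y (normal_pdf m s' y)%:E)%E).
  apply: ge0_le_integral => //.
  - by move=> y _; rewrite -EFinM lee_fin mulr_ge0 ?expR_ge0 ?normal_pdf_ge0.
  - apply/measurable_EFinP; apply: measurable_funM => //.
    exact: measurable_normal_pdf.
  - by apply/measurable_EFinP; exact: measurable_normal_pdf.
  - by move=> y _; rewrite -EFinM lee_fin.
by rewrite integral_normal_pdf.
Qed.
End GaussianExponential.

(** * The exponential supermartingale of a discrete stochastic sum *)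

Section AdaptedContinuous.
Context (R : realType) (T : R) (d : nat).
Context (disp : measure_display) (Omega : measurableType disp).
Variables (Ft : R -> set (set Omega)) (Z : R -> Omega -> 'cV[R]_d).

Lemma adapted_continuous (g : 'cV[R]_d -> R) (t : R) :
  adapted T Ft Z -> 0 <= t <= T -> continuous g ->
  measurable_wrt (Ft t) (fun w => g (Z t w)).
Proof.
move=> aZ tT cg; apply: (measurability _ (RGenOpens.measurableE R)).
move=> _ [_ [a [b ->] <-]]; rewrite setTI; apply: sub_sigma_algebra.
apply: (aZ t (g @^-1` `]a, b[%classic)) => //; apply: sub_sigma_algebra.
by move/continuousP : cg; apply; exact: interval_open.
Qed.

End AdaptedContinuous.

Definition grid (R : realType) (t0 h : R) (k : nat) : R := t0 + k%:R * h.

Lemma gridS (R : realType) (t0 h : R) (k : nat) :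
  grid t0 h k.+1 = grid t0 h k + h.
Proof. by rewrite /grid -natr1 mulrDl mul1r addrA. Qed.

Lemma grid0 (R : realType) (t0 h : R) : grid t0 h 0 = t0.
Proof. by rewrite /grid mul0r addr0. Qed.

Lemma le_grid (R : realType) (t0 h : R) (k l : nat) : 0 <= h -> (k <= l)%N ->
  grid t0 h k <= grid t0 h l.
Proof. by move=> h0 kl; rewrite lerD2l ler_wpM2r// ler_nat. Qed.

Definition coord_incr (R : realType) (Omega : Type) (d : nat)
    (Z : R -> Omega -> 'cV[R]_d) (t0 h : R) (k : nat) (i : 'I_d) (w : Omega) : R :=
  increment Z (grid t0 h k) (grid t0 h k.+1) w i 0.

Section ExponentialSupermartingale.
Context (R : realType) (T : R) (d : nat).
Context (disp : measure_display) (Omega : measurableType disp).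
Variables (P : probability Omega R) (Ft : R -> set (set Omega)).
Variable W : R -> Omega -> 'cV[R]_d.
Hypothesis basis : complete_basis T P Ft.
Hypothesis brownian : is_brownian_motion T P Ft W.

Let Ftm (t : R) : 0 <= t <= T -> Ft t `<=` measurable.
Proof. by move=> tT; exact: (basis_sub basis). Qed.

Lemma measurable_wrt_later (s t : R) (f : Omega -> R) : 0 <= s -> s <= t ->
  t <= T -> measurable_wrt (Ft s) f -> measurable_wrt (Ft t) f.
Proof.
move=> s0 st tT; apply: measurable_wrt_sub => A FA; apply: sub_sigma_algebra.
exact: (basis_mono basis s0 st tT).
Qed.

Lemma coord_incr_measurable_wrt (t0 h : R) (k : nat) (i : 'I_d) :
  0 <= t0 -> 0 <= h -> grid t0 h k.+1 <= T ->
  measurable_wrt (Ft (grid t0 h k.+1)) (coord_incr W t0 h k i).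
Proof.
move=> t00 h0 kT.
have k0 : 0 <= grid t0 h k by rewrite addr_ge0// mulr_ge0.
have kk : grid t0 h k <= grid t0 h k.+1 by exact: le_grid.
have mW t : 0 <= t <= T -> measurable_wrt (Ft t) (fun w => W t w i 0).
  move=> tT; apply: (adapted_continuous (g := fun v => v i 0) (bm_adapted brownian)) => //.
  exact: coord_continuous.
rewrite /coord_incr /increment.
under eq_fun do rewrite !mxE.
apply: measurable_funB; first by apply: mW; rewrite (le_trans k0).
by apply: (measurable_wrt_later k0 kk kT); apply: mW; rewrite k0 (le_trans kk).
Qed.

Lemma bm_step_expectation_le (s t q : R) (U : Omega -> R)
    (a : 'I_d -> Omega -> R) :
  0 <= s -> s < t -> t <= T -> 0 <= q -> q * (t - s) <= 4^-1 ->
  measurable_wrt (Ft s) U -> (forall w, 0 <= U w) ->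
  (forall i, measurable_wrt (Ft s) (a i)) ->
  (\int[P]_w (U w * \prod_(i < d) expR (a i w * increment W s t w i 0
      + q * increment W s t w i 0 ^+ 2 - a i w ^+ 2 * (t - s)
      - 2 * q * (t - s)))%:E <= \int[P]_w (U w)%:E)%E.
Proof.
move=> s0 st tT q0 qh mU U0 ma.
have sT : 0 <= s <= T by rewrite s0 (le_trans (ltW st)).
have tT' : 0 <= t <= T by rewrite (le_trans s0 (ltW st)).
pose sg := Num.sqrt (t - s).
have sgE : sg ^+ 2 = t - s by rewrite sqr_sqrtr// subr_ge0 ltW.
have sg0 : 0 < sg by rewrite sqrtr_gt0 subr_gt0.
pose xi (i : 'I_d) (w : Omega) : measurableTypeR R := increment W s t w i 0.
have mxi i : measurable_fun setT (xi i).
  have mW u : 0 <= u <= T -> measurable_fun setT (fun w => W u w i 0).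
    move=> uT; apply: (measurable_wrt_measurable (Ftm uT)).
    apply: (adapted_continuous (g := fun v => v i 0) (bm_adapted brownian)) => //.
    exact: coord_continuous.
  rewrite /xi /increment; under eq_fun do rewrite !mxE.
  by apply: measurable_funB; exact: mW.
pose g (z : R * measurableTypeR R) : R := expR (z.1 * z.2 + q * z.2 ^+ 2
  - z.1 ^+ 2 * sg ^+ 2 - 2 * q * sg ^+ 2).
have mg : measurable_fun setT g.
  apply: (measurableT_comp (@measurable_expR R)).
  have m1 : measurable_fun setT (fun z : R * measurableTypeR R => z.1).
    exact: measurable_fst.
  have m2 : measurable_fun setT (fun z : R * measurableTypeR R => z.2 : R).
    exact: measurable_snd.
  apply: measurable_funB => //; apply: measurable_funB => //.
    apply: measurable_funD; apply: measurable_funM => //.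
    exact: measurable_funX.
  by apply: measurable_funM => //; exact: measurable_funX.
have := @independent_prod_expectation_le _ _ R Omega (measurableTypeR R) P d
  (Ft s) (normal_prob 0 sg) xi (basis_sigma basis sT) (Ftm sT) mxi _ U a g
  mU ma U0 mg.
rewrite /g /xi sgE; apply.
- move=> A B FA mB.
  (* [bm_indep] speaks of Borel sets of vectors and [bm_gauss] of boxes; a box is Borel, which lets
     the two be combined. *)
  pose BB := [set v : 'cV[R]_d | forall i, B i (v i 0)].
  have bB : borel_set BB.
    rewrite (_ : BB = \bigcap_(i in [set: 'I_d]) [set v | B i (v i 0)]).
      apply: (@fin_bigcap_measurable _ (g_sigma_algebraType _)) => // i _.
      have mc : measurable_fun setT ((fun v : 'cV[R]_d => v i 0) :
          g_sigma_algebraType [set U : set 'cV[R]_d | open U] -> R).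
        apply: (measurability _ (RGenOpens.measurableE R)).
        move=> _ [_ [x [y ->] <-]]; rewrite setTI; apply: sub_sigma_algebra.
        have /continuousP := @coord_continuous R d 1 i 0.
        by apply; exact: interval_open.
      by have := mc measurableT (B i) (mB i); rewrite setTI.
    by apply/seteqP; split => [v Bv i _|v Bv i]; exact: Bv.
  have gB := bm_gauss brownian s0 st tT mB.
  transitivity (P A * P (increment W s t @^-1` BB))%E.
    exact: (bm_indep brownian s0 (ltW st) tT FA bB).
  by congr (_ * _)%E; exact: gB.
- by move=> z; exact: expR_ge0.
- by move=> x; rewrite -sgE; apply: normal_exp_le1 => //; rewrite sgE.
Qed.

(** The terms in [q k] serve the energy estimate, where squared Brownian increments occur; moments
    of stochastic sums use [q = 0]. The bound on [q k * h] keeps the Gaussian integral of each step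
    finite and under control. *)
Lemma exp_supermartingale (t0 h : R) (n : nat) (q : nat -> R)
    (a : nat -> 'I_d -> Omega -> R) :
  0 <= t0 -> 0 < h -> grid t0 h n <= T ->
  (forall k, (k < n)%N -> 0 <= q k /\ q k * h <= 4^-1) ->
  (forall k i, (k < n)%N -> measurable_wrt (Ft (grid t0 h k)) (a k i)) ->
  (\int[P]_w (expR (\sum_(k < n) \sum_(i < d)
     (a k i w * coord_incr W t0 h k i w + q k * coord_incr W t0 h k i w ^+ 2
      - a k i w ^+ 2 * h - 2 * q k * h)))%:E <= 1)%E.
Proof.
move=> t00 h0 nT Hq Ha.
have h0' := ltW h0.
pose E k w := \sum_(i < d) (a k i w * coord_incr W t0 h k i w
  + q k * coord_incr W t0 h k i w ^+ 2 - a k i w ^+ 2 * h - 2 * q k * h).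
have mE k : (k < n)%N -> measurable_wrt (Ft (grid t0 h k.+1)) (E k).
  move=> kn.
  have kT : grid t0 h k.+1 <= T by apply: le_trans nT; exact: le_grid.
  have mx i := coord_incr_measurable_wrt i t00 h0' kT.
  have ma i : measurable_wrt (Ft (grid t0 h k.+1)) (a k i).
    apply: (measurable_wrt_later _ _ kT (Ha k i kn)); last exact: le_grid.
    by rewrite addr_ge0// mulr_ge0.
  apply: measurable_sum => i.
  apply: measurable_funB => //; apply: measurable_funB.
    apply: measurable_funD; first exact: measurable_funM (ma i) (mx i).
    by apply: measurable_funM => //; exact: measurable_funX (mx i).
  by apply: measurable_funM => //; exact: measurable_funX (ma i).
suff H m : (m <= n)%N -> (\int[P]_w (expR (\sum_(k < m) E k w))%:E <= 1)%E.
  exact: (H n).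
elim: m => [_|m IH mn].
  under eq_integral do rewrite big_ord0 expR0.
  by rewrite integral_cst// mul1e; exact: probability_le1.
apply: le_trans (IH (ltnW mn)).
have mT : grid t0 h m.+1 <= T by apply: le_trans nT; exact: le_grid.
have hE : grid t0 h m.+1 - grid t0 h m = h by rewrite gridS; ring.
have [qm0 qm4] := Hq m mn.
have := @bm_step_expectation_le (grid t0 h m) (grid t0 h m.+1) (q m)
  (fun w => expR (\sum_(k < m) E k w)) (a m).
rewrite hE => step.
under eq_integral do rewrite big_ord_recr expRD /= [expR (E m _)]expR_sum.
apply: step => //.
- by rewrite addr_ge0// mulr_ge0.
- by rewrite -subr_gt0 hE.
- apply: (measurableT_comp (@measurable_expR R)).
  rewrite (_ : (fun w => _) = (fun w => \sum_(k <- index_enum 'I_m) E k w))//.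
  apply: measurable_sum => k.
  have km := leq_trans (ltn_ord k) (ltnW mn).
  apply: (measurable_wrt_later _ _ _ (mE k km)) => //.
  + by rewrite addr_ge0// mulr_ge0.
  + exact: le_grid.
  + by apply: le_trans nT; apply: le_grid => //; exact: ltnW.
- by move=> i; exact: Ha.
Qed.

End ExponentialSupermartingale.

(** * Expectation bounds and Fatou's lemma *)

Section MeanBounds.
Context (disp : measure_display) (R : realType) (Omega : measurableType disp).
Variable P : probability Omega R.
Implicit Types (f g : Omega -> R) (C D c : R).

(** Measurability and sign travel with the bound, so that such bounds can be added and scaled
    without side conditions. *)
Definition mean_le (f : Omega -> R) (C : R) : Prop :=
  [/\ measurable_fun setT f, (forall w, 0 <= f w) &
      (\int[P]_w (f w)%:E <= C%:E)%E].

Lemma mean_le_weaken f C D : C <= D -> mean_le f C -> mean_le f D.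
Proof. by move=> CD [mf f0 fC]; split => //; rewrite (le_trans fC)// lee_fin. Qed.

Lemma mean_le_cst (C : R) : 0 <= C -> mean_le (fun=> C) C.
Proof.
move=> C0; split => //.
rewrite integral_cst// -[leRHS]mule1 lee_pmul ?lee_fin//.
exact: probability_le1.
Qed.

Lemma mean_le_bounded f g C : measurable_fun setT f ->
  (forall w, 0 <= f w <= g w) -> mean_le g C -> mean_le f C.
Proof.
move=> mf fg [mg g0 gC]; split => //; first by move=> w; case/andP: (fg w).
apply: le_trans gC; apply: ge0_le_integral => //.
- by move=> w _; rewrite lee_fin; case/andP: (fg w).
- exact/measurable_EFinP.
- exact/measurable_EFinP.
- by move=> w _; rewrite lee_fin; case/andP: (fg w).
Qed.

Lemma mean_leD f g C D : mean_le f C -> mean_le g D ->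
  mean_le (fun w => f w + g w) (C + D).
Proof.
move=> [mf f0 fC] [mg g0 gD]; split; first exact: measurable_funD.
  by move=> w; rewrite addr_ge0.
under eq_integral do rewrite EFinD.
rewrite ge0_integralD//.
- by rewrite EFinD leeD.
- by move=> w _; rewrite lee_fin.
- exact/measurable_EFinP.
- by move=> w _; rewrite lee_fin.
- exact/measurable_EFinP.
Qed.

Lemma mean_leZ c f C : 0 <= c -> mean_le f C ->
  mean_le (fun w => c * f w) (c * C).
Proof.
move=> c0 [mf f0 fC]; split; first exact: measurable_funM.
  by move=> w; rewrite mulr_ge0.
under eq_integral do rewrite EFinM.
rewrite ge0_integralZl//.
- by rewrite EFinM lee_pmul// ?lee_fin//; apply: integral_ge0 => w _;
    rewrite lee_fin.
- exact/measurable_EFinP.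
- by move=> w _; rewrite lee_fin.
Qed.

Lemma mean_le_sum (I : Type) (s : seq I) (f : I -> Omega -> R) (C : R) :
  (forall i, mean_le (f i) C) ->
  mean_le (fun w => \sum_(i <- s) f i w) ((size s)%:R * C).
Proof.
move=> fC; elim: s => [|i s IH].
  by under eq_fun do rewrite big_nil; rewrite mul0r; exact: mean_le_cst.
under eq_fun do rewrite big_cons.
by rewrite /= -natr1 mulrDl mul1r addrC; exact: mean_leD.
Qed.

Lemma size_index_ord (n : nat) : size (index_enum 'I_n) = n.
Proof. by rewrite [index_enum _]unlock -enumT size_enum_ord. Qed.

Lemma mean_le_avg (n : nat) (f : nat -> Omega -> R) (C : R) : (0 < n)%N ->
  (forall k, (k < n)%N -> mean_le (f k) C) ->
  mean_le (fun w => n%:R^-1 * \sum_(k < n) f k w) C.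
Proof.
move=> n0 fC.
have := @mean_le_sum 'I_n (index_enum 'I_n) (fun k w => f k w) C
  (fun k => fC k (ltn_ord k)).
move=> /(@mean_leZ n%:R^-1 _ _ _).
rewrite invr_ge0 ler0n => /(_ isT).
rewrite size_index_ord mulKf//.
by rewrite pnatr_eq0 -lt0n.
Qed.

(** The integral of a nonnegative function is a supremum over the simple functions below it, hence
    monotone for arbitrary functions. This is how the iterated integral is handled. *)
Lemma le_integral_nonmeasurable (f g : Omega -> \bar R) :
  (forall w, 0 <= f w)%E -> (forall w, f w <= g w)%E ->
  (\int[P]_w f w <= \int[P]_w g w)%E.
Proof.
move=> f0 fg; rewrite !ge0_integralTE//; last first.
  by move=> w; exact: le_trans (fg w).
apply: le_ereal_sup => _ [h /= hf <-]; exists h => //= w.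
exact: le_trans (fg w).
Qed.

(** Setting the measurable majorant to infinity on the exceptional null set makes the inequality
    hold everywhere without changing its integral. *)
Lemma ae_le_integral_nonmeasurable (f g : Omega -> \bar R) :
  (forall w, 0 <= f w)%E -> (forall w, 0 <= g w)%E -> measurable_fun setT g ->
  {ae P, forall w, (f w <= g w)%E} -> (\int[P]_w f w <= \int[P]_w g w)%E.
Proof.
move=> f0 g0 mg [N [mN PN0 fgN]].
pose g' := fun w => if w \in N then +oo%E else g w.
have mg' : measurable_fun setT g'.
  apply: measurable_fun_if => //.
    by apply: (@measurable_fun_bool _ _ _ _ true); rewrite setTI preimage_mem_true.
  exact: measurable_funTS.
have -> : (\int[P]_w g w = \int[P]_w g' w)%E.
  apply: ge0_ae_eq_integral => //.
    by move=> w _; rewrite /g'; case: ifP.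
  exists N; split => // w /=; rewrite /g'; case: ifPn => [|_]; first by rewrite inE.
  by move=> H; exfalso; apply: H.
apply: le_integral_nonmeasurable => // w; rewrite /g'; case: ifPn => [_|].
  by rewrite leey.
by rewrite notin_setE => Nw; apply: contrapT => H; apply: Nw; exact: fgN.
Qed.

(** The pathwise hypothesis says that [Z] lies almost surely below the lower limit of [G n]. The
    rank [n0] may depend on the sample point, which is all that grid estimates provide. *)
Lemma fatou_mean_le (Z : Omega -> R) (G : nat -> Omega -> R) (C : R) :
  (forall w, 0 <= Z w) -> (forall n, mean_le (G n) C) ->
  {ae P, forall w, forall e, 0 < e ->
    exists n0, forall n, (n0 <= n)%N -> Z w <= G n w + e} ->
  (\int[P]_w (Z w)%:E <= C%:E)%E.
Proof.
move=> Z0 GC H.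
have mG n : measurable_fun setT (fun w => (G n w)%:E).
  by apply/measurable_EFinP; case: (GC n).
have G0 n w : (0 <= (G n w)%:E)%E by rewrite lee_fin; case: (GC n).
apply: (@le_trans _ _ (\int[P]_w limn_einf (fun n => (G n w)%:E)))%E.
  apply: ae_le_integral_nonmeasurable.
  - by move=> w; rewrite lee_fin.
  - move=> w; rewrite limn_einf_lim; apply: lime_ge.
      exact: is_cvg_einfs.
    by apply: nearW => n; apply: le_ereal_inf_tmp => _ [k _ <-].
  - apply: (emeasurable_fun_cvg (fun n w => einfs (fun k => (G k w)%:E) n)).
      by move=> n; exact: measurable_fun_einfs.
    by move=> w _; rewrite limn_einf_lim; exact: is_cvg_einfs.
  - apply: filterS H => w Hw.
    apply/lee_addgt0Pr => e e0; have [n0 Hn] := Hw e e0.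
    rewrite -leeBlDr// limn_einf_lim.
    apply: lime_ge; first exact: is_cvg_einfs.
    exists n0 => // n /= n0n; apply: le_ereal_inf_tmp => _ [k /= nk <-].
    by rewrite -EFinD lee_fin lerBlDr Hn// (leq_trans n0n).
apply: le_trans (fatou _ _ _ _) _ => //.
rewrite limn_einf_lim; apply: lime_le; first exact: is_cvg_einfs.
apply: nearW => n; apply: le_trans (_ : _ <= \int[P]_w (G n w)%:E)%E _.
  by apply: ereal_inf_lbound; exists n => //=.
by case: (GC n).
Qed.

End MeanBounds.

Section PowerMeans.
Context (R : realType).

Lemma exprn_tangent_le (a x : R) (m : nat) : 0 <= a -> 0 <= x ->
  a ^+ m + m%:R * a ^+ m.-1 * (x - a) <= x ^+ m.
Proof.
move=> a0 x0; elim: m => [|m IH]; first by rewrite !expr0 mul0r mul0r addr0.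
rewrite [leRHS]exprS; apply: (le_trans _ (ler_wpM2l x0 IH)).
rewrite -subr_ge0; case: m {IH} => [|m] /=.
  by rewrite expr0 expr1 mul0r mul0r addr0 mul1r; lra.
rewrite (_ : _ - _ = m.+1%:R * a ^+ m * (x - a) ^+ 2); last first.
  by rewrite !exprS -[in m.+2%:R]natr1; ring.
by rewrite mulr_ge0 ?sqr_ge0// mulr_ge0// exprn_ge0.
Qed.

(** Jensen's inequality: the tangent inequality of the power function is summed at the mean, where
    the linear terms cancel. *)
Lemma power_mean_le (I : Type) (s : seq I) (x : I -> R) (m : nat) :
  (0 < size s)%N -> (forall i, 0 <= x i) ->
  ((size s)%:R^-1 * \sum_(i <- s) x i) ^+ m <=
    (size s)%:R^-1 * \sum_(i <- s) x i ^+ m.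
Proof.
move=> s0 x0; set n := (size s)%:R; set a := n^-1 * _.
have n0 : 0 < n by rewrite ltr0n.
have a0 : 0 <= a by rewrite mulr_ge0 ?invr_ge0 ?ler0n ?sumr_ge0.
rewrite ler_pdivlMl//.
have sE : \sum_(i <- s) x i = n * a by rewrite mulVKf// gt_eqF.
have -> : n * a ^+ m = \sum_(i <- s) (a ^+ m + m%:R * a ^+ m.-1 * (x i - a)).
  rewrite big_split /= -big_distrr /= sumrB sE !big_const_seq !count_predT.
  by rewrite !iter_addr_0 -[a *+ _]mulr_natl subrr mulr0 addr0 mulr_natl.
by apply: ler_sum => i _; exact: exprn_tangent_le.
Qed.

Lemma power_sum_le (I : Type) (s : seq I) (x : I -> R) (m : nat) :
  (0 < size s)%N -> (forall i, 0 <= x i) ->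
  (\sum_(i <- s) x i) ^+ m <= (size s)%:R ^+ m * \sum_(i <- s) x i ^+ m.
Proof.
move=> s0 x0; have := power_mean_le m s0 x0.
set n := (size _)%:R; have n1 : 1 <= n by rewrite ler1n.
have n0 : 0 < n by rewrite (lt_le_trans _ n1).
rewrite exprMn exprVn ler_pdivrMl ?exprn_gt0// => H.
apply: le_trans H _.
rewrite ler_wpM2l ?exprn_ge0 ?(ltW n0)//.
by rewrite ler_piMl ?invf_le1// sumr_ge0// => j _; exact: exprn_ge0.
Qed.

Lemma exprn_le_expR (m : nat) (x : R) : 0 <= x -> x ^+ m <= m`!%:R * expR x.
Proof.
move=> x0; case: m => [|m]; first by rewrite expr0 fact0 mul1r -expR0 ler_expR.
have := expR_ge1Dxn m x0 => H.
rewrite mulrC -ler_pdivrMr ?ltr0n ?fact_gt0//; apply: le_trans H.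
by rewrite lerDr.
Qed.

End PowerMeans.

Section MartingaleMoments.
Context (R : realType) (T : R) (d : nat).
Context (disp : measure_display) (Omega : measurableType disp).
Variables (P : probability Omega R) (Ft : R -> set (set Omega)).
Variable W : R -> Omega -> 'cV[R]_d.
Hypothesis basis : complete_basis T P Ft.
Hypothesis brownian : is_brownian_motion T P Ft W.

Definition ito_sum (t0 h : R) (n : nat) (a : nat -> 'I_d -> Omega -> R)
    (w : Omega) : R :=
  \sum_(k < n) \sum_(i < d) a k i w * coord_incr W t0 h k i w.

Let quad_sum (h : R) (n : nat) (a : nat -> 'I_d -> Omega -> R) (w : Omega) : R :=
  h * \sum_(k < n) \sum_(i < d) a k i w ^+ 2.

Lemma measurable_sum_ord (n : nat) (f : nat -> Omega -> R) :
  (forall k, (k < n)%N -> measurable_fun setT (f k)) ->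
  measurable_fun setT (fun w => \sum_(k < n) f k w).
Proof.
move=> mf; elim: n mf => [|n IH] mf.
  by under eq_fun do rewrite big_ord0; exact: measurable_cst.
under eq_fun do rewrite big_ord_recr.
apply: measurable_funD; last exact: mf.
by apply: IH => k kn; apply: mf; exact: ltnW.
Qed.

Lemma grid_itv (t0 h : R) (n k : nat) : 0 <= t0 -> 0 <= h ->
  grid t0 h n <= T -> (k <= n)%N -> 0 <= grid t0 h k <= T.
Proof.
move=> t00 h0 nT kn; apply/andP; split; first by rewrite addr_ge0// mulr_ge0.
by apply: le_trans nT; exact: le_grid.
Qed.

Lemma measurable_coord_incr (t0 h : R) (k : nat) (i : 'I_d) :
  0 <= t0 -> 0 <= h -> grid t0 h k.+1 <= T ->
  measurable_fun setT (coord_incr W t0 h k i).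
Proof.
move=> t00 h0 kT.
apply: (measurable_wrt_measurable (basis_sub basis (grid_itv t00 h0 kT (leqnn _)))).
exact: (coord_incr_measurable_wrt basis brownian).
Qed.

Lemma exp_supermartingale_mean_le (t0 h : R) (n : nat) (q : nat -> R)
    (a : nat -> 'I_d -> Omega -> R) :
  0 <= t0 -> 0 < h -> grid t0 h n <= T ->
  (forall k, (k < n)%N -> 0 <= q k /\ q k * h <= 4^-1) ->
  (forall k i, (k < n)%N -> measurable_wrt (Ft (grid t0 h k)) (a k i)) ->
  mean_le P (fun w => expR (\sum_(k < n) \sum_(i < d)
     (a k i w * coord_incr W t0 h k i w + q k * coord_incr W t0 h k i w ^+ 2
      - a k i w ^+ 2 * h - 2 * q k * h))) 1.
Proof.
move=> t00 h0 nT Hq ma; have h0' := ltW h0.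
have maT k i : (k < n)%N -> measurable_fun setT (a k i).
  move=> kn; apply: measurable_wrt_measurable (ma k i kn).
  exact: (basis_sub basis (grid_itv t00 h0' nT (ltnW kn))).
have mxT k i : (k < n)%N -> measurable_fun setT (coord_incr W t0 h k i).
  move=> kn; apply: measurable_coord_incr => //.
  by apply: le_trans nT; exact: le_grid.
split.
- apply: (measurableT_comp (@measurable_expR R)).
  apply: (measurable_sum_ord (f := fun k w => \sum_(i < d)
    (a k i w * coord_incr W t0 h k i w + q k * coord_incr W t0 h k i w ^+ 2
      - a k i w ^+ 2 * h - 2 * q k * h))) => k kn.
  apply: measurable_sum => i; apply: measurable_funB => //; apply: measurable_funB.
    apply: measurable_funD; first by apply: measurable_funM; [exact: maT|exact: mxT].
    by apply: measurable_funM => //; apply: measurable_funX; exact: mxT.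
  by apply: measurable_funM => //; apply: measurable_funX; exact: maT.
- by move=> w; exact: expR_ge0.
- exact: (exp_supermartingale basis brownian).
Qed.

Lemma exp_ito_sum_mean_le (t0 h : R) (n : nat) (a : nat -> 'I_d -> Omega -> R) :
  0 <= t0 -> 0 < h -> grid t0 h n <= T ->
  (forall k i, (k < n)%N -> measurable_wrt (Ft (grid t0 h k)) (a k i)) ->
  mean_le P (fun w => expR (ito_sum t0 h n a w - quad_sum h n a w)) 1.
Proof.
move=> t00 h0 nT ma.
have q0 k : (k < n)%N -> 0 <= (0 : R) /\ 0 * h <= 4^-1.
  by move=> kn; rewrite mul0r invr_ge0.
have := exp_supermartingale_mean_le t00 h0 nT q0 ma.
congr mean_le; apply/funext => w; congr expR.
rewrite /ito_sum /quad_sum mulr_sumr -sumrB; apply: eq_bigr => k _.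
rewrite mulr_sumr -sumrB; apply: eq_bigr => i _.
by rewrite !(mul0r, mulr0, addr0, subr0) mulrC [h * _]mulrC.
Qed.

(* With S the sum and V its bracket, either |S| <= 2 V, or |S| / 2 <= |S| - V
   and |S|^m is dominated by the exponential supermartingales of S and - S. *)
Lemma ito_sum_moment (m : nat) (t0 h : R) (n : nat)
    (a : nat -> 'I_d -> Omega -> R) (A : nat -> Omega -> R) (C : R) :
  0 <= t0 -> 0 < h -> (0 < n)%N -> grid t0 h n <= T ->
  (forall k i, (k < n)%N -> measurable_wrt (Ft (grid t0 h k)) (a k i)) ->
  (forall k w, (k < n)%N -> n%:R * h * \sum_(i < d) a k i w ^+ 2 <= A k w) ->
  (forall k, (k < n)%N -> mean_le P (fun w => A k w ^+ m) C) ->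
  mean_le P (fun w => `|ito_sum t0 h n a w| ^+ m)
    (2 ^+ m * C + m`!%:R * 2 ^+ m * 2).
Proof.
move=> t00 h0 n0 nT ma aA AC; have h0' := ltW h0.
pose S := ito_sum t0 h n a; pose V := quad_sum h n a.
have EP := exp_ito_sum_mean_le t00 h0 nT ma.
pose b k i w := - a k i w.
have mb k i : (k < n)%N -> measurable_wrt (Ft (grid t0 h k)) (b k i).
  by move=> kn; apply: measurableT_comp => //; exact: ma.
have EN := exp_ito_sum_mean_le t00 h0 nT mb.
have SN w : ito_sum t0 h n b w = - S w.
  rewrite /ito_sum -sumrN; apply: eq_bigr => k _.
  by rewrite -sumrN; apply: eq_bigr => i _; rewrite mulNr.
have VN w : quad_sum h n b w = V w.
  by congr (_ * _); apply: eq_bigr => k _; apply: eq_bigr => i _; rewrite sqrrN.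
have maT k i : (k < n)%N -> measurable_fun setT (a k i).
  move=> kn; apply: measurable_wrt_measurable (ma k i kn).
  exact: (basis_sub basis (grid_itv t00 h0' nT (ltnW kn))).
apply: (@mean_le_bounded _ _ _ _ _ (fun w =>
    2 ^+ m * (n%:R^-1 * \sum_(k < n) A k w ^+ m)
    + m`!%:R * 2 ^+ m * (expR (S w - V w)
      + expR (ito_sum t0 h n b w - quad_sum h n b w)))).
- apply: measurable_funX; apply: measurableT_comp => //.
  apply: (measurable_sum_ord (f := fun k w =>
    \sum_(i < d) a k i w * coord_incr W t0 h k i w)) => k kn.
  apply: measurable_sum => i; apply: measurable_funM; first exact: maT.
  apply: measurable_coord_incr => //.
  by apply: le_trans nT; exact: le_grid.
- move=> w; rewrite exprn_ge0//= SN VN.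
  have A0 k : (k < n)%N -> 0 <= A k w.
    move=> kn; apply: le_trans (aA k w kn).
    by rewrite !mulr_ge0// sumr_ge0// => i _; exact: sqr_ge0.
  have V0 : 0 <= V w.
    rewrite mulr_ge0// sumr_ge0// => k _.
    by rewrite sumr_ge0// => i _; exact: sqr_ge0.
  (* [A k] bounds what the bracket would be if step [k] were repeated over the whole interval, so
     the true bracket is at most their mean and Jensen moves the power inside. *)
  have VA : V w <= n%:R^-1 * \sum_(k < n) A k w.
    rewrite ler_pdivlMl ?ltr0n// mulrA mulr_sumr.
    by apply: ler_sum => k _; exact: aA.
  have VAm : V w ^+ m <= n%:R^-1 * \sum_(k < n) A k w ^+ m.
    apply: (@le_trans _ _ ((n%:R^-1 * \sum_(k < n) A k w) ^+ m)).
      by apply: lerXn2r => //; rewrite nnegrE// (le_trans V0).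
    have := @power_mean_le R _ (index_enum 'I_n) (fun k => A k w) m.
    by rewrite size_index_ord; apply => // k; exact: A0.
  have Am0 : 0 <= n%:R^-1 * \sum_(k < n) A k w ^+ m.
    by rewrite (le_trans _ VAm)// exprn_ge0.
  have e1 := expR_ge0 (S w - V w); have e2 := expR_ge0 (- S w - V w).
  have [SV|VS] := leP `|S w| (2 * V w).
    apply: (@le_trans _ _ ((2 * V w) ^+ m)).
      by apply: lerXn2r => //; rewrite nnegrE// mulr_ge0.
    rewrite exprMn -[leLHS]addr0; apply: lerD.
      by rewrite ler_wpM2l// exprn_ge0.
    by apply: mulr_ge0; [rewrite mulr_ge0// exprn_ge0|exact: addr_ge0].
  rewrite -[leLHS]add0r lerD//; first by rewrite mulr_ge0// exprn_ge0.
  have -> : `|S w| = 2 * (`|S w| / 2) by field.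
  rewrite exprMn [_ * 2 ^+ m]mulrC -mulrA ler_wpM2l ?exprn_ge0//.
  apply: le_trans (exprn_le_expR m (_ : 0 <= `|S w| / 2)) _; first by rewrite divr_ge0.
  rewrite ler_wpM2l//.
  apply: (@le_trans _ _ (expR (`|S w| - V w))); first by rewrite ler_expR; lra.
  have [S0|S0] := leP 0 (S w); first by rewrite ger0_norm// lerDl.
  by rewrite ltr0_norm// lerDr.
- apply: mean_leD.
    by apply: mean_leZ; [rewrite exprn_ge0|
      exact: (@mean_le_avg _ _ _ P n (fun k w => A k w ^+ m))].
  apply: mean_leZ; first by rewrite mulr_ge0// exprn_ge0.
  by apply: mean_leD; [exact: EP|exact: EN].
Qed.

End MartingaleMoments.

(** * Consequences of the assumptions on the coefficients *)

Section SupNorm.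
Context (R : realType) (m n : nat).
Implicit Types A : 'M[R]_(m, n).

Lemma mx_norm_le A (c : R) : 0 <= c -> (forall i j, `|A i j| <= c) -> `|A| <= c.
Proof.
move=> c0 H; rewrite /Num.norm /= mx_normrE.
by apply: bigmax_le => // -[i j] _; exact: H.
Qed.

Lemma coord_le_mx_norm A i j : `|A i j| <= `|A|.
Proof.
rewrite [leRHS]/Num.norm /= mx_normrE.
exact: (le_bigmax _ (fun ij => `|A ij.1 ij.2|) (i, j)).
Qed.

End SupNorm.

Lemma continuous_sum (R : realType) (S : topologicalType) (I : Type) (s : seq I)
    (f : I -> S -> R) :
  (forall i, continuous (f i)) -> continuous (fun u => \sum_(i <- s) f i u).
Proof.
move=> cf; elim: s => [|i s IH].
  rewrite (_ : (fun u => _) = fun=> 0); first exact: cst_continuous.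
  by apply/funext => u; rewrite big_nil.
rewrite (_ : (fun u => _) = f i \+ (fun u => \sum_(j <- s) f j u)).
  by move=> u; apply: continuousD; [exact: cf|exact: IH].
by apply/funext => u; rewrite big_cons.
Qed.

Lemma nonneg_quadratic_eq0 (R : realType) (b g : R) : 0 <= g ->
  (forall t, 0 <= 2 * t * b + t ^+ 2 * g) -> b = 0.
Proof.
(* The minimiser is - b / g; [g + 1] avoids the case [g = 0], and the value is still negative unless
   [b = 0]. *)
move=> g0 H; have := H (- b / (g + 1)).
have -> : 2 * (- b / (g + 1)) * b + (- b / (g + 1)) ^+ 2 * g
    = - (b ^+ 2 * (g + 2) / (g + 1) ^+ 2) by field; lra.
rewrite oppr_ge0 ler_pdivrMr; last by rewrite exprn_gt0//; lra.
rewrite mul0r => H'; apply/eqP; rewrite -sqrf_eq0 eq_le sqr_ge0 andbT.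
by have := sqr_ge0 b; nra.
Qed.

Section RayleighQuotient.
Context (R : realType) (d : nat).
Implicit Types (u v : 'rV[R]_d) (S : 'M[R]_d).

Let bil S u v : R := (u *m S *m v^T) 0 0.

Let sqn u : R := \sum_i u 0 i ^+ 2.

Let bilE S u v : bil S u v = \sum_j (\sum_i u 0 i * S i j) * v 0 j.
Proof. by rewrite /bil mxE; apply: eq_bigr => j _; rewrite !mxE. Qed.

Let bil1 u : bil 1%:M u u = sqn u.
Proof. by rewrite /bil mulmx1 mxE; apply: eq_bigr => j _; rewrite mxE. Qed.

Let sqn_eq0 u : sqn u = 0 -> u = 0.
Proof.
move/eqP; rewrite psumr_eq0; last by move=> i _; exact: sqr_ge0.
move/allP => H; apply/rowP => i; rewrite mxE.
by have := H i (mem_index_enum i); rewrite sqrf_eq0 => /eqP.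
Qed.

Let continuous_coord i : continuous (fun u => u 0 i : R).
Proof. exact: coord_continuous. Qed.

Let continuous_bil S : continuous (fun u => bil S u u).
Proof.
rewrite (_ : (fun u => _) = fun u => \sum_j (\sum_i u 0 i * S i j) * u 0 j).
  apply: continuous_sum => j u; apply: continuousM; last first.
    exact: continuous_coord.
  apply: continuous_sum => i v; apply: continuousM; last exact: cst_continuous.
  exact: continuous_coord.
by apply/funext => u; rewrite bilE.
Qed.

Let bilD S u v t : S^T = S ->
  bil S (u + t *: v) (u + t *: v) = bil S u u + 2 * t * bil S v u + t ^+ 2 * bil S v v.
Proof.
move=> ST.
have sym x y : bil S x y = bil S y x.
  rewrite /bil (_ : x *m S *m y^T = (y *m S *m x^T)^T); first by rewrite mxE.
  by rewrite !trmx_mul trmxK ST mulmxA.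
have -> : bil S (u + t *: v) (u + t *: v) =
    bil S u u + t * bil S u v + t * bil S v u + t ^+ 2 * bil S v v.
  rewrite /bil linearD /= linearZ /= !mulmxDl !mulmxDr -!scalemxAl -!scalemxAr.
  by rewrite !mxE; ring.
by rewrite (sym u v); ring.
Qed.

(* A minimiser of the quadratic form on the unit sphere is an eigenvector. *)
Lemma symmetric_form_ge S (l : R) u : S^T = S ->
  (forall a, eigenvalue S a -> l <= a) -> l * sqn u <= bil S u u.
Proof.
move=> ST eigS.
have [->|u0] := eqVneq u 0.
  rewrite /sqn big1 ?mulr0; last by move=> i _; rewrite mxE expr0n.
  by rewrite /bil !mul0mx mxE.
pose K := [set v | sqn v = 1].
have sq0 v : 0 <= sqn v by rewrite sumr_ge0// => i _; exact: sqr_ge0.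
have sqp v : v != 0 -> 0 < sqn v.
  move=> v0; rewrite lt0r sq0 andbT; apply/eqP => /sqn_eq0 v0'.
  by rewrite v0' eqxx in v0.
have sqnZ t v : sqn (t *: v) = t ^+ 2 * sqn v.
  by rewrite /sqn mulr_sumr; apply: eq_bigr => i _; rewrite mxE exprMn.
have bilZ A t v : bil A (t *: v) (t *: v) = t ^+ 2 * bil A v v.
  by rewrite /bil linearZ /= -!scalemxAl -scalemxAr !mxE; ring.
have normK v : v != 0 -> K ((Num.sqrt (sqn v))^-1 *: v).
  move=> v0; rewrite /K /= sqnZ exprVn sqr_sqrtr// mulVf//.
  by rewrite gt_eqF// sqp.
have cK : compact K.
  apply: bounded_closed_compact.
    exists 1; split => // M M1 v Kv /=.
    apply: (le_trans _ (ltW M1)).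
    apply: mx_norm_le => // i j.
    rewrite ord1 -(@ler_pXn2r _ 2%N) ?nnegrE// expr1n real_normK ?num_real//.
    rewrite -Kv /sqn (bigD1 j)//= lerDl.
    by rewrite sumr_ge0// => k _; exact: sqr_ge0.
  have -> : K = (fun v => bil 1%:M v v) @^-1` [set 1].
    by apply/seteqP; split => v; rewrite /K /= bil1.
  by apply: preimage_closed; [|exact: closed_eq]; move=> v _; exact: continuous_bil.
have [c Kc minc] := EVT_min_rV (ex_intro _ _ (normK u u0)) cK
  (continuous_subspaceT (@continuous_bil S)).
set mu := bil S c c in minc.
have Sge v : mu * sqn v <= bil S v v.
  have [->|v0] := eqVneq v 0.
    rewrite /sqn big1 ?mulr0; last by move=> i _; rewrite mxE expr0n.
    by rewrite /bil !mul0mx mxE.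
  have := minc _ (mem_set (normK v v0)).
  rewrite bilZ exprVn sqr_sqrtr// ler_pdivlMl ?sqp// mulrC.
  by [].
have c1 : sqn c = 1 by move: Kc; rewrite inE.
pose B := S - mu%:M.
have BT : B^T = B by rewrite /B linearB /= ST tr_scalar_mx.
have bilB v : bil B v v = bil S v v - mu * sqn v.
  by rewrite -bil1 /bil /B mulmxBr mulmxBl mul_mx_scalar mulmx1 -scalemxAl !mxE.
have B0 v : 0 <= bil B v v by rewrite bilB subr_ge0.
have Bc : bil B c c = 0 by rewrite bilB c1 mulr1 subrr.
(* [B] is positive semidefinite with B(c, c) = 0, so its form at c + t w equals 2 t |w|^2 + t^2 B(w,
   w). Nonnegativity for every t forces w = 0, which is the eigenvector equation for [c]. *)
pose w := c *m B.
have ww : bil B w c = sqn w.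
  rewrite -bil1 /bil mulmx1 -mulmxA (_ : B *m c^T = w^T)//.
  by rewrite /w trmx_mul BT.
have w0 : sqn w = 0.
  apply: (@nonneg_quadratic_eq0 R (sqn w) (bil B w w)) => // t.
  by have := B0 (c + t *: w); rewrite bilD// Bc ww add0r.
have eigc : eigenvalue S mu.
  apply/eigenvalueP; exists c.
    move/sqn_eq0 : w0; rewrite /w /B mulmxBr mul_mx_scalar => /eqP.
    by rewrite subr_eq0 => /eqP.
  by apply/eqP => c0; move: c1; rewrite c0 /sqn big1 => [/eqP|i _];
    rewrite ?mxE ?expr0n// eq_sym oner_eq0.
by apply: le_trans (Sge u); rewrite ler_wpM2r// eigS.
Qed.

End RayleighQuotient.

(** * Uniform continuity and expansion of primitives on a segment *)

Section UniformContinuity.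
Context (R : realType) (V : normedModType R) (T : R) (f : R -> V).
Hypothesis cf : {within `[0, T], continuous f}.

Let near_cont (x e : R) : 0 <= x <= T -> 0 < e ->
  exists2 r : R, 0 < r & forall z, 0 <= z <= T -> `|z - x| < r -> `|f z - f x| <= e.
Proof.
move=> xT e0.
have : f @ within `[0, T] (nbhs x) --> f x.
  rewrite nbhs_subspace_in; last by rewrite /= in_itv.
  exact: cf.
move=> /cvgrPdist_le /(_ e e0).
rewrite near_withinE => /nbhs_ballP[r /= r0 H]; exists r => // z zT zx.
rewrite distrC; apply: H; last by rewrite /= in_itv.
by rewrite /ball /= distrC.
Qed.

Lemma segment_uniform_continuous (e : R) : 0 < e ->
  exists2 r : R, 0 < r & forall u v, 0 <= u <= T -> 0 <= v <= T ->
    `|v - u| < r -> `|f v - f u| <= e.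
Proof.
move=> e0.
pose Q (r x : R) := forall v, 0 <= x <= T -> 0 <= v <= T ->
  `|v - x| < r -> `|f v - f x| <= e.
have : \forall r \near 0^'+, `[0, T] `<=` Q r.
  apply: (compact_near_coveringP _).1; first exact: segment_compact.
  move=> x; rewrite /= in_itv /= => xT.
  have [r r0 H] := near_cont xT (divr_gt0 e0 (ltr0n R 2)).
  exists (ball x (r / 2), [set s | s < r / 2]).
    split; first by apply: nbhsx_ballx; rewrite divr_gt0.
    by apply: nbhs_right_lt; rewrite divr_gt0.
  move=> [x' s] [/= xx' sr] v x'T vT vx'.
  have h1 : `|v - x| < r.
    rewrite (_ : v - x = (v - x') - (x - x')); last by ring.
    apply: le_lt_trans (ler_normB _ _) _; rewrite [r]splitr.
    by apply: ltrD => //; exact: lt_trans vx' sr.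
  have h2 : `|x' - x| < r.
    by move: xx'; rewrite /ball /= distrC => xx'; lra.
  rewrite (_ : f v - f x' = (f v - f x) - (f x' - f x)); last first.
    by rewrite opprB addrA subrK.
  apply: le_trans (ler_normB _ _) _; rewrite [e]splitr.
  by apply: lerD; exact: H.
move=> [r /= r0 H]; exists (r / 2); first by rewrite divr_gt0.
move=> u v uT vT vu.
apply: (H (r / 2)) => //=.
- rewrite sub0r normrN gtr0_norm ?divr_gt0// ltr_pdivrMr// ltr_pMr// ltr1n//.
- by rewrite divr_gt0.
Qed.

Lemma segment_bounded : exists2 B : R, 0 <= B &
  forall u, 0 <= u <= T -> `|f u| <= B.
Proof.
pose Q (M x : R) := 0 <= x <= T -> `|f x| <= M.
have : \forall M \near +oo, `[0, T] `<=` Q M.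
  apply: (compact_near_coveringP _).1; first exact: segment_compact.
  move=> x; rewrite /= in_itv /= => xT.
  have [r r0 H] := near_cont xT ltr01.
  exists (ball x r, [set s | `|f x| + 1 <= s]).
    by split; [exact: nbhsx_ballx|exact: nbhs_pinfty_ge].
  move=> [x' s] [/= xx' sr] x'T; apply: le_trans sr.
  rewrite -[f x'](subrK (f x)) addrC; apply: le_trans (ler_normD _ _) _.
  by rewrite lerD2l H// distrC.
move=> [M [_ H]]; exists (Num.max M 0 + 1).
  by rewrite addr_ge0// le_max lexx orbT.
move=> u uT; apply: (H (Num.max M 0 + 1)) => //=.
by rewrite ltr_pwDr// le_max lexx.
Qed.

End UniformContinuity.

Section IntegralIncrement.
Context (R : realType) (T : R) (f : R -> R).
Hypothesis cf : {within `[0, T], continuous f}.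

Let mu := @lebesgue_measure R.

(** First-order expansion of the primitive, with an error controlled uniformly in the base point by
    uniform continuity; the integral equations are used on grids in this form. *)
Lemma integral_increment (e : R) : 0 < e ->
  exists2 r : R, 0 < r & forall u v, 0 <= u -> u <= v -> v <= T -> v - u < r ->
    `|\int[mu]_(z in `[0, v]) f z - \int[mu]_(z in `[0, u]) f z - (v - u) * f u|
      <= e * (v - u).
Proof.
move=> e0; have [r r0 H] := segment_uniform_continuous cf e0.
exists r => // u v u0 uv vT vur.
have intf a b : 0 <= a -> b <= T ->
    mu.-integrable `]a, b] (EFin \o f).
  move=> a0 bT; have : mu.-integrable `[0, T] (EFin \o f).
    by apply: continuous_compact_integrable => //; exact: segment_compact.
  apply: integrableS => // z /=; rewrite !in_itv /= => /andP[az zb].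
  by rewrite (le_trans a0 (ltW az)) (le_trans zb bT).
have intf0 b : b <= T -> mu.-integrable `[0, b] (EFin \o f).
  move=> bT; have : mu.-integrable `[0, T] (EFin \o f).
    by apply: continuous_compact_integrable => //; exact: segment_compact.
  apply: integrableS => // z /=; rewrite !in_itv /= => /andP[-> zb] /=.
  exact: le_trans zb bT.
rewrite (Rintegral_itvB (intf0 v vT)) ?bnd_simp//.
have muuv : fine (mu `]u, v]) = v - u.
  rewrite /mu lebesgue_measure_itv /= lte_fin.
  by move: uv; rewrite le_eqVlt => /predU1P[->|->]//; rewrite ltxx subrr.
have icst c : mu.-integrable `]u, v] (EFin \o cst c).
  apply: integrableS (_ : mu.-integrable `[u, v] _) => //.
    by apply: subset_itv; rewrite bnd_simp.
  apply: continuous_compact_integrable; first exact: segment_compact.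
  by move=> z; exact: cvg_cst.
have iB : mu.-integrable `]u, v] (EFin \o (fun z => f z - f u)).
  have mI : @measurable _ (measurableTypeR R) `]u, v] by exact: measurable_itv.
  have := integrableB mI (intf u v u0 vT) (icst (f u)).
  by apply: eq_integrable.
have -> : (v - u) * f u = \int[mu]_(z in `]u, v]) (cst (f u)) z.
  by rewrite Rintegral_cst//= muuv mulrC.
rewrite -RintegralB//; last exact: intf.
apply: le_trans (le_normr_Rintegral _ iB) _ => //.
apply: (@le_trans _ _ (\int[mu]_(z in `]u, v]) (cst e) z)); last first.
  by rewrite Rintegral_cst//= muuv.
apply: le_Rintegral => //.
  by have /integrable_norm := iB.
move=> z /=; rewrite in_itv /= => /andP[uz zv].
apply: H.
- by rewrite u0 (le_trans uv).
- by rewrite (le_trans u0 (ltW uz)) (le_trans zv).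
- by rewrite ger0_norm ?subr_ge0 ?(ltW uz)// (le_lt_trans _ vur)// lerB.
Qed.

End IntegralIncrement.

Section EuclideanNorm.
Context (R : realType).

Lemma mx_norm_le_enorm (m n : nat) (A : 'M[R]_(m, n)) : `|A| <= enorm A.
Proof.
apply: mx_norm_le => [|i j]; first exact: sqrtr_ge0.
rewrite -sqrtr_sqr ler_wsqrtr// (bigD1 i)//= (bigD1 j)//= -addrA lerDl.
by rewrite addr_ge0 ?sumr_ge0// => k _; rewrite ?sumr_ge0// => *; exact: sqr_ge0.
Qed.

Lemma enorm_le_mx_norm (m n : nat) (A : 'M[R]_(m, n)) :
  enorm A <= (m * n)%:R * `|A|.
Proof.
have nA : 0 <= `|A| := normr_ge0 A.
rewrite -[leRHS]ger0_norm ?mulr_ge0// -sqrtr_sqr ler_wsqrtr//.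
apply: (@le_trans _ _ (\sum_(i < m) \sum_(j < n) `|A| ^+ 2)).
  apply: ler_sum => i _; apply: ler_sum => j _.
  by rewrite -real_normK ?num_real// lerXn2r ?nnegrE// coord_le_mx_norm.
rewrite sumr_const sumr_const !card_ord -mulrnA exprMn mulnC -[leLHS]mulr_natl.
rewrite ler_wpM2r ?sqr_ge0// -natrX ler_nat.
by case: (m * n)%N => // k; rewrite expnS expn1 leq_pmulr.
Qed.

Lemma mx_norm_mulmx_le (m n p : nat) (A : 'M[R]_(m, n)) (B : 'M[R]_(n, p)) :
  `|A *m B| <= n%:R * `|A| * `|B|.
Proof.
apply: mx_norm_le => [|i j]; first by rewrite !mulr_ge0.
rewrite mxE; apply: le_trans (ler_norm_sum _ _ _) _.
apply: (@le_trans _ _ (\sum_(k < n) `|A| * `|B|)).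
  by apply: ler_sum => k _; rewrite normrM ler_pM// coord_le_mx_norm.
by rewrite sumr_const card_ord -mulrA -[leLHS]mulr_natl.
Qed.

Lemma elipschitz_mx_norm (d m n : nat) (f : 'cV[R]_d -> 'M[R]_(m, n)) :
  elipschitz f -> exists2 L : R, 0 <= L & forall x y, `|f x - f y| <= L * `|x - y|.
Proof.
move=> [L fL]; exists (`|L| * (d * 1)%:R); first by rewrite mulr_ge0.
move=> x y; apply: le_trans (mx_norm_le_enorm _) _; apply: le_trans (fL x y) _.
apply: (@le_trans _ _ (`|L| * enorm (x - y))).
  by rewrite ler_wpM2r ?sqrtr_ge0// ler_norm.
by rewrite -mulrA ler_wpM2l// enorm_le_mx_norm.
Qed.

Lemma lipschitz_mx_continuous (d m n : nat) (f : 'cV[R]_d -> 'M[R]_(m, n)) (L : R) :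
  (forall x y, `|f x - f y| <= L * `|x - y|) -> continuous f.
Proof.
move=> fL x; apply/(@cvgrPdist_le _ _ _ (nbhs x)) => e e0.
have L0 : 0 < `|L| + 1 by rewrite ltr_wpDl.
apply/nbhs_ballP; exists (e / (`|L| + 1)) => /=; first by rewrite divr_gt0.
move=> y [_ xy]; apply: le_trans (fL x y) _.
have {}xy : `|x - y| <= e / (`|L| + 1).
  apply: mx_norm_le => [|i j]; first by rewrite divr_ge0// ltW.
  by rewrite !mxE ltW//; exact: xy.
apply: (@le_trans _ _ ((`|L| + 1) * `|x - y|)).
  by rewrite ler_wpM2r// (le_trans (ler_norm _))// lerDl.
by rewrite -ler_pdivlMl// mulrC.
Qed.

End EuclideanNorm.

(** The assumptions in the form used by the estimates, in the sup norm of matrices; one constant [K]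
    bounds both M^-1 and F. *)
Record coef_bounds (R : realType) (d : nat) (M : 'cV[R]_d -> 'M[R]_d)
    (F : 'cV[R]_d -> 'cV[R]_d) (l K L : R) : Prop := CoefBounds {
  coef_l_gt0 : 0 < l ;
  coef_K_ge0 : 0 <= K ;
  coef_L_ge0 : 0 <= L ;
  coef_coercive : forall x y : 'cV[R]_d,
    l * \sum_i y i 0 ^+ 2 <= \sum_i y i 0 * (M x *m y) i 0 ;
  coef_mulVmx : forall x, invmx (M x) *m M x = 1%:M ;
  coef_inv_bounded : forall x, `|invmx (M x)| <= K ;
  coef_inv_lipschitz : forall x x',
    `|invmx (M x) - invmx (M x')| <= L * `|x - x'| ;
  coef_F_bounded : forall x, `|F x| <= K ;
  coef_M_continuous : continuous M ;
  coef_inv_continuous : continuous (fun x => invmx (M x)) ;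
  coef_F_continuous : continuous F }.

Lemma assumptions_coef_bounds (R : realType) (d : nat)
    (M : 'cV[R]_d -> 'M[R]_d) (F : 'cV[R]_d -> 'cV[R]_d) :
  assumption_A1 M -> assumption_A2 M -> assumption_A3 M -> assumption_A4 F ->
  exists l K L, coef_bounds M F l K L.
Proof.
move=> [l l0 eigM] [CM CN] [_ lipN _ [K1 NK]] [lipF [K2 FK]].
have [L L0 NL] := elipschitz_mx_norm lipN.
have [L' L'0 FL] := elipschitz_mx_norm lipF.
have coer (x y : 'cV[R]_d) :
    l * \sum_i y i 0 ^+ 2 <= \sum_i y i 0 * (M x *m y) i 0.
  have sT : (2^-1 *: (M x + (M x)^T))^T = 2^-1 *: (M x + (M x)^T).
    by rewrite linearZ /= linearD /= trmxK addrC.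
  have := symmetric_form_ge y^T sT (eigM x).
  under eq_bigr do rewrite mxE.
  move=> /le_trans; apply; rewrite trmxK -scalemxAr -scalemxAl mulmxDr mulmxDl.
  have -> : y^T *m (M x)^T *m y = (y^T *m M x *m y)^T.
    by rewrite !trmx_mul trmxK mulmxA.
  have EQ (Q : 'M[R]_1) : (2^-1 *: (Q + Q^T)) 0 0 = Q 0 0.
    by rewrite !mxE; lra.
  rewrite EQ -mulmxA mxE le_eqVlt; apply/orP; left; apply/eqP.
  by apply: eq_bigr => i _; rewrite mxE.
(* [invmx] is the inverse only for invertible matrices and otherwise returns its argument.
   Coercivity makes the kernel trivial. *)
have unitM x : M x \in unitmx.
  rewrite -row_free_unit -kermx_eq0; apply/eqP/row_matrixP => i; rewrite row0.
  set v := row i _; have vM : v *m M x = 0.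
    by rewrite /v -row_mul mulmx_ker row0.
  have := coer x v^T.
  rewrite (_ : \sum_j v^T j 0 * (M x *m v^T) j 0 = (v *m M x *m v^T) 0 0); last first.
    by rewrite -mulmxA [RHS]mxE; apply: eq_bigr => j _; rewrite mxE.
  rewrite vM mul0mx mxE pmulr_rle0// => H.
  apply/rowP => j; rewrite [RHS]mxE; apply/eqP; rewrite -sqrf_eq0.
  rewrite eq_le sqr_ge0 andbT; apply: le_trans H.
  rewrite (bigD1 j)//= [v^T j 0]mxE lerDl.
  by apply: sumr_ge0 => k _; exact: sqr_ge0.
exists l, (`|K1| + `|K2|), L; split => //.
- by move=> x; exact: mulVmx.
- move=> x; apply: le_trans (mx_norm_le_enorm _) _; apply: le_trans (NK x) _.
  by rewrite (le_trans (ler_norm _))// lerDl.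
- move=> x; apply: le_trans (mx_norm_le_enorm _) _; apply: le_trans (FK x) _.
  by rewrite (le_trans (ler_norm _))// lerDr.
- by case: CM.
- by case: CN.
- exact: lipschitz_mx_continuous FL.
Qed.

(** * Paths of the system on fine grids *)

Section FineProperties.
Context (R : realType) (T : R).

(** A filter of properties of short intervals, uniform in their position: the error estimates of one
    path can be intersected freely, and the result holds on every step of a fine enough uniform
    grid. *)
Definition eventually_fine (Q : R -> R -> Prop) : Prop :=
  exists2 r : R, 0 < r & forall u v, 0 <= u -> u <= v -> v <= T -> v - u < r -> Q u v.

Lemma eventually_fine_mono (Q Q' : R -> R -> Prop) :
  (forall u v, 0 <= u -> u <= v -> v <= T -> Q u v -> Q' u v) ->
  eventually_fine Q -> eventually_fine Q'.
Proof. by move=> QQ [r r0 H]; exists r => // u v u0 uv vT uvr; apply: QQ; auto. Qed.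

Lemma eventually_fine_and (Q Q' : R -> R -> Prop) :
  eventually_fine Q -> eventually_fine Q' ->
  eventually_fine (fun u v => Q u v /\ Q' u v).
Proof.
move=> [r r0 H] [r' r'0 H']; exists (Num.min r r'); first by rewrite lt_min r0.
by move=> u v u0 uv vT; rewrite lt_min => /andP[h h']; split; auto.
Qed.

Lemma eventually_fine_forall (d : nat) (Q : 'I_d -> R -> R -> Prop) :
  (forall i, eventually_fine (Q i)) -> eventually_fine (fun u v => forall i, Q i u v).
Proof.
move=> H.
suff K (s : seq 'I_d) : eventually_fine (fun u v => forall i, i \in s -> Q i u v).
  by apply: eventually_fine_mono (K (enum 'I_d)) => u v _ _ _ h i;
    apply: h; rewrite mem_enum.
elim: s => [|i s IH]; first by exists 1 => // u v _ _ _ _ i.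
apply: eventually_fine_mono (eventually_fine_and (H i) IH) => u v _ _ _ [h1 h2] j.
by rewrite inE => /predU1P[->//|]; exact: h2.
Qed.

Lemma eventually_fine_lt (r : R) : 0 < r -> eventually_fine (fun u v => v - u < r).
Proof. by move=> r0; exists r. Qed.

Lemma eventually_fine_grid (Q : R -> R -> Prop) (s t : R) : 0 <= s -> s < t -> t <= T ->
  eventually_fine Q -> exists n0, forall n, (n0 <= n)%N -> forall k, (k < n.+1)%N ->
    let h := (t - s) / n.+1%:R in Q (grid s h k) (grid s h k.+1).
Proof.
move=> s0 st tT [r r0 H].
have st0 : 0 < t - s by rewrite subr_gt0.
exists (Num.truncn ((t - s) / r)) => n n0 k kn h.
have n1 : 0 < n.+1%:R :> R by rewrite ltr0n.
have h0 : 0 < h by rewrite divr_gt0.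
have hr : h < r.
  rewrite ltr_pdivrMr// mulrC -ltr_pdivrMr//.
  by apply: lt_le_trans (truncnS_gt _) _; rewrite ler_nat ltnS.
have gn : grid s h n.+1 = t
  by rewrite /grid /h mulrC divfK ?gt_eqF// addrC subrK.
apply: H.
- by rewrite addr_ge0// mulr_ge0// ltW.
- by apply: le_grid => //; exact: ltW.
- by rewrite -gn in tT; apply: le_trans tT; apply: le_grid => //; exact: ltW.
- by rewrite gridS addrAC subrr add0r.
Qed.

End FineProperties.

Section VectorIntegral.
Context (R : realType) (T : R) (d : nat).

Lemma vintegral_increment (f : R -> 'cV[R]_d) (e : R) : 0 < e ->
  (forall i, {within `[0, T], continuous (fun u => f u i 0)}) ->
  eventually_fine T (fun u v =>
    `|vintegral v f - vintegral u f - (v - u) *: f u| <= e * (v - u)).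
Proof.
move=> e0 cf.
apply: eventually_fine_mono (eventually_fine_forall
  (fun i => integral_increment (cf i) e0)) => u v _ uv _ H.
apply: mx_norm_le => [|i j]; first by rewrite mulr_ge0 ?(ltW e0)// subr_ge0.
by rewrite ord1 !mxE; exact: H.
Qed.

Lemma within_coord (m n : nat) (f : R -> 'M[R]_(m, n)) (i : 'I_m) (j : 'I_n) :
  {within `[0, T], continuous f} -> {within `[0, T], continuous (fun u => f u i j)}.
Proof.
move=> cf u; apply: (@continuous_comp (subspace `[0, T]) 'M[R]_(m, n) R f (fun v => v i j) u).
  exact: cf.
exact: coord_continuous.
Qed.

Lemma within_comp (U V : topologicalType) (f : R -> U) (g : U -> V) :
  {within `[0, T], continuous f} -> continuous g ->
  {within `[0, T], continuous (fun u => g (f u))}.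
Proof.
move=> cf cg u; apply: (@continuous_comp (subspace `[0, T]) U V f g u).
  exact: cf.
exact: cg.
Qed.

End VectorIntegral.

(** The system at a fixed sample point, with noise path [om]. Everything up to Fatou's lemma, apart
    from the bounds on stochastic sums, is a deterministic statement about such triples. *)
Record is_path (R : realType) (T : R) (d : nat) (M : 'cV[R]_d -> 'M[R]_d)
    (F : 'cV[R]_d -> 'cV[R]_d) (eps : R) (x y om : R -> 'cV[R]_d) : Prop := IsPath {
  path_x_continuous : {within `[0, T], continuous x} ;
  path_y_continuous : {within `[0, T], continuous y} ;
  path_eqx : forall t, 0 <= t <= T -> x t = eps^-1 *: vintegral t y ;
  path_eqy : forall t, 0 <= t <= T ->
    y t = - (eps ^- 2 *: vintegral t (fun u => M (x u) *m y u))
          + eps^-1 *: vintegral t (fun u => F (x u)) + eps^-1 *: om t ;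
  path_om0 : om 0 = 0 }.

Section PathIncrements.
Context (R : realType) (T : R) (d : nat).
Variables (M : 'cV[R]_d -> 'M[R]_d) (F : 'cV[R]_d -> 'cV[R]_d) (l K L : R).
Hypothesis MF : coef_bounds M F l K L.
Variables (eps : R) (x y om : R -> 'cV[R]_d).
Hypothesis eps01 : 0 < eps <= 1.
Hypothesis path : is_path T M F eps x y om.

Let eps_gt0 : 0 < eps. Proof. by case/andP: eps01. Qed.

Definition drift (u : R) : 'cV[R]_d :=
  - (eps ^- 2 *: (M (x u) *m y u)) + eps^-1 *: F (x u).

Let cMy i : {within `[0, T], continuous (fun u => (M (x u) *m y u) i 0)}.
Proof.
rewrite (_ : (fun u => _) = fun u => \sum_j M (x u) i j * y u j 0); last first.
  by apply/funext => u; rewrite mxE.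
apply: (@continuous_sum _ (subspace `[0, T])) => j u; apply: continuousM.
  apply: (@within_coord _ T _ _ (fun u => M (x u))).
  by apply: within_comp (path_x_continuous path) _; exact: coef_M_continuous MF.
exact: (within_coord (path_y_continuous path)).
Qed.

Let cFx : {within `[0, T], continuous (fun u => F (x u))}.
Proof.
by apply: within_comp (path_x_continuous path) _; exact: coef_F_continuous MF.
Qed.

Lemma drift_bounded : exists2 B, 0 <= B & forall u, 0 <= u <= T -> `|drift u| <= B.
Proof.
have /choice [B HB] i : exists B : R, 0 <= B /\
    forall u, 0 <= u <= T -> `|(M (x u) *m y u) i 0| <= B.
  by have [B B0 H] := segment_bounded (@cMy i); exists B.
have sB0 : 0 <= \sum_i B i by apply: sumr_ge0 => i _; case: (HB i).
exists (eps ^- 2 * (\sum_i B i) + eps^-1 * K).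
  by rewrite addr_ge0 ?mulr_ge0 ?invr_ge0 ?exprn_ge0 ?(coef_K_ge0 MF)// ltW.
move=> u uT; apply: le_trans (ler_normD _ _) _; apply: lerD.
  rewrite normrN normrZ ger0_norm ?invr_ge0 ?exprn_ge0 ?(ltW eps_gt0)//.
  rewrite ler_wpM2l ?invr_ge0 ?exprn_ge0 ?(ltW eps_gt0)//.
  apply: mx_norm_le => // i j; rewrite ord1.
  apply: le_trans ((HB i).2 u uT) _; rewrite (bigD1 i)//= lerDl.
  by apply: sumr_ge0 => k _; case: (HB k).
rewrite normrZ ger0_norm ?invr_ge0 ?(ltW eps_gt0)//.
by rewrite ler_wpM2l ?invr_ge0 ?(ltW eps_gt0)//; exact: coef_F_bounded MF _.
Qed.

Lemma x_increment (e : R) : 0 < e -> eventually_fine T (fun u v =>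
  `|x v - x u - ((v - u) / eps) *: y u| <= e * (v - u)).
Proof.
move=> e0; have e0' : 0 < e * eps by rewrite mulr_gt0.
apply: eventually_fine_mono (vintegral_increment e0'
  (fun i => within_coord (i := i) (j := 0) (path_y_continuous path))) => u v u0 uv vT H.
rewrite !(path_eqx path); last 2 first.
- by rewrite u0 (le_trans uv).
- by rewrite (le_trans u0 uv).
rewrite -scalerBr mulrC -scalerA -scalerBr normrZ ger0_norm ?invr_ge0 ?(ltW eps_gt0)//.
by rewrite ler_pdivrMl// mulrA (mulrC eps).
Qed.

Lemma y_increment (e : R) : 0 < e -> eventually_fine T (fun u v =>
  `|y v - y u - (v - u) *: drift u - eps^-1 *: (om v - om u)| <= e * (v - u)).
Proof.
move=> e0.
have e1 : 0 < e / 2 * eps ^+ 2 by rewrite mulr_gt0 ?divr_gt0 ?exprn_gt0.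
have e2 : 0 < e / 2 * eps by rewrite mulr_gt0 ?divr_gt0.
apply: eventually_fine_mono (eventually_fine_and (vintegral_increment e1 (@cMy))
  (vintegral_increment e2 (fun i => within_coord (i := i) (j := 0) (@cFx))))
  => u v u0 uv vT [H1 H2].
rewrite !(path_eqy path); last 2 first.
- by rewrite u0 (le_trans uv).
- by rewrite (le_trans u0 uv).
set a := vintegral v _ in H1 *; set b := vintegral u _ in H1 *.
set a' := vintegral v _ in H2 *; set b' := vintegral u _ in H2 *.
rewrite (_ : _ - _ = - (eps ^- 2 *: (a - b - (v - u) *: (M (x u) *m y u)))
    + eps^-1 *: (a' - b' - (v - u) *: F (x u))); last first.
  by apply/colP => i; rewrite /drift !mxE; ring.
apply: le_trans (ler_normD _ _) _.
rewrite normrN !normrZ !ger0_norm ?invr_ge0 ?exprn_ge0 ?(ltW eps_gt0)//.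
rewrite (_ : e * (v - u) = eps ^- 2 * (e / 2 * eps ^+ 2 * (v - u))
  + eps^-1 * (e / 2 * eps * (v - u))); last by field; rewrite gt_eqF.
by apply: lerD; rewrite ler_wpM2l// ?invr_ge0 ?exprn_ge0 ?(ltW eps_gt0).
Qed.

Lemma y_uniform (e : R) : 0 < e -> eventually_fine T (fun u v => `|y v - y u| <= e).
Proof.
move=> e0; have [r r0 H] := segment_uniform_continuous (path_y_continuous path) e0.
exists r => // u v u0 uv vT uvr; apply: H.
- by rewrite u0 (le_trans uv).
- by rewrite (le_trans u0 uv).
- by rewrite ger0_norm// subr_ge0.
Qed.

End PathIncrements.

(** * The energy estimate *)

Definition sumsq (R : realType) (d : nat) (v : 'cV[R]_d) : R := \sum_i v i 0 ^+ 2.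

Lemma sumsq_ge0 (R : realType) (d : nat) (v : 'cV[R]_d) : 0 <= sumsq v.
Proof. by apply: sumr_ge0 => i _; exact: sqr_ge0. Qed.

Lemma mx_norm_sqr_le_sumsq (R : realType) (d : nat) (v : 'cV[R]_d) :
  `|v| ^+ 2 <= sumsq v.
Proof.
rewrite -[leRHS]sqr_sqrtr ?sumsq_ge0// lerXn2r ?nnegrE ?sqrtr_ge0//.
apply: mx_norm_le => [|i j]; first exact: sqrtr_ge0.
rewrite ord1 -sqrtr_sqr ler_wsqrtr// /sumsq (bigD1 i)//= lerDl.
by apply: sumr_ge0 => k _; exact: sqr_ge0.
Qed.

Lemma sumsq_le_mx_norm (R : realType) (d : nat) (v : 'cV[R]_d) :
  sumsq v <= d%:R * `|v| ^+ 2.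
Proof.
apply: (@le_trans _ _ (\sum_(i < d) `|v| ^+ 2)).
  apply: ler_sum => i _.
  by rewrite -real_normK ?num_real// lerXn2r ?nnegrE// coord_le_mx_norm.
by rewrite sumr_const card_ord -[leLHS]mulr_natl.
Qed.

Lemma expR_le_quadratic (R : realType) (z : R) : 0 <= z -> z <= 2^-1 ->
  expR z <= 1 + z + 2 * z ^+ 2.
Proof.
move=> z0 z1; have := expR_ge1Dx (- z); rewrite expRN => H.
have e0 := expR_gt0 z.
have H' : (1 - z) * expR z <= 1.
  by rewrite -ler_pdivlMr// div1r.
have : (1 - z) * expR z <= (1 - z) * (1 + z + 2 * z ^+ 2).
  apply: le_trans H' _; have : 0 <= z ^+ 2 * (1 - 2 * z).
    by rewrite mulr_ge0 ?sqr_ge0//; lra.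
  by nra.
by rewrite ler_pM2l//; lra.
Qed.

(** [q] stands for the noise, whose square is of order h and is therefore kept; the square of the
    drift part [h * b + r] is of order h^2 and joins the error. *)
Lemma coord_energy_le (R : realType) (y b r q h Y B eta : R) :
  0 <= h -> 0 <= eta -> `|y| <= Y -> `|b| <= B -> `|r| <= eta * h ->
  (y + (h * b + r) + q) ^+ 2 <=
    y ^+ 2 + 2 * h * (y * b) + 2 * (y * q) + 2 * q ^+ 2
    + (2 * eta * h * Y + 2 * (h * (B + eta)) ^+ 2).
Proof.
move=> h0 eta0 yY bB rh.
have Y0 : 0 <= Y by exact: le_trans yY.
have yr : y * r <= eta * h * Y.
  apply: le_trans (ler_norm _) _; rewrite normrM mulrC.
  by rewrite ler_pM.
have p2 : (h * b + r) ^+ 2 <= (h * (B + eta)) ^+ 2.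
  rewrite -real_normK ?num_real// lerXn2r ?nnegrE//.
    by rewrite mulr_ge0// addr_ge0// (le_trans _ bB).
  apply: le_trans (ler_normD _ _) _; rewrite mulrDr lerD//; last by rewrite mulrC.
  by rewrite normrM ger0_norm// ler_wpM2l.
have pq : 0 <= (h * b + r - q) ^+ 2 := sqr_ge0 _.
by move: yr p2 pq; set P := (h * (B + eta)) ^+ 2; nra.
Qed.

Section Energy.
Context (R : realType) (T : R) (d : nat).
Variables (M : 'cV[R]_d -> 'M[R]_d) (F : 'cV[R]_d -> 'cV[R]_d) (l K L : R).
Hypothesis MF : coef_bounds M F l K L.
Variables (eps : R) (x y om : R -> 'cV[R]_d).
Hypothesis eps01 : 0 < eps <= 1.
Hypothesis path : is_path T M F eps x y om.

Let eps_gt0 : 0 < eps. Proof. by case/andP: eps01. Qed.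
Let l_gt0 : 0 < l := coef_l_gt0 MF.

Let c : R := l / eps ^+ 2.
Let D : R := 2 * d%:R * K ^+ 2 / l.
Let c_gt0 : 0 < c. Proof. by rewrite divr_gt0// exprn_gt0. Qed.

(** Coercivity gives -2 c |y|^2. Young's inequality spends a quarter of it on the term y F / eps; as
    that term has only one factor 1 / eps, the remainder [D] does not depend on eps. *)
Lemma drift_dissipative (u : R) :
  2 * \sum_i y u i 0 * drift M F eps x y u i 0 <= - (3 / 2) * c * sumsq (y u) + D.
Proof.
have -> : \sum_i y u i 0 * drift M F eps x y u i 0 =
    - (eps ^- 2) * \sum_i y u i 0 * (M (x u) *m y u) i 0
    + eps^-1 * \sum_i y u i 0 * F (x u) i 0.
  rewrite !mulr_sumr -big_split /=; apply: eq_bigr => i _.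
  rewrite /drift; move: (M (x u) *m y u) => Q.
  by rewrite !mxE; ring.
have H1 := coef_coercive MF (x u) (y u).
have H2 : 2 * (eps^-1 * \sum_i y u i 0 * F (x u) i 0)
    <= 2^-1 * c * sumsq (y u) + D.
  rewrite /sumsq !mulr_sumr.
  apply: (@le_trans _ _ (\sum_i (2^-1 * c * y u i 0 ^+ 2 + 2 * K ^+ 2 / l))).
    apply: ler_sum => i _.
    have FK : F (x u) i 0 ^+ 2 <= K ^+ 2.
      rewrite -real_normK ?num_real// lerXn2r ?nnegrE ?(coef_K_ge0 MF)//.
      by apply: le_trans (coord_le_mx_norm _ _ _) _; exact: coef_F_bounded MF _.
    have Fl : 2 * F (x u) i 0 ^+ 2 / l <= 2 * K ^+ 2 / l.
      by rewrite ler_pM2r ?invr_gt0// ler_wpM2l.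
    apply: le_trans (lerD (lexx _) Fl).
    rewrite -subr_ge0 (_ : _ - _ = 2^-1 * l * (y u i 0 / eps - 2 / l * F (x u) i 0) ^+ 2).
      by rewrite mulr_ge0 ?sqr_ge0// mulr_ge0// ltW.
    by rewrite /c; field; rewrite !gt_eqF.
  rewrite big_split /= sumr_const card_ord lerD2l /D -[leLHS]mulr_natl.
  by rewrite mulrA (mulrA d%:R) (mulrC d%:R 2).
have H3 : - (eps ^- 2) * \sum_i y u i 0 * (M (x u) *m y u) i 0 <= - (c * sumsq (y u)).
  by rewrite /c mulNr lerN2 mulrAC ler_pdivrMr ?exprn_gt0// mulrAC mulVf ?mul1r//
    gt_eqF// exprn_gt0.
by rewrite mulrDr; lra.
Qed.

Lemma energy_increment (rho : R) : 0 < rho -> eventually_fine T (fun u v =>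
  sumsq (y v) <= sumsq (y u) + (v - u) * (- (3 / 2) * c * sumsq (y u) + D)
    + 2 / eps * (\sum_i y u i 0 * (om v - om u) i 0)
    + 2 / eps ^+ 2 * sumsq (om v - om u) + rho * (v - u)).
Proof.
move=> rho0.
have [Y Y0 HY] := segment_bounded (path_y_continuous path).
have [B B0 HB] := drift_bounded MF eps01 path.
have d0 : 0 <= d%:R :> R by [].
(* [eta] limits the cost of the expansion error to [rho / 2] per unit time, and the step bound [r]
   below does the same for the squared drift. *)
pose eta := Num.min 1 (rho / (4 * (d%:R + 1) * (Y + 1))).
have eta0 : 0 < eta.
  by rewrite lt_min ltr01 divr_gt0// !mulr_gt0//; lra.
have eta1 : eta <= 1 by rewrite ge_min lexx.
have etaY : 2 * d%:R * eta * Y <= rho / 2.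
  have : eta <= rho / (4 * (d%:R + 1) * (Y + 1)) by rewrite ge_min lexx orbT.
  rewrite ler_pdivlMr; last by rewrite !mulr_gt0//; lra.
  move=> H; have : 0 <= eta * d%:R by rewrite mulr_ge0// ltW.
  have : 0 <= eta * Y by rewrite mulr_ge0// ltW.
  by nra.
pose r := rho / (4 * (d%:R + 1) * (B + 1) ^+ 2).
have r0 : 0 < r by rewrite divr_gt0// !mulr_gt0 ?exprn_gt0//; lra.
apply: eventually_fine_mono (eventually_fine_and (y_increment MF eps01 path eta0)
  (eventually_fine_lt T r0)) => u v u0 uv vT [H hr].
set h := v - u in H hr *.
have h0 : 0 <= h by rewrite subr_ge0.
have uT : 0 <= u <= T by rewrite u0 (le_trans uv).
set b := drift M F eps x y u in H.
set xi := om v - om u in H *.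
set e := y v - y u - h *: b - eps^-1 *: xi in H.
have cstep (i : 'I_d) : y v i 0 ^+ 2 <= y u i 0 ^+ 2 + 2 * h * (y u i 0 * b i 0)
    + 2 / eps * (y u i 0 * xi i 0) + 2 / eps ^+ 2 * xi i 0 ^+ 2
    + (2 * eta * h * Y + 2 * (h * (B + eta)) ^+ 2).
  have -> : y v i 0 = y u i 0 + (h * b i 0 + e i 0) + eps^-1 * xi i 0.
    have split (b' xi' : 'cV[R]_d) : y v i 0 = y u i 0 + (h * b' i 0
        + (y v - y u - h *: b' - eps^-1 *: xi') i 0) + eps^-1 * xi' i 0.
      by rewrite !mxE; ring.
    exact: split.
  have := @coord_energy_le R (y u i 0) (b i 0) (e i 0) (eps^-1 * xi i 0) h Y B eta
    h0 (ltW eta0) (le_trans (coord_le_mx_norm _ _ _) (HY u uT))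
    (le_trans (coord_le_mx_norm _ _ _) (HB u uT)) (le_trans (coord_le_mx_norm _ _ _) H).
  move=> /le_trans; apply; rewrite lerD2r.
  rewrite le_eqVlt; apply/orP; left; apply/eqP.
  by field; rewrite gt_eqF.
have : sumsq (y v) <= \sum_i (y u i 0 ^+ 2 + 2 * h * (y u i 0 * b i 0)
    + 2 / eps * (y u i 0 * xi i 0) + 2 / eps ^+ 2 * xi i 0 ^+ 2
    + (2 * eta * h * Y + 2 * (h * (B + eta)) ^+ 2)).
  by apply: ler_sum => i _; exact: cstep.
rewrite 4!big_split /= sumr_const card_ord -!mulr_sumr -/(sumsq (y u)) -/(sumsq xi).
move=> /le_trans; apply.
have hD : h * (2 * \sum_i y u i 0 * b i 0) <= h * (- (3 / 2) * c * sumsq (y u) + D).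
  by rewrite ler_wpM2l//; exact: drift_dissipative.
have hrho : (2 * eta * h * Y + 2 * (h * (B + eta)) ^+ 2) *+ d <= rho * h.
  rewrite -mulr_natl.
  have h1 : h * (2 * d%:R * eta * Y) <= h * (rho / 2) by rewrite ler_wpM2l.
  have h2 : 2 * d%:R * h * (B + eta) ^+ 2 <= rho / 2.
    have : h <= r by exact: ltW.
    rewrite ler_pdivlMr; last by rewrite !mulr_gt0 ?exprn_gt0//; lra.
    have Be : (B + eta) ^+ 2 <= (B + 1) ^+ 2.
      by rewrite lerXn2r ?nnegrE ?addr_ge0 ?lerD2l// ltW.
    have B1 : 0 <= (B + 1) ^+ 2 := sqr_ge0 _.
    move=> H2.
    have : h * d%:R * (B + eta) ^+ 2 <= h * d%:R * (B + 1) ^+ 2.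
      by rewrite ler_wpM2l// mulr_ge0.
    have : 0 <= h * (B + 1) ^+ 2 by rewrite mulr_ge0.
    by move: H2; set P := (B + 1) ^+ 2; set P' := (B + eta) ^+ 2; lra.
  have h3 : h * (2 * d%:R * h * (B + eta) ^+ 2) <= h * (rho / 2) by rewrite ler_wpM2l.
  by rewrite exprMn; move: h1 h3; set P := (B + eta) ^+ 2; lra.
by lra.
Qed.

Lemma energy_uniform (rho : R) : 0 < rho -> eventually_fine T (fun u v =>
  sumsq (y v) <= sumsq (y u) + rho).
Proof.
move=> rho0.
have [Y Y0 HY] := segment_bounded (path_y_continuous path).
have d0 : 0 <= d%:R :> R by [].
pose eta := Num.min 1 (rho / ((d%:R + 1) * (2 * Y + 1))).
have eta0 : 0 < eta.
  by rewrite lt_min ltr01 divr_gt0// !mulr_gt0//; lra.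
have eta1 : eta <= 1 by rewrite ge_min lexx.
have etaY : d%:R * (eta * (2 * Y + 1)) <= rho.
  have : eta <= rho / ((d%:R + 1) * (2 * Y + 1)) by rewrite ge_min lexx orbT.
  rewrite ler_pdivlMr; last by rewrite !mulr_gt0//; lra.
  have : 0 <= eta * (2 * Y + 1) by rewrite mulr_ge0 ?(ltW eta0)//; lra.
  by lra.
apply: eventually_fine_mono (y_uniform path eta0) => u v u0 uv vT H.
have uT : 0 <= u <= T by rewrite u0 (le_trans uv).
apply: (@le_trans _ _ (\sum_i (y u i 0 ^+ 2 + eta * (2 * Y + 1)))).
  apply: ler_sum => i _.
  have h1 : `|y v i 0 - y u i 0| <= eta.
    by apply: le_trans H; have := coord_le_mx_norm (y v - y u) i 0; rewrite !mxE.
  have h2 : `|y u i 0| <= Y by apply: le_trans (coord_le_mx_norm _ _ _) (HY u uT).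
  move: h1 h2; rewrite !ler_norml => /andP[h1 h1'] /andP[h2 h2'].
  by nra.
by rewrite big_split /= sumr_const card_ord -[X in _ + X]mulr_natl lerD2l.
Qed.

(** The growth of the weight uses c of the dissipation rate 3 c / 2; the remaining c / 2 is reserved
    for the bracket of the stochastic sum. The quantifier over [e] is inside [eventually_fine]
    because the weights depend on the grid, whereas the required fineness must not depend on
    them. *)
Lemma weighted_energy_increment (rho : R) : 0 < rho -> eventually_fine T (fun u v =>
  forall e, 0 <= e <= 1 ->
  e * expR (c * (v - u)) * sumsq (y v) - e * sumsq (y u)
  <= e * ((v - u) * (- (c / 2) * sumsq (y u) + D)
       + 2 / eps * (\sum_i y u i 0 * (om v - om u) i 0)
       + 2 / eps ^+ 2 * sumsq (om v - om u)) + rho * (v - u)).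
Proof.
move=> rho0.
have [Y Y0 HY] := segment_bounded (path_y_continuous path).
pose V := d%:R * Y ^+ 2.
have V0 : 0 <= V by rewrite mulr_ge0// sqr_ge0.
have rho1 : 0 < rho / 3 by rewrite divr_gt0.
have rho2 : 0 < rho / (6 * c) by rewrite divr_gt0// mulr_gt0.
have r1 : 0 < (2 * c)^-1 by rewrite invr_gt0 mulr_gt0.
have den0 : 0 < 6 * c ^+ 2 * (V + 1).
  apply: mulr_gt0; last by rewrite ltr_wpDl.
  by apply: mulr_gt0 => //; exact: exprn_gt0.
have r2 : 0 < rho / (6 * c ^+ 2 * (V + 1)) by rewrite divr_gt0.
apply: eventually_fine_mono (eventually_fine_and
  (eventually_fine_and (energy_increment rho1) (energy_uniform rho2))
  (eventually_fine_and (eventually_fine_lt T r1) (eventually_fine_lt T r2)))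
  => u v u0 uv vT [[H1 H2] [hr1 hr2]] e /andP[e0 e1].
set h := v - u in H1 hr1 hr2 *.
have h0 : 0 <= h by rewrite subr_ge0.
have uT : 0 <= u <= T by rewrite u0 (le_trans uv).
set S := sumsq (y u) in H1 H2 *; set S' := sumsq (y v) in H1 H2 *.
have S'0 : 0 <= S' := sumsq_ge0 _.
have S0 : 0 <= S := sumsq_ge0 _.
have SV : S <= V.
  apply: le_trans (sumsq_le_mx_norm _) _; rewrite ler_wpM2l// lerXn2r ?nnegrE//.
  exact: HY.
set Q1 := 2 / eps * _ in H1 *; set Q2 := 2 / eps ^+ 2 * _ in H1 *.
pose z := c * h.
have z0 : 0 <= z by rewrite mulr_ge0// ltW.
have z1 : z <= 2^-1.
  by rewrite /z -(ler_pdivlMl _ _ c_gt0) -invfM [c * 2]mulrC ltW.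
have zV : 2 * z * V <= rho / (3 * c).
  have := ltW hr2; rewrite ler_pdivlMr//.
  have c3 : 0 < 3 * c by apply: mulr_gt0.
  rewrite (ler_pdivlMr _ _ c3) /z => H.
  have : 0 <= h * c ^+ 2 by rewrite mulr_ge0// sqr_ge0.
  by nra.
have ez := expR_le_quadratic z0 z1.
have A1 : e * (expR z * S' - S') <= e * (z * S) + h * (rho / 3 + rho / 3).
  have B1 : (expR z - 1) * S' <= (z + 2 * z ^+ 2) * (S + rho / (6 * c)).
    apply: ler_pM => //; first by rewrite subr_ge0 -expR0 ler_expR.
    by lra.
  have B2 : (z + 2 * z ^+ 2) * (S + rho / (6 * c)) <= z * S + h * (rho / 3 + rho / 3).
    have C1 : z * (2 * z * S) <= z * (rho / (3 * c)).
      by rewrite ler_wpM2l//; apply: le_trans zV; rewrite ler_wpM2l// mulr_ge0.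
    have C2 : z * (rho / (3 * c)) = h * (rho / 3).
      by rewrite /z; field; rewrite gt_eqF.
    have C3 : 0 <= z * (1 - 2 * z) * (rho / (6 * c)).
      by rewrite mulr_ge0 ?(ltW rho2)// mulr_ge0//; lra.
    have C4 : z * (rho / (6 * c)) = h * (rho / 3) / 2.
      by rewrite /z; field; rewrite gt_eqF.
    by move: C3; rewrite expr2; nra.
  have -> : expR z * S' - S' = (expR z - 1) * S' by ring.
  have B3 := le_trans B1 B2.
  have hrr : 0 <= h * (rho / 3 + rho / 3) by rewrite mulr_ge0//; lra.
  apply: le_trans (ler_wpM2l e0 B3) _.
  by rewrite mulrDr lerD2l ler_piMl.
have A2 : e * (S' - S) <= e * (h * (- (3 / 2) * c * S + D) + Q1 + Q2) + h * (rho / 3).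
  have : e * (S' - S) <= e * (h * (- (3 / 2) * c * S + D) + Q1 + Q2 + rho / 3 * h).
    by rewrite ler_wpM2l//; lra.
  have e3 : e * (h * (rho / 3)) <= h * (rho / 3) by rewrite ler_piMl// mulr_ge0// ltW.
  rewrite [e * (_ + rho / 3 * h)]mulrDr [rho / 3 * h]mulrC => H3.
  by apply: le_trans H3 _; rewrite lerD2l.
rewrite -/z.
have -> : e * expR z * S' - e * S = e * (expR z * S' - S') + e * (S' - S) by ring.
apply: le_trans (lerD A1 A2) _.
by rewrite /z le_eqVlt; apply/orP; left; apply/eqP; field.
Qed.

End Energy.

Lemma grid_last (R : realType) (s t : R) (n : nat) :
  grid s ((t - s) / n.+1%:R) n.+1 = t.
Proof. by rewrite /grid mulrC divfK ?pnatr_eq0// addrC subrK. Qed.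

(* exp (- (l / eps^2) (t - t_k)), the weight that turns the dissipation of |y|^2
   into a total derivative. *)
Definition energy_weight (R : realType) (l eps t h : R) (k : nat) : R :=
  expR (- (l / eps ^+ 2 * (t - grid 0 h k))).

(** Coefficient of the Brownian increment in theta times the weighted energy inequality, with theta
    = l / 8; [energy_quad] is that of its square. The compensator of the linear part, 4 theta^2 w^2
    |y|^2 h / eps^2 for a weight w <= 1, has to stay below the reserved dissipation theta w (c / 2)
    |y|^2 h with c = l / eps^2, which asks for theta <= l / 8. *)
Definition energy_lin (R : realType) (d : nat) (l eps t h : R) (k : nat)
    (v : 'cV[R]_d) (i : 'I_d) : R :=
  2 * (l / 8) / eps * energy_weight l eps t h k * v i 0.

Definition energy_quad (R : realType) (l eps t h : R) (k : nat) : R :=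
  2 * (l / 8) / eps ^+ 2 * energy_weight l eps t h k.

Section EnergyBound.
Context (R : realType) (T : R) (d : nat).
Variables (M : 'cV[R]_d -> 'M[R]_d) (F : 'cV[R]_d -> 'cV[R]_d) (l K L : R).
Hypothesis MF : coef_bounds M F l K L.
Variables (eps : R) (x y om : R -> 'cV[R]_d).
Hypothesis eps01 : 0 < eps <= 1.
Hypothesis path : is_path T M F eps x y om.

Let eps_gt0 : 0 < eps. Proof. by case/andP: eps01. Qed.
Let l_gt0 : 0 < l := coef_l_gt0 MF.

Let c : R := l / eps ^+ 2.
Let D : R := 2 * d%:R * K ^+ 2 / l.
Let c_gt0 : 0 < c. Proof. by rewrite divr_gt0// exprn_gt0. Qed.

Lemma path_y0 : 0 <= T -> y 0 = 0.
Proof.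
move=> T0; rewrite (path_eqy path) ?lexx// (path_om0 path).
have v0 (f : R -> 'cV[R]_d) : vintegral 0 f = 0.
  by apply/colP => i; rewrite !mxE set_itv1 Rintegral_set1.
by rewrite !v0 !scaler0 oppr0 !addr0.
Qed.

(** Discrete form of the bound 1 / c for the integral of exp (- c (t - u)): since exp (c h) - 1 >= c
    h, the sum is dominated by a telescoping one. The value 1 / c = eps^2 / l is what cancels the
    factor 1 / eps^2 of the noise. *)
Lemma weight_sum_le (t h : R) (n : nat) : 0 < h -> grid 0 h n <= t ->
  h * (\sum_(k < n) expR (- (c * (t - grid 0 h k)))) <= c^-1.
Proof.
move=> h0 nt; rewrite -[leRHS]mulr1 ler_pdivlMl//.
pose f k := expR (- (c * (t - grid 0 h k))).
apply: (@le_trans _ _ (\sum_(0 <= k < n) (f k.+1 - f k))).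
  rewrite mulrA mulr_sumr big_mkord; apply: ler_sum => k _.
  have -> : f k.+1 = f k * expR (c * h).
    by rewrite /f -expRD gridS; congr expR; ring.
  rewrite -/(f k) (_ : f k * _ - f k = f k * (expR (c * h) - 1)); last by ring.
  rewrite mulrC ler_wpM2l ?expR_ge0//.
  by have := expR_ge1Dx (c * h); lra.
rewrite telescope_sumr// lerBlDr; apply: (@le_trans _ _ 1).
  by rewrite -expR0 ler_expR oppr_le0 mulr_ge0 ?subr_ge0// ltW.
by rewrite lerDl expR_ge0.
Qed.

(** The weighted increments telescope to |y t|^2, because y vanishes at 0 and the last weight is 1.
    The compensators [2 * q * h] contribute 4 d / eps^2 next to [D]; the total weight eps^2 / l
    turns l / 8 times their sum into (eps^2 D + 4 d) / 8, and eps <= 1 removes eps. *)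
Lemma energy_bound (t rho : R) : 0 < t -> t <= T -> 0 < rho ->
  exists n0, forall n, (n0 <= n)%N ->
  l / 8 * sumsq (y t) <=
    \sum_(k < n.+1) \sum_(i < d)
      (let h := (t - 0) / n.+1%:R in
       let xi := (om (grid 0 h k.+1) - om (grid 0 h k)) i 0 in
       let a := energy_lin l eps t h k (y (grid 0 h k)) i in
       let q := energy_quad l eps t h k in
       a * xi + q * xi ^+ 2 - a ^+ 2 * h - 2 * q * h)
    + (D + 4 * d%:R) / 8 + rho.
Proof.
move=> t0 tT rho0.
have th0 : 0 < l / 8 by rewrite divr_gt0.
have r0 : 0 < rho / (l / 8 * t) by rewrite divr_gt0// mulr_gt0.
have [n0 H] := eventually_fine_grid (lexx 0) t0 tT
  (weighted_energy_increment MF eps01 path r0).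
exists n0 => n n0n.
pose h := (t - 0) / n.+1%:R.
pose e := energy_weight l eps t h.
pose a k i := energy_lin l eps t h k (y (grid 0 h k)) i.
pose q := energy_quad l eps t h.
pose xi k i := (om (grid 0 h k.+1) - om (grid 0 h k)) i 0.
suff : l / 8 * sumsq (y t) <=
    \sum_(k < n.+1) \sum_(i < d) (a k i * xi k i + q k * xi k i ^+ 2
       - a k i ^+ 2 * h - 2 * q k * h) + (D + 4 * d%:R) / 8 + rho by [].
have h0 : 0 < h by rewrite divr_gt0 ?subr0.
have gl : grid 0 h n.+1 = t := grid_last 0 t n.
have e01 k : (k <= n.+1)%N -> 0 <= e k <= 1.
  move=> kn; rewrite expR_ge0 /= /e /energy_weight -expR0 ler_expR oppr_le0 mulr_ge0 ?(ltW c_gt0)//.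
  by rewrite subr_ge0 -gl; apply: le_grid => //; exact: ltW.
pose f k := e k * sumsq (y (grid 0 h k)).
have D0 : 0 <= D.
  by rewrite /D mulr_ge0 ?invr_ge0 ?(ltW l_gt0)// !mulr_ge0 ?sqr_ge0// (coef_K_ge0 MF).
have step k : (k < n.+1)%N -> l / 8 * (f k.+1 - f k) <=
    \sum_(i < d) (a k i * xi k i + q k * xi k i ^+ 2 - a k i ^+ 2 * h - 2 * q k * h)
    + (l / 8 * (D + 4 * d%:R / eps ^+ 2)) * (h * e k) + rho / n.+1%:R.
  move=> kn; have /andP[e0 e1] := e01 k (ltnW kn).
  have := H n n0n k kn (e k) (e01 k (ltnW kn)).
  rewrite -/h (_ : grid 0 h k.+1 - grid 0 h k = h); last by rewrite gridS; ring.
  have -> : e k * expR (c * h) = e k.+1.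
    by rewrite /e /energy_weight -expRD gridS -/c; congr expR; ring.
  rewrite -/(f k) -/(f k.+1) => Hk.
  have Hk' := ler_wpM2l (ltW th0) Hk.
  apply: le_trans Hk' _.
  rewrite sumrB sumrB big_split /=.
  set S := sumsq (y (grid 0 h k)).
  have E1 : \sum_(i < d) a k i * xi k i =
      l / 8 * (e k * (2 / eps * \sum_i y (grid 0 h k) i 0 *
        (om (grid 0 h k.+1) - om (grid 0 h k)) i 0)).
    by rewrite !mulr_sumr; apply: eq_bigr => i _; rewrite /a /xi /energy_lin -/(e k); ring.
  have E2 : \sum_(i < d) q k * xi k i ^+ 2 =
      l / 8 * (e k * (2 / eps ^+ 2 * sumsq (om (grid 0 h k.+1) - om (grid 0 h k)))).
    by rewrite /sumsq !mulr_sumr; apply: eq_bigr => i _; rewrite /q /xi /energy_quad -/(e k); ring.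
  have E3 : \sum_(i < d) a k i ^+ 2 * h <= l / 8 * (e k * (h * (c / 2 * S))).
    rewrite /S /sumsq !mulr_sumr; apply: ler_sum => i _.
    rewrite (_ : a k i ^+ 2 * h =
      l / 8 * (e k * (e k * (h * (c / 2 * y (grid 0 h k) i 0 ^+ 2))))).
      rewrite !ler_wpM2l ?(ltW th0)//.
      rewrite ler_piMl// mulr_ge0 ?(ltW h0)// mulr_ge0 ?sqr_ge0//.
      by rewrite mulr_ge0 ?(ltW c_gt0).
    by rewrite /a /energy_lin -/(e k) /c; field; rewrite gt_eqF.
  have E4 : \sum_(i < d) 2 * q k * h = l / 8 * (4 * d%:R / eps ^+ 2) * (h * e k).
    by rewrite sumr_const card_ord -[LHS]mulr_natl /q /energy_quad -/(e k); ring.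
  have E5 : l / 8 * (rho / (l / 8 * t) * h) = rho / n.+1%:R.
    by rewrite /h subr0; field; rewrite !gt_eqF.
  rewrite E1 E2 E4 mulrDr E5.
  rewrite lerD2r -/D mulNr.
  have gen (th ek Q1 Q2 A cS Dd q4 hh : R) : A <= th * (ek * (hh * cS)) ->
      th * (ek * (hh * (- cS + Dd) + Q1 + Q2)) <= th * (ek * Q1) + th * (ek * Q2)
        - A - th * q4 * (hh * ek) + th * (Dd + q4) * (hh * ek).
    move=> HA; rewrite -subr_ge0 (_ : _ - _ = th * (ek * (hh * cS)) - A); last by ring.
    by rewrite subr_ge0.
  exact: gen.
have -> : sumsq (y t) = \sum_(0 <= k < n.+1) (f k.+1 - f k).
  rewrite telescope_sumr// /f gl /e /energy_weight gl subrr mulr0 oppr0 expR0 mul1r grid0.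
  rewrite path_y0; last by exact: le_trans (ltW t0) tT.
  suff -> : sumsq (0 : 'cV[R]_d) = 0 by rewrite mulr0 subr0.
  by rewrite /sumsq big1// => i _; rewrite mxE expr0n.
rewrite big_mkord mulr_sumr.
apply: le_trans.
  by apply: ler_sum => k _; apply: step; exact: ltn_ord.
rewrite big_split big_split /= -[leLHS]addrA -[leRHS]addrA lerD2l.
apply: lerD; last first.
  by rewrite sumr_const card_ord -[leLHS]mulr_natl mulrC divfK ?pnatr_eq0.
rewrite -!mulr_sumr.
have ws : h * \sum_(k < n.+1) e k <= c^-1 by apply: weight_sum_le; rewrite ?gl.
have cf0 : 0 <= l / 8 * (D + 4 * d%:R / eps ^+ 2).
  rewrite mulr_ge0 ?(ltW th0)// addr_ge0// mulr_ge0 ?invr_ge0 ?exprn_ge0 ?(ltW eps_gt0)//.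
apply: le_trans (ler_wpM2l cf0 ws) _.
have -> : l / 8 * (D + 4 * d%:R / eps ^+ 2) / c = (eps ^+ 2 * D + 4 * d%:R) / 8.
  by rewrite /c; field; rewrite !gt_eqF.
rewrite ler_pM2r ?invr_gt0// lerD2r ler_piMl//.
by case/andP: eps01 => _ e1; rewrite exprn_ile1// ltW.
Qed.

End EnergyBound.

(** * Families with uniformly bounded moments *)

Section MomentFamilies.
Context (disp : measure_display) (R : realType) (Omega : measurableType disp).
Variable P : probability Omega R.

(** Uniformity in eps, in the times and in the grid is expressed by the index set. All orders are
    carried at once because a product of two families uses moments of twice the order of its
    factors; the class is then stable under sums, products and averages. *)
Definition bounded_moments (I : Type) (D : I -> Prop) (f : I -> Omega -> R) : Prop :=
  (forall i, D i -> forall w, 0 <= f i w) /\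
  forall m : nat, exists C, forall i, D i -> mean_le P (fun w => f i w ^+ m) C.

Lemma bounded_moments_measurable (I : Type) (D : I -> Prop) (f : I -> Omega -> R)
    (i : I) : bounded_moments D f -> D i ->
  measurable_fun setT (f i).
Proof. by move=> [_ /(_ 1%N) [C H]] Di; have [] := H i Di. Qed.

Section Closure.
Variables (I : Type) (D : I -> Prop).
Implicit Types f g : I -> Omega -> R.

Lemma bounded_moments_le f g : (forall i, D i -> measurable_fun setT (f i)) ->
  (forall i w, D i -> 0 <= f i w <= g i w) -> bounded_moments D g ->
  bounded_moments D f.
Proof.
move=> mf fg [g0 H]; split; first by move=> i Di w; case/andP: (fg i w Di).
move=> m; have [C HC] := H m; exists C => i Di.
apply: mean_le_bounded (HC i Di); first by apply: measurable_funX; exact: mf.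
move=> w; have /andP[f0 fgw] := fg i w Di.
by rewrite exprn_ge0//= lerXn2r// nnegrE// (le_trans f0).
Qed.

Lemma bounded_moments_cst (c : R) : 0 <= c -> bounded_moments D (fun _ _ => c).
Proof.
move=> c0; split => // m; exists (c ^+ m) => i _; apply: mean_le_cst.
exact: exprn_ge0.
Qed.

Lemma bounded_momentsD f g : bounded_moments D f -> bounded_moments D g ->
  bounded_moments D (fun i w => f i w + g i w).
Proof.
move=> bf bg; have [f0 Hf] := bf; have [g0 Hg] := bg.
split; first by move=> i Di w; rewrite addr_ge0 ?f0 ?g0.
move=> m; have [A HA] := Hf m; have [B HB] := Hg m.
exists (2 ^+ m * (A + B)) => i Di.
apply: mean_le_bounded (mean_leZ (exprn_ge0 m (ler0n R 2)) (mean_leD (HA i Di) (HB i Di))).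
  apply: measurable_funX; apply: measurable_funD.
    exact: (bounded_moments_measurable bf).
  exact: (bounded_moments_measurable bg).
move=> w; rewrite exprn_ge0 ?addr_ge0 ?f0 ?g0//=.
have := @power_sum_le R bool [:: true; false]
  (fun b => if b then f i w else g i w) m isT.
rewrite !big_cons !big_nil /= !addr0; apply.
by case; [exact: f0|exact: g0].
Qed.

Lemma bounded_momentsM f g : bounded_moments D f -> bounded_moments D g ->
  bounded_moments D (fun i w => f i w * g i w).
Proof.
move=> bf bg; have [f0 Hf] := bf; have [g0 Hg] := bg.
split; first by move=> i Di w; rewrite mulr_ge0 ?f0 ?g0.
move=> m; have [A HA] := Hf (m * 2)%N; have [B HB] := Hg (m * 2)%N.
exists (A + B) => i Di.
apply: mean_le_bounded (mean_leD (HA i Di) (HB i Di)).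
  apply: measurable_funX; apply: measurable_funM.
    exact: (bounded_moments_measurable bf).
  exact: (bounded_moments_measurable bg).
move=> w; rewrite exprn_ge0 ?mulr_ge0 ?f0 ?g0//= exprMn !exprM.
set a := f i w ^+ m; set b := g i w ^+ m.
have := sqr_ge0 (a - b); have := sqr_ge0 a; have := sqr_ge0 b.
by nra.
Qed.

Lemma bounded_moments_sum (J : Type) (s : seq J) (f : J -> I -> Omega -> R) :
  (forall j, bounded_moments D (f j)) ->
  bounded_moments D (fun i w => \sum_(j <- s) f j i w).
Proof.
move=> H; elim: s => [|j s IH].
  rewrite (_ : (fun _ _ => _) = fun _ _ => 0); first exact: bounded_moments_cst.
  by apply/funext => i; apply/funext => w; rewrite big_nil.
rewrite (_ : (fun _ _ => _) = fun i w => f j i w + \sum_(j <- s) f j i w).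
  exact: bounded_momentsD.
by apply/funext => i; apply/funext => w; rewrite big_cons.
Qed.

(** By Jensen the bound for an average is the bound for its terms, so it does not deteriorate as the
    grid is refined. *)
Lemma bounded_moments_avg (n : I -> nat) (f : I * nat -> Omega -> R) :
  bounded_moments (fun ik => D ik.1 /\ (ik.2 < (n ik.1).+1)%N) f ->
  bounded_moments D (fun i w => (n i).+1%:R^-1 * \sum_(k < (n i).+1) f (i, nat_of_ord k) w).
Proof.
move=> bf; have [f0 Hf] := bf; split.
  move=> i Di w; rewrite mulr_ge0 ?invr_ge0// sumr_ge0// => k _.
  by apply: f0; split => //=.
move=> m; have [C HC] := Hf m; exists C => i Di.
have Hk k : (k < (n i).+1)%N -> mean_le P (fun w => f (i, k) w ^+ m) C.
  by move=> kn; exact: (HC (i, k)).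
apply: mean_le_bounded (mean_le_avg (ltn0Sn (n i)) Hk).
  apply: measurable_funX; apply: measurable_funM => //.
  apply: (measurable_sum_ord (f := fun k w => f (i, k) w)) => k kn.
  exact: (bounded_moments_measurable (i := (i, k)) bf (conj Di kn)).
move=> w.
have fk0 (k : 'I_(n i).+1) : 0 <= f (i, nat_of_ord k) w.
  by apply: f0; split => //=.
rewrite exprn_ge0 ?mulr_ge0 ?invr_ge0 ?sumr_ge0//=.
have := @power_mean_le R _ (index_enum 'I_(n i).+1)
  (fun k => f (i, nat_of_ord k) w) m.
by rewrite size_index_ord; apply.
Qed.

End Closure.

Lemma bounded_moments_reindex (I J : Type) (D : I -> Prop) (E : J -> Prop)
    (phi : J -> I) (f : I -> Omega -> R) :
  (forall j, E j -> D (phi j)) -> bounded_moments D f ->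
  bounded_moments E (fun j => f (phi j)).
Proof.
move=> ED [f0 H]; split; first by move=> j Ej; apply: f0; exact: ED.
by move=> m; have [C HC] := H m; exists C => j Ej; apply: HC; exact: ED.
Qed.

Lemma bounded_moments_union (I : Type) (D D' : I -> Prop) (f : I -> Omega -> R) :
  bounded_moments D f -> bounded_moments D' f ->
  bounded_moments (fun i => D i \/ D' i) f.
Proof.
move=> [f0 H] [f0' H']; split; first by move=> i [Di|Di]; [exact: f0|exact: f0'].
move=> m; have [C HC] := H m; have [C' HC'] := H' m.
exists (Num.max C C') => i [Di|Di].
  by apply: mean_le_weaken (HC i Di); rewrite le_max lexx.
by apply: mean_le_weaken (HC' i Di); rewrite le_max lexx orbT.
Qed.

(** The conclusion is a bare integral bound and not [bounded_moments], so that it covers the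
    iterated integral as well. *)
Lemma fatou_bounded_moments (I : Type) (D : I -> Prop) (Z : I -> Omega -> R)
    (G : I * nat -> Omega -> R) :
  (forall i w, D i -> 0 <= Z i w) ->
  bounded_moments (fun ik => D ik.1) G ->
  (forall i, D i -> {ae P, forall w, exists n0, forall n, (n0 <= n)%N ->
     Z i w <= G (i, n) w}) ->
  forall m : nat, exists C, forall i, D i -> (\int[P]_w (Z i w ^+ m)%:E <= C%:E)%E.
Proof.
move=> Z0 [G0 H] HZ m; have [C HC] := H m; exists C => i Di.
apply: (@fatou_mean_le _ _ _ _ _ (fun n w => G (i, n) w ^+ m)).
- by move=> w; rewrite exprn_ge0// Z0.
- by move=> n; exact: (HC (i, n)).
- apply: filterS (HZ i Di) => w [n0 Hn] e e0; exists n0 => n n0n.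
  apply: (@le_trans _ _ (G (i, n) w ^+ m)); last by rewrite lerDl ltW.
  by rewrite lerXn2r ?nnegrE ?Z0 ?Hn//; exact: G0 (i, n) Di w.
Qed.

Lemma fatou_bounded_moments_measurable (I : Type) (D : I -> Prop)
    (Z : I -> Omega -> R) (G : I * nat -> Omega -> R) :
  (forall i w, D i -> 0 <= Z i w) ->
  (forall i, D i -> measurable_fun setT (Z i)) ->
  bounded_moments (fun ik => D ik.1) G ->
  (forall i, D i -> {ae P, forall w, exists n0, forall n, (n0 <= n)%N ->
     Z i w <= G (i, n) w}) ->
  bounded_moments D Z.
Proof.
move=> Z0 mZ bG HZ; split; first by move=> i Di w; exact: Z0.
move=> m; have [C HC] := fatou_bounded_moments Z0 bG HZ m; exists C => i Di.
split; first by apply: measurable_funX; exact: mZ.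
  by move=> w; rewrite exprn_ge0// Z0.
exact: HC.
Qed.

End MomentFamilies.

Section FastVariable.
Context (R : realType) (T : R) (d : nat).
Context (disp : measure_display) (Omega : measurableType disp).
Variables (P : probability Omega R) (Ft : R -> set (set Omega)).
Variable W : R -> Omega -> 'cV[R]_d.
Variables (M : 'cV[R]_d -> 'M[R]_d) (F : 'cV[R]_d -> 'cV[R]_d) (l K L : R).
Variables X Y : R -> R -> Omega -> 'cV[R]_d.
Hypothesis T_gt0 : 0 < T.
Hypothesis basis : complete_basis T P Ft.
Hypothesis brownian : is_brownian_motion T P Ft W.
Hypothesis MF : coef_bounds M F l K L.
Hypothesis solution : forall eps : R, 0 < eps <= 1 ->
  is_solution T P Ft W M F eps (X eps) (Y eps).

Lemma ae_is_path (eps : R) : 0 < eps <= 1 ->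
  {ae P, forall w, is_path T M F eps (X eps ^~ w) (Y eps ^~ w) (W ^~ w)}.
Proof.
move=> e01; have S := solution e01.
have h1 := sol_continuousX S; have h2 := sol_continuousY S.
have h3 := sol_eqX S; have h4 := sol_eqY S; have h5 := bm_start brownian.
have h12 : {ae P, forall w, {within `[0, T], continuous (X eps ^~ w)} /\
    {within `[0, T], continuous (Y eps ^~ w)}}.
  by apply: filterS2 h1 h2 => w.
have h34 : {ae P, forall w, (forall t : R, 0 <= t <= T ->
      X eps t w = eps^-1 *: vintegral t (fun u => Y eps u w)) /\
    (forall t : R, 0 <= t <= T ->
      Y eps t w = - (eps ^- 2 *: vintegral t (fun u => M (X eps u w) *m Y eps u w))
            + eps^-1 *: vintegral t (fun u => F (X eps u w)) + eps^-1 *: W t w)}.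
  by apply: filterS2 h3 h4 => w.
by apply: filterS3 h12 h34 h5 => w [a b] [c e] f; split.
Qed.

Lemma bounded_moments_ito (I : Type) (D : I -> Prop) (t0 h : I -> R) (n : I -> nat)
    (a : I -> nat -> 'I_d -> Omega -> R) (A : I * nat -> Omega -> R) :
  (forall i, D i -> [/\ 0 <= t0 i, 0 < h i & grid (t0 i) (h i) (n i).+1 <= T]) ->
  (forall i k j, D i -> (k < (n i).+1)%N ->
     measurable_wrt (Ft (grid (t0 i) (h i) k)) (a i k j)) ->
  (forall i k w, D i -> (k < (n i).+1)%N ->
     (n i).+1%:R * h i * \sum_(j < d) a i k j w ^+ 2 <= A (i, k) w) ->
  bounded_moments P (fun ik => D ik.1 /\ (ik.2 < (n ik.1).+1)%N) A ->
  bounded_moments P D (fun i w => `|ito_sum W (t0 i) (h i) (n i).+1 (a i) w|).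
Proof.
move=> Hg ma aA [A0 HA]; split => // m; have [C HC] := HA m.
exists (2 ^+ m * C + m`!%:R * 2 ^+ m * 2) => i Di; have [t00 h0 gT] := Hg i Di.
apply: (ito_sum_moment basis brownian (A := fun k w => A (i, k) w)) => //.
- by move=> k j kn; exact: ma.
- by move=> k w kn; exact: aA.
- by move=> k kn; exact: (HC (i, k)).
Qed.

Lemma continuous_mx_norm (m n : nat) : continuous (fun v : 'M[R]_(m, n) => `|v|).
Proof.
move=> v; apply/(@cvgrPdist_le _ R^o _ (nbhs v)) => e e0.
apply/nbhs_ballP; exists e => //= u [_ vu].
apply: le_trans (ler_dist_dist _ _) _; apply: mx_norm_le => [|i j]; first exact: ltW.
by rewrite !mxE ltW//; exact: vu.
Qed.

Lemma measurable_Y (eps t : R) (g : 'cV[R]_d -> R) : 0 < eps <= 1 -> 0 <= t <= T ->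
  continuous g -> measurable_wrt (Ft t) (fun w => g (Y eps t w)).
Proof. by move=> e01 tT cg; apply: adapted_continuous (sol_adaptedY (solution e01)) tT cg. Qed.

Lemma measurable_X (eps t : R) (g : 'cV[R]_d -> R) : 0 < eps <= 1 -> 0 <= t <= T ->
  continuous g -> measurable_wrt (Ft t) (fun w => g (X eps t w)).
Proof. by move=> e01 tT cg; apply: adapted_continuous (sol_adaptedX (solution e01)) tT cg. Qed.

Let C0 : R := (2 * d%:R * K ^+ 2 / l + 4 * d%:R) / 8.

Lemma Y_exponential_moment (eps t : R) : 0 < eps <= 1 -> 0 <= t <= T ->
  (\int[P]_w (expR (l / 8 * sumsq (Y eps t w)))%:E <= (expR C0)%:E)%E.
Proof.
move=> e01 /andP[t0 tT]; have l0 := coef_l_gt0 MF.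
have C00 : 0 <= C0.
  have h1 : 0 <= 2 * d%:R * K ^+ 2 / l.
    by apply: divr_ge0; [apply: mulr_ge0; [exact: mulr_ge0|exact: sqr_ge0]|exact: ltW].
  by have : 0 <= d%:R :> R by []; rewrite /C0; lra.
(* At time 0 there is no grid, but Y vanishes almost surely. *)
move: t0; rewrite le_eqVlt => /predU1P[<-|t0].
  apply: (@fatou_mean_le _ _ _ P _ (fun=> cst (expR C0))).
  - by move=> w; exact: expR_ge0.
  - by move=> n; apply: mean_le_cst; exact: expR_ge0.
  apply: filterS (ae_is_path e01) => w pw e e0; exists 0%N => n _.
  rewrite (path_y0 pw) ?(ltW T_gt0)// /sumsq big1; last first.
    by move=> i _; rewrite mxE expr0n.
  by rewrite mulr0 ler_wpDr ?(ltW e0)// ler_expR.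
have eps0 : 0 < eps by case/andP: e01.
(* The quadratic coefficients are at most l / (4 eps^2), so a mesh below eps^2 / l meets the
   condition [q * h <= 4^-1]. Shifting the grid sizes by [n1] gives every member of the sequence
   such a mesh. *)
have r0 : 0 < eps ^+ 2 / l by rewrite divr_gt0// exprn_gt0.
have [n1 Hn1] := eventually_fine_grid (lexx 0) t0 tT (eventually_fine_lt T r0).
pose h n := (t - 0) / (n + n1).+1%:R.
pose q n k := energy_quad l eps t (h n) k.
pose a n k i w := energy_lin l eps t (h n) k (Y eps (grid 0 (h n) k) w) i.
have h0 n : 0 < h n by rewrite divr_gt0 ?subr0.
have gl n : grid 0 (h n) (n + n1).+1 = t := grid_last 0 t (n + n1).
pose G n w := expR C0 * expR (\sum_(k < (n + n1).+1) \sum_(i < d)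
  (a n k i w * coord_incr W 0 (h n) k i w + q n k * coord_incr W 0 (h n) k i w ^+ 2
   - a n k i w ^+ 2 * h n - 2 * q n k * h n)).
apply: (@fatou_mean_le _ _ _ P _ G).
- by move=> w; exact: expR_ge0.
- move=> n; rewrite -[X in mean_le _ _ X]mulr1; apply: mean_leZ.
    exact: expR_ge0.
  apply: (exp_supermartingale_mean_le basis brownian) => //.
  + by rewrite gl.
  + move=> k kn; have ew : energy_weight l eps t (h n) k <= 1.
      rewrite /energy_weight -expR0 ler_expR oppr_le0 mulr_ge0//.
        by rewrite divr_ge0 ?exprn_ge0// ltW.
      by rewrite subr_ge0 -(gl n); apply: le_grid; [exact: ltW|exact: ltnW].
    have ew0 : 0 <= energy_weight l eps t (h n) k by exact: expR_ge0.
    have c0 : 0 <= 2 * (l / 8) / eps ^+ 2.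
      apply: divr_ge0; last by apply: exprn_ge0; exact: ltW.
      by apply: mulr_ge0 => //; apply: divr_ge0 => //; exact: ltW.
    split; first by rewrite mulr_ge0.
    have hr : h n <= eps ^+ 2 / l.
      have /= := Hn1 (n + n1)%N (leq_addl _ _) k kn; rewrite -/(h n) gridS.
      by rewrite addrAC subrr add0r => /ltW.
    apply: (@le_trans _ _ (2 * (l / 8) / eps ^+ 2 * (eps ^+ 2 / l))).
      rewrite ler_pM// ?(ltW (h0 n))//; first by rewrite mulr_ge0.
      by rewrite ler_piMr.
    by rewrite le_eqVlt; apply/orP; left; apply/eqP; field; rewrite !gt_eqF.
  + move=> k i kn; apply: measurable_funM; first exact: measurable_cst.
    apply: (measurable_Y (g := fun v => v i 0)) => //; last exact: coord_continuous.
    apply: (grid_itv (n := (n + n1).+1)) => //; [exact: ltW|by rewrite gl|exact: ltnW].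
- apply: filterS (ae_is_path e01) => w pw e e0.
  set Z := expR _; have Z0 : 0 < Z by exact: expR_gt0.
  (* The error rho in the exponent becomes a factor exp rho; with rho = e / Z it costs at most [e],
     since Z exp (- e / Z) >= Z - e. *)
  have rho0 : 0 < e / Z by rewrite divr_gt0.
  have [n0 Hn] := energy_bound MF e01 pw t0 tT rho0.
  exists n0 => n n0n.
  have := Hn (n + n1)%N (leq_trans n0n (leq_addr _ _)).
  rewrite -/C0 => Hle.
  have HZ : Z <= G n w * expR (e / Z).
    by rewrite /G -!expRD /Z ler_expR; apply: le_trans Hle _;
      rewrite lerD2r addrC lerD2l.
  have Ze : Z * expR (- (e / Z)) <= G n w.
    by rewrite expRN ler_pdivrMr ?expR_gt0.
  have := expR_ge1Dx (- (e / Z)).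
  move=> /(ler_wpM2l (ltW Z0)); rewrite mulrDr mulr1 mulrN mulrC divfK ?gt_eqF//.
  by lra.
Qed.

Lemma Y_bounded_moments :
  bounded_moments P (fun et : R * R => 0 < et.1 <= 1 /\ 0 <= et.2 <= T)
    (fun et w => `|Y et.1 et.2 w|).
Proof.
split => // m; have l0 := coef_l_gt0 MF.
pose c := (8 / l) ^+ m * m`!%:R.
have c0 : 0 <= c by rewrite mulr_ge0// exprn_ge0// divr_ge0// ltW.
exists (1 + c * expR C0) => -[eps t] [/= e01 tT].
have mY : measurable_fun setT (fun w => `|Y eps t w|).
  apply: (measurable_wrt_measurable (basis_sub basis tT)).
  by apply: measurable_Y => //; exact: continuous_mx_norm.
have mE : mean_le P (fun w => expR (l / 8 * sumsq (Y eps t w))) (expR C0).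
  split; last exact: Y_exponential_moment.
    apply: (measurableT_comp (@measurable_expR R)); apply: measurable_funM => //.
    apply: measurable_sum => i; apply: measurable_funX.
    apply: (measurable_wrt_measurable (basis_sub basis tT)).
    apply: (measurable_Y (g := fun v => v i 0)) => //; exact: coord_continuous.
  by move=> w; exact: expR_ge0.
apply: mean_le_bounded (mean_leD (mean_le_cst P ler01) (mean_leZ c0 mE)).
  exact: measurable_funX.
move=> w; rewrite exprn_ge0//=; set y := Y eps t w.
(* Only even powers compare directly with [sumsq]; the constant 1 covers |y| <= 1. *)
have y2 : `|y| ^+ m <= 1 + (`|y| ^+ 2) ^+ m.
  have [y1|y1] := leP `|y| 1.
    by rewrite -[leLHS]addr0 lerD ?exprn_ile1// exprn_ge0// exprn_ge0.
  rewrite -[leLHS]add0r lerD// -exprM mul2n -addnn exprD ler_peMr ?exprn_ge0//.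
  by rewrite exprn_ege1// ltW.
apply: le_trans y2 _; rewrite lerD2l.
apply: (@le_trans _ _ (sumsq y ^+ m)).
  by rewrite lerXn2r ?nnegrE ?exprn_ge0 ?sumsq_ge0 ?mx_norm_sqr_le_sumsq.
have s0 : 0 <= l / 8 * sumsq y by rewrite mulr_ge0 ?sumsq_ge0// divr_ge0// ltW.
have sE : sumsq y = (8 / l) * (l / 8 * sumsq y) by field; rewrite gt_eqF.
rewrite [in leLHS]sE exprMn /c -[leRHS]mulrA.
apply: ler_wpM2l; last exact: exprn_le_expR.
by apply: exprn_ge0; apply: divr_ge0 => //; exact: ltW.
Qed.

End FastVariable.

(** * The increments of the slow variable *)

Section SlowIncrement.
Context (R : realType) (T : R) (d : nat).
Variables (M : 'cV[R]_d -> 'M[R]_d) (F : 'cV[R]_d -> 'cV[R]_d) (l K L : R).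
Hypothesis MF : coef_bounds M F l K L.
Variables (eps : R) (x y om : R -> 'cV[R]_d).
Hypothesis eps01 : 0 < eps <= 1.
Hypothesis path : is_path T M F eps x y om.

Let eps_gt0 : 0 < eps. Proof. by case/andP: eps01. Qed.
Let eps_le1 : eps <= 1. Proof. by case/andP: eps01. Qed.
Let K_ge0 : 0 <= K := coef_K_ge0 MF.
Let L_ge0 : 0 <= L := coef_L_ge0 MF.

Let N (u : R) : 'M[R]_d := invmx (M (x u)).

(** Adding eps times this term to X removes the singular part of its dynamics. *)
Definition corrector (u : R) : 'cV[R]_d := invmx (M (x u)) *m y u.

(** Error per unit time in [slow_increment]. In order: the expansion error of X, that of Y
    multiplied by M^-1, the term M^-1 F, and the increment of M^-1(X) acting on Y. *)
Definition slow_rate (v : 'cV[R]_d) : R :=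
  1 + d%:R * K + d%:R * K ^+ 2 + d%:R * L * (`|v| + 1) ^+ 2.

Lemma slow_rate_ge0 v : 0 <= slow_rate v.
Proof.
by rewrite /slow_rate !addr_ge0// !mulr_ge0// exprn_ge0// addr_ge0.
Qed.

Lemma corrector_le (u : R) : `|corrector u| <= d%:R * K * `|y u|.
Proof.
apply: le_trans (mx_norm_mulmx_le _ _) _.
by rewrite ler_wpM2r// ler_wpM2l//; exact: coef_inv_bounded MF _.
Qed.

(* eps M^-1(X) dY = - dX + M^-1(X) F dt + M^-1(X) dW, and moving the left-hand
   side into the total differential of eps M^-1(X) Y costs only the increment
   of M^-1(X), which is at most L |dX|. *)
Lemma slow_increment : eventually_fine T (fun u v =>
  [/\ `|x v - x u + eps *: (corrector v - corrector u) - N u *m (om v - om u)|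
        <= (v - u) * slow_rate (y u),
      `|x v - x u| <= (v - u) * (`|y u| / eps + 1) &
      `|y v| <= `|y u| + 1]).
Proof.
apply: eventually_fine_mono (eventually_fine_and (eventually_fine_and
  (x_increment eps01 path ltr01) (y_increment MF eps01 path ltr01))
  (y_uniform path ltr01)) => u v u0 uv vT [[H1 H2] H3].
set h := v - u in H1 H2 *; have h0 : 0 <= h by rewrite subr_ge0.
rewrite mul1r in H1; rewrite mul1r in H2.
have yv : `|y v| <= `|y u| + 1.
  rewrite -[y v](subrK (y u)) addrC; apply: le_trans (ler_normD _ _) _.
  by rewrite lerD2l.
have dx : `|x v - x u| <= h * (`|y u| / eps + 1).
  rewrite -[x v - x u](subrK ((h / eps) *: y u)).
  apply: le_trans (ler_normD _ _) _; rewrite mulrDr mulr1 addrC lerD//.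
  by rewrite normrZ ger0_norm ?divr_ge0 ?(ltW eps_gt0)// mulrAC mulrA.
split => //.
have -> : x v - x u + eps *: (corrector v - corrector u) - N u *m (om v - om u) =
    (x v - x u - (h / eps) *: y u)
    + eps *: (N u *m (y v - y u - h *: drift M F eps x y u - eps^-1 *: (om v - om u)))
    + h *: (N u *m F (x u)) + eps *: ((N v - N u) *m y v).
  (* This identity makes the drift of order eps^-2, multiplied by eps M^-1, cancel dX exactly. In
     the product rule the increment of M^-1(X) meets Y at the right endpoint, hence the separate
     bound on [y v]. *)
  have NM : N u *m (M (x u) *m y u) = y u.
    by rewrite mulmxA (coef_mulVmx MF) mul1mx.
  rewrite /corrector -/(N u) -/(N v) /drift.
  rewrite !mulmxBl !mulmxBr -!scalemxAr mulmxDr mulmxN -!scalemxAr NM mulmxBr.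
  move: (N v *m y v) (N u *m y v) (N u *m y u) (N u *m om v) (N u *m om u)
    (N u *m F (x u)) => a1 a2 a3 a4 a5 a6.
  apply/colP => i; rewrite !mxE; field.
  by rewrite gt_eqF.
have Nu : `|N u| <= K := coef_inv_bounded MF _.
have e1 : `|eps *: (N u *m (y v - y u - h *: drift M F eps x y u
    - eps^-1 *: (om v - om u)))| <= h * (d%:R * K).
  rewrite normrZ gtr0_norm//.
  set r := _ - eps^-1 *: _ in H2 *.
  have Nr : `|N u *m r| <= d%:R * K * h.
    apply: le_trans (mx_norm_mulmx_le _ _) _.
    by rewrite ler_pM ?mulr_ge0// ler_wpM2l.
  apply: (@le_trans _ _ `|N u *m r|); first by rewrite ler_piMl.
  by rewrite mulrC.
have e2 : `|h *: (N u *m F (x u))| <= h * (d%:R * K ^+ 2).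
  rewrite normrZ ger0_norm// ler_wpM2l//.
  apply: le_trans (mx_norm_mulmx_le _ _) _; rewrite -mulrA ler_wpM2l// expr2.
  by rewrite ler_pM//; exact: coef_F_bounded MF _.
have e3 : `|eps *: ((N v - N u) *m y v)| <= h * (d%:R * L * (`|y u| + 1) ^+ 2).
  rewrite normrZ gtr0_norm//.
  have dN : `|N v - N u| <= L * (h * (`|y u| / eps + 1)).
    by apply: le_trans (coef_inv_lipschitz MF _ _) _; rewrite ler_wpM2l.
  have s1 : `|(N v - N u) *m y v| <=
      d%:R * (L * (h * (`|y u| / eps + 1))) * (`|y u| + 1).
    apply: le_trans (mx_norm_mulmx_le _ _) _.
    by rewrite ler_pM ?mulr_ge0// ler_wpM2l.
  apply: le_trans (ler_wpM2l (ltW eps_gt0) s1) _.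
  rewrite (_ : eps * _ = h * (d%:R * L * ((`|y u| + eps) * (`|y u| + 1)))); last first.
    by field; rewrite gt_eqF.
  rewrite !ler_wpM2l ?mulr_ge0// expr2 ler_wpM2r ?addr_ge0// lerD2l//.
rewrite /slow_rate !mulrDr mulr1.
apply: le_trans (ler_normD _ _) _; apply: lerD => //.
apply: le_trans (ler_normD _ _) _; apply: lerD => //.
by apply: le_trans (ler_normD _ _) _; apply: lerD.
Qed.

Section GridSums.
Variables (s t : R).
Hypotheses (s_ge0 : 0 <= s) (st : s < t) (tT : t <= T).

Let step n : R := (t - s) / n.+1%:R.

(** Each quantity receives two bounds on the same grid: the first and third use the corrector and
    serve small eps, the second and fourth use only |dX| <= |Y| dt / eps and serve large eps. *)
Lemma slow_grid_sums : exists n0, forall n, (n0 <= n)%N ->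
  [/\ `|x t - x s| <= eps * (`|corrector t| + `|corrector s|)
        + `|\sum_(k < n.+1) N (grid s (step n) k) *m
             (om (grid s (step n) k.+1) - om (grid s (step n) k))|
        + step n * \sum_(k < n.+1) slow_rate (y (grid s (step n) k)),
      `|x t - x s| <= step n * \sum_(k < n.+1) (`|y (grid s (step n) k)| / eps + 1),
      forall i j, `|\sum_(k < n.+1) (x (grid s (step n) k) - x s) i 0
          * (x (grid s (step n) k.+1) - x (grid s (step n) k)) j 0| <=
        eps * `|x t - x s| * `|corrector t|
        + step n * \sum_(k < n.+1) (d%:R * K * (`|y (grid s (step n) k)| + 1) ^+ 2)
        + `|\sum_(k < n.+1) (x (grid s (step n) k) - x s) i 0 *
             (N (grid s (step n) k) *m
             (om (grid s (step n) k.+1) - om (grid s (step n) k))) j 0|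
        + step n * \sum_(k < n.+1)
            (`|x (grid s (step n) k) - x s| * slow_rate (y (grid s (step n) k))) &
      forall i j, `|\sum_(k < n.+1) (x (grid s (step n) k) - x s) i 0
          * (x (grid s (step n) k.+1) - x (grid s (step n) k)) j 0| <=
        step n * \sum_(k < n.+1)
          (`|x (grid s (step n) k) - x s| * (`|y (grid s (step n) k)| / eps + 1))].
Proof.
have [n0 H] := eventually_fine_grid s_ge0 st tT slow_increment.
exists n0 => n n0n; set h := step n; set g := grid s h.
have h0 : 0 <= h by rewrite divr_ge0// subr_ge0 ltW.
have gh k : g k.+1 - g k = h by rewrite /g gridS; ring.
have gl : g n.+1 = t := grid_last s t n.
have g0 : g 0%N = s := grid0 s h.
have {}H k : (k < n.+1)%N ->
    [/\ `|x (g k.+1) - x (g k) + eps *: (corrector (g k.+1) - corrector (g k))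
          - N (g k) *m (om (g k.+1) - om (g k))| <= h * slow_rate (y (g k)),
        `|x (g k.+1) - x (g k)| <= h * (`|y (g k)| / eps + 1) &
        `|y (g k.+1)| <= `|y (g k)| + 1].
  by move=> kn; have /= := H n n0n k kn; rewrite -/(step n) -/h -/g gh.
have tx : x t - x s = \sum_(k < n.+1) (x (g k.+1) - x (g k)).
  by rewrite -(big_mkord xpredT (fun k => x (g k.+1) - x (g k)))
    telescope_sumr// gl g0.
have tz : corrector t - corrector s
    = \sum_(k < n.+1) (corrector (g k.+1) - corrector (g k)).
  by rewrite -(big_mkord xpredT (fun k => corrector (g k.+1) - corrector (g k)))
    telescope_sumr// gl g0.
split.
- have -> : x t - x s = - (eps *: (corrector t - corrector s))
      + \sum_(k < n.+1) N (g k) *m (om (g k.+1) - om (g k))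
      + \sum_(k < n.+1) (x (g k.+1) - x (g k)
          + eps *: (corrector (g k.+1) - corrector (g k))
          - N (g k) *m (om (g k.+1) - om (g k))).
    rewrite sumrB big_split /= -scaler_sumr -tz -tx.
    have gen (a b c : 'cV[R]_d) : a = - b + c + (a + b - c).
      by apply/colP => i; rewrite !mxE; ring.
    exact: gen.
  apply: le_trans (ler_normD _ _) _; apply: lerD.
    apply: le_trans (ler_normD _ _) _; rewrite lerD2r normrN normrZ gtr0_norm//.
    by rewrite ler_wpM2l ?(ltW eps_gt0)//; exact: ler_normB.
  apply: le_trans (ler_norm_sum _ _ _) _; rewrite mulr_sumr.
  by apply: ler_sum => k _; have [] := H k (ltn_ord k).
- rewrite tx; apply: le_trans (ler_norm_sum _ _ _) _; rewrite mulr_sumr.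
  by apply: ler_sum => k _; have [] := H k (ltn_ord k).
- move=> i j; pose X k := (x (g k) - x s) i 0; pose z k := corrector (g k) j 0.
  pose G k := (x (g k.+1) - x (g k) + eps *: (corrector (g k.+1) - corrector (g k))
          - N (g k) *m (om (g k.+1) - om (g k))) j 0.
  pose Q k := (N (g k) *m (om (g k.+1) - om (g k))) j 0.
  (* Summation by parts against [X 0 = 0] leaves one boundary term. The other sum, eps dX z, is of
     order h without singularity because eps cancels the 1 / eps in the bound for dX. *)
  have abel : \sum_(k < n.+1) (X k.+1 * z k.+1 - X k * z k) = X n.+1 * z n.+1.
    rewrite -(big_mkord xpredT (fun k => X k.+1 * z k.+1 - X k * z k)).
    by rewrite telescope_sumr// {2}/X g0 subrr mxE mul0r subr0.
  have -> : \sum_(k < n.+1) (x (g k) - x s) i 0 * (x (g k.+1) - x (g k)) j 0 =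
      - (eps * (X n.+1 * z n.+1)) + \sum_(k < n.+1) eps * ((X k.+1 - X k) * z k.+1)
      + \sum_(k < n.+1) X k * Q k + \sum_(k < n.+1) X k * G k.
    rewrite -abel mulr_sumr -sumrN -!big_split /=; apply: eq_bigr => k _.
    rewrite /G /z -/(X k); move: (X k) (X k.+1) => X0 X1.
    have -> : (x (g k.+1) - x (g k) + eps *: (corrector (g k.+1) - corrector (g k))
          - N (g k) *m (om (g k.+1) - om (g k))) j 0
        = (x (g k.+1) - x (g k)) j 0
          + eps * (corrector (g k.+1) j 0 - corrector (g k) j 0) - Q k.
      rewrite /Q; move: (N (g k) *m _) (corrector (g k.+1)) (corrector (g k))
        => a b b'.
      by rewrite !mxE.
    by ring.
  apply: le_trans (ler_normD _ _) _; apply: lerD; last first.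
    apply: le_trans (ler_norm_sum _ _ _) _; rewrite mulr_sumr.
    apply: ler_sum => k _; rewrite normrM mulrCA ler_pM//.
      exact: coord_le_mx_norm.
    apply: le_trans (coord_le_mx_norm _ _ _) _.
    by have [] := H k (ltn_ord k).
  apply: le_trans (ler_normD _ _) _; rewrite lerD2r.
  apply: le_trans (ler_normD _ _) _; apply: lerD.
    rewrite normrN !normrM gtr0_norm// /X /z gl mulrA.
    by rewrite ler_pM ?mulr_ge0 ?(ltW eps_gt0)// ?coord_le_mx_norm//
      ler_wpM2l ?(ltW eps_gt0)// coord_le_mx_norm.
  apply: le_trans (ler_norm_sum _ _ _) _; rewrite mulr_sumr.
  apply: ler_sum => k _; have [_ Hx Hy] := H k (ltn_ord k).
  rewrite !normrM gtr0_norm//.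
  have dX : `|X k.+1 - X k| <= h * (`|y (g k)| / eps + 1).
    apply: le_trans Hx; have := coord_le_mx_norm (x (g k.+1) - x (g k)) i 0.
    by rewrite /X !mxE; congr (`|_| <= _); ring.
  have zk : `|z k.+1| <= d%:R * K * (`|y (g k)| + 1).
    apply: le_trans (coord_le_mx_norm _ _ _) _.
    by apply: le_trans (corrector_le _) _; rewrite ler_wpM2l ?mulr_ge0.
  have p0 : 0 <= `|y (g k)| / eps + 1 by rewrite addr_ge0// divr_ge0// ltW.
  apply: (@le_trans _ _ (eps * (h * (`|y (g k)| / eps + 1) *
      (d%:R * K * (`|y (g k)| + 1))))).
    by rewrite ler_wpM2l ?(ltW eps_gt0)// ler_pM.
  rewrite (_ : eps * _ = h * (d%:R * K * ((`|y (g k)| + eps) * (`|y (g k)| + 1))));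
    last by field; rewrite gt_eqF.
  apply: ler_wpM2l => //; apply: ler_wpM2l; first by rewrite mulr_ge0.
  by rewrite expr2 ler_wpM2r ?addr_ge0// lerD2l.
- move=> i j; apply: le_trans (ler_norm_sum _ _ _) _; rewrite mulr_sumr.
  apply: ler_sum => k _; rewrite normrM mulrCA ler_pM//.
    exact: coord_le_mx_norm.
  apply: le_trans (coord_le_mx_norm _ _ _) _.
  by have [] := H k (ltn_ord k).
Qed.

End GridSums.

End SlowIncrement.

(** * Riemann-Stieltjes integrals *)

Section RiemannStieltjes.
Context (R : realType) (T : R).
Variables (f g dg : R -> R).
Hypothesis cf : {within `[0, T], continuous f}.
Hypothesis cdg : {within `[0, T], continuous dg}.
Hypothesis hg : forall e, 0 < e -> eventually_fine T (fun u v =>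
  `|g v - g u - (v - u) * dg u| <= e * (v - u)).

(** The integral is the Lebesgue integral of [f * dg]. Existence is the point, since [RS_integral]
    falls back to 0 when there is no limit. *)
Lemma C1_is_RS_integral (s t : R) : 0 <= s -> s < t -> t <= T ->
  exists I, is_RS_integral s t f g I.
Proof.
move=> s0 st tT.
pose G v := \int[@lebesgue_measure R]_(u in `[0, v]) (f u * dg u).
exists (G t - G s) => e e0.
have [B B0 HB] := segment_bounded cf.
have [B' B'0 HB'] := segment_bounded cdg.
have cfg : {within `[0, T], continuous (fun u => f u * dg u)}.
  by move=> u; apply: (@continuousM _ (subspace `[0, T])); [exact: cf|exact: cdg].
have st0 : 0 < t - s by rewrite subr_gt0.
(* Per unit time the error is [eta * (B' + 1)] for moving the tag to the left end, [eta * B] for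
   linearising [g], and [eta] for the Lebesgue integral. *)
pose eta := Num.min 1 (e / (2 * (B + B' + 2) * (t - s))).
have den0 : 0 < 2 * (B + B' + 2) * (t - s) by rewrite !mulr_gt0//; lra.
have eta0 : 0 < eta by rewrite lt_min ltr01 divr_gt0.
have eta1 : eta <= 1 by rewrite ge_min lexx.
have etaE : eta * (B + B' + 2) * (t - s) <= e / 2.
  have : eta <= e / (2 * (B + B' + 2) * (t - s)) by rewrite ge_min lexx orbT.
  by rewrite ler_pdivlMr//; lra.
have [r r0 Hr] := eventually_fine_and (hg eta0) (integral_increment cfg eta0).
have [r' r'0 Hr'] := segment_uniform_continuous cf eta0.
exists (Num.min r r'); first by rewrite lt_min r0.
move=> ps tag part Htag.
pose p i := nth t (s :: ps) i.
have pS i : nth t ps i = p i.+1 by [].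
have p0 : p 0%N = s by [].
have pn : p (size ps) = t by exact: itv_partition_nth_size.
have pT i : (i <= size ps)%N -> s <= p i <= t.
  by move=> ips; rewrite itv_partition_nth_ge// itv_partition_nth_le.
have tele : G t - G s = \sum_(0 <= i < size ps) (G (p i.+1) - G (p i)).
  by rewrite (telescope_sumr (fun i => G (p i)))// pn p0.
have tele' : t - s = \sum_(0 <= i < size ps) (p i.+1 - p i).
  by rewrite (telescope_sumr p)// pn p0.
rewrite tele -sumrB.
apply: le_lt_trans (ler_norm_sum _ _ _) _.
apply: (@le_lt_trans _ _ (\sum_(0 <= i < size ps)
    (eta * (B + B' + 2)) * (p i.+1 - p i))); last first.
  by rewrite -mulr_sumr -tele'; apply: le_lt_trans etaE _; lra.
rewrite big_nat [leRHS]big_nat; apply: ler_sum => i /andP[_ ips].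
have [/andP[ptag tagp] pr] := Htag i ips.
rewrite pS in tagp pr *; rewrite -/(p i) in ptag pr *.
set u := p i in ptag pr *; set v := p i.+1 in tagp pr *.
have /andP[su ut] := pT i (ltnW ips); have /andP[sv vt] := pT i.+1 ips.
have u0 : 0 <= u by exact: le_trans su.
have uv : u <= v by exact: le_trans tagp.
have vT : v <= T by exact: le_trans tT.
move: pr; rewrite lt_min => /andP[vr vr'].
have [H1 H2] := Hr u v u0 uv vT vr.
have uT : 0 <= u <= T by rewrite u0 (le_trans uv).
have tT' : 0 <= tag i <= T by rewrite (le_trans u0 ptag) (le_trans tagp).
have H3 : `|f (tag i) - f u| <= eta.
  apply: Hr' => //; rewrite ger0_norm ?subr_ge0//; apply: le_lt_trans vr'.
  by rewrite lerD2r.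
have Hf := HB u uT; have Hdg := HB' u uT.
have h0 : 0 <= v - u by rewrite subr_ge0.
have H4 : `|g v - g u| <= (v - u) * (B' + 1).
  rewrite -[g v - g u](subrK ((v - u) * dg u)).
  apply: le_trans (ler_normD _ _) _; rewrite mulrDr mulr1 addrC lerD//.
    by rewrite normrM ger0_norm// ler_wpM2l.
  by apply: le_trans H1 _; rewrite ler_piMl.
rewrite -/(G v) -/(G u) in H2.
have -> : f (tag i) * (g v - g u) - (G v - G u) =
    (f (tag i) - f u) * (g v - g u) + f u * (g v - g u - (v - u) * dg u)
    - (G v - G u - (v - u) * (f u * dg u)) by ring.
apply: le_trans (ler_normB _ _) _.
have H5 : `|(f (tag i) - f u) * (g v - g u) + f u * (g v - g u - (v - u) * dg u)|
    <= eta * ((v - u) * (B' + 1)) + B * (eta * (v - u)).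
  apply: le_trans (ler_normD _ _) _; apply: lerD; rewrite normrM ler_pM//.
by apply: le_trans (lerD H5 H2) _; rewrite le_eqVlt; apply/orP; left; apply/eqP; ring.
Qed.

Lemma RS_integral_grid_sums (s t e : R) : 0 <= s -> s < t -> t <= T -> 0 < e ->
  exists n0, forall n, (n0 <= n)%N -> let h := (t - s) / n.+1%:R in
  `|\sum_(k < n.+1) f (grid s h k) * (g (grid s h k.+1) - g (grid s h k))
    - RS_integral s t f g| < e.
Proof.
move=> s0 st tT e0.
have RS : is_RS_integral s t f g (RS_integral s t f g).
  by have [I HI] := C1_is_RS_integral s0 st tT; exact: (xgetPex 0 (ex_intro _ I HI)).
have [r r0 Hr] := RS e e0.
have [n0 Hn] := eventually_fine_grid s0 st tT (eventually_fine_lt T r0).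
exists n0 => n n0n /=; set h := _ / _; pose p := grid s h.
have h0 : 0 < h by rewrite divr_gt0// subr_gt0.
pose ps := [seq p i.+1 | i <- iota 0 n.+1].
have sz : size ps = n.+1 by rewrite size_map size_iota.
have nthp i : (i < n.+1)%N -> nth t ps i = p i.+1.
  by move=> ni; rewrite (nth_map 0%N) ?size_iota// nth_iota.
have nthp' i : (i < n.+1)%N -> nth t (s :: ps) i = p i.
  by case: i => [_|i ni]; [rewrite /p grid0|rewrite /= nthp// ltnW].
have part : itv_partition s t ps.
  split.
    apply/(pathP t) => i; rewrite sz => ni; rewrite nthp' // nthp//.
    by rewrite /p gridS ltrDl.
  rewrite -nth_last sz (set_nth_default t) ?sz//; apply/eqP.
  by apply: etrans (nthp n (ltnSn n)) _; rewrite /p grid_last.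
have HS := Hr ps p part; rewrite sz big_mkord in HS.
rewrite (eq_bigr (fun k : 'I_n.+1 => f (p k) *
  (g (nth t ps k) - g (nth t (s :: ps) k)))); last first.
  by move=> k _; rewrite nthp ?ltn_ord// nthp' ?ltn_ord.
apply: HS => i ni; rewrite nthp// nthp'//; split.
  by rewrite lexx /p gridS lerDl ltW.
exact: (Hn n n0n i ni).
Qed.

End RiemannStieltjes.

Section ScaledBounds.
Context (R : realType) (T : R) (d : nat).
Variables (M : 'cV[R]_d -> 'M[R]_d) (F : 'cV[R]_d -> 'cV[R]_d) (l K L : R).
Hypothesis MF : coef_bounds M F l K L.
Variables (eps : R) (x y om : R -> 'cV[R]_d).
Hypothesis eps01 : 0 < eps <= 1.
Hypothesis path : is_path T M F eps x y om.
Variables (s t : R).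
Hypotheses (s_ge0 : 0 <= s) (st : s < t) (tT : t <= T).

Let r : R := Num.sqrt (t - s).
Let eps_gt0 : 0 < eps. Proof. by case/andP: eps01. Qed.
Let K_ge0 : 0 <= K := coef_K_ge0 MF.
Let ts_gt0 : 0 < t - s. Proof. by rewrite subr_gt0. Qed.
Let r_gt0 : 0 < r. Proof. by rewrite sqrtr_gt0. Qed.
Let r2 : t - s = r * r. Proof. by rewrite -expr2 sqr_sqrtr// ltW. Qed.
Let N (u : R) : 'M[R]_d := invmx (M (x u)).
Let node n := grid s ((t - s) / n.+1%:R).

Let step_avg n (f : 'I_n.+1 -> R) :
  (t - s) / n.+1%:R * \sum_k f k = r * r * (n.+1%:R^-1 * \sum_k f k).
Proof. by rewrite -r2 mulrA. Qed.

Let avgD n (f g : 'I_n.+1 -> R) : n.+1%:R^-1 * \sum_k (f k + g k)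
  = n.+1%:R^-1 * \sum_k f k + n.+1%:R^-1 * \sum_k g k.
Proof. by rewrite big_split mulrDr. Qed.

Let avg_ge0 n (f : 'I_n.+1 -> R) : (forall k, 0 <= f k) ->
  0 <= n.+1%:R^-1 * \sum_k f k.
Proof. by move=> f0; rewrite mulr_ge0 ?invr_ge0// sumr_ge0. Qed.

Let avg_le n (f g : 'I_n.+1 -> R) : (forall k, f k <= g k) ->
  n.+1%:R^-1 * \sum_k f k <= n.+1%:R^-1 * \sum_k g k.
Proof. by move=> fg; rewrite ler_wpM2l ?invr_ge0// ler_sum. Qed.

Lemma mx_norm_le_sum (v : 'cV[R]_d) : `|v| <= \sum_i `|v i 0|.
Proof.
apply: mx_norm_le => [|i j]; first exact: sumr_ge0.
by rewrite ord1 (bigD1 i)//= lerDl sumr_ge0.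
Qed.

(* For eps <= r the decomposition of the slow increment is used, for eps > r
   the trivial bound |dX| <= |Y| dt / eps. *)
Lemma scaled_increment_le : exists n0, forall n, (n0 <= n)%N ->
  `|x t - x s| / r <= d%:R * K * (`|y t| + `|y s|)
   + \sum_(i < d) `|\sum_(k < n.+1) \sum_(q < d) N (node n k) i q / r *
       (om (node n k.+1) - om (node n k)) q 0|
   + r * (n.+1%:R^-1 * \sum_(k < n.+1) slow_rate K L (y (node n k)))
   + (n.+1%:R^-1 * \sum_(k < n.+1) `|y (node n k)| + r).
Proof.
have [n0 H] := slow_grid_sums MF eps01 path s_ge0 st tT; exists n0 => n n0n.
have [/= Ha Hb _ _] := H n n0n; rewrite -/(node n) in Ha Hb.
rewrite !step_avg in Ha Hb.
set A := n.+1%:R^-1 * _ in Ha *.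
have A0 : 0 <= A by apply: avg_ge0 => k; exact: slow_rate_ge0 MF _.
set B := n.+1%:R^-1 * \sum_(k < n.+1) `|y (node n k)|.
have B0 : 0 <= B by apply: avg_ge0.
set S := \sum_(i < d) _; have S0 : 0 <= S by apply: sumr_ge0.
set c := d%:R * K * _; have c0 : 0 <= c by rewrite !mulr_ge0// addr_ge0.
rewrite ler_pdivrMr//.
have [er|re] := leP eps r.
  have h1 : eps * (`|corrector M x y t| + `|corrector M x y s|) <= r * c.
    apply: ler_pM; rewrite ?addr_ge0 ?(ltW eps_gt0)//.
    by rewrite /c mulrDr lerD//; exact: corrector_le MF _ _ _.
  have h2 : `|\sum_(k < n.+1) N (node n k) *m
      (om (node n k.+1) - om (node n k))| <= r * S.
    apply: le_trans (mx_norm_le_sum _) _; rewrite mulr_sumr; apply: ler_sum => i _.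
    rewrite -{1}(gtr0_norm r_gt0) -normrM mulr_sumr summxE le_eqVlt; apply/orP; left.
    apply/eqP; congr `|_|; apply: eq_bigr => k _; rewrite mxE mulr_sumr.
    by apply: eq_bigr => q _; rewrite mulrCA mulrA divfK ?gt_eqF// mulrC.
  have gen (u a b : R) : u <= a + b + r * r * A -> a <= r * c -> b <= r * S ->
      u <= (c + S + r * A + (B + r)) * r.
    move=> h a1 b1; have := mulr_ge0 (ltW r_gt0) B0.
    by have := mulr_ge0 (ltW r_gt0) (ltW r_gt0); nra.
  exact: gen Ha h1 h2.
have Hb' : n.+1%:R^-1 * \sum_(k < n.+1) (`|y (node n k)| / eps + 1) = B / eps + 1.
  by rewrite avgD -mulr_suml sumr_const card_ord mulrA mulVf// pnatr_eq0.
rewrite Hb' in Hb.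
have h1 : r * r * (B / eps + 1) <= r * B + r * r.
  rewrite mulrDr mulr1 lerD2r -mulrA ler_wpM2l ?(ltW r_gt0)//.
  by rewrite mulrCA ler_piMr// ler_pdivrMr// mul1r ltW.
apply: le_trans Hb _; apply: le_trans h1 _.
have gen (a b c' e : R) : 0 <= a -> 0 <= b -> 0 <= c' -> r * e + r * r <=
    (a + b + c' + (e + r)) * r by move=> *; have := r_gt0; nra.
by apply: gen; rewrite // mulr_ge0// ltW.
Qed.

(** The same dichotomy at scale t - s = r^2: apart from the final 1, the first four terms serve eps
    <= r and the fifth serves eps > r. Increments of X appear already divided by r, so the moments
    found for them can be inserted. *)
Lemma scaled_iterated_le (i j : 'I_d) : exists n0, forall n, (n0 <= n)%N ->
  `|iterated_integral x s t i j| / (t - s) <=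
   `|x t - x s| / r * (d%:R * K * `|y t|)
   + n.+1%:R^-1 * \sum_(k < n.+1) (d%:R * K * (`|y (node n k)| + 1) ^+ 2)
   + `|\sum_(k < n.+1) \sum_(q < d)
        (x (node n k) - x s) i 0 * N (node n k) j q / (t - s) *
        (om (node n k.+1) - om (node n k)) q 0|
   + n.+1%:R^-1 * \sum_(k < n.+1)
       (`|x (node n k) - x s| / r * (r * slow_rate K L (y (node n k))))
   + n.+1%:R^-1 * \sum_(k < n.+1)
       (`|x (node n k) - x s| / r * (`|y (node n k)| + r))
   + 1.
Proof.
have [n1 H1] := slow_grid_sums MF eps01 path s_ge0 st tT.
pose f u := (x u - x s) i 0; pose g u := x u j 0; pose dg u := y u j 0 / eps.
have cx := path_x_continuous path; have cy := path_y_continuous path.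
have cf : {within `[0, T], continuous f}.
  apply: (@within_comp _ _ _ _ x (fun v : 'cV[R]_d => (v - x s) i 0)) => //.
  move=> v; rewrite (_ : (fun v : 'cV[R]_d => _) = fun v => v i 0 - x s i 0).
    apply: (@continuousB _ _ _ (fun v : 'cV[R]_d => v i 0) (fun=> x s i 0)).
      exact: coord_continuous.
    exact: cst_continuous.
  by apply/funext => u; rewrite !mxE.
have cdg : {within `[0, T], continuous dg}.
  apply: (@within_comp _ _ _ _ y (fun v : 'cV[R]_d => v j 0 / eps)) => //.
  move=> v; apply: (@continuousM _ _ (fun v : 'cV[R]_d => v j 0) (fun=> eps^-1)).
    exact: coord_continuous.
  exact: cst_continuous.
have hg e : 0 < e ->
    eventually_fine T (fun u v => `|g v - g u - (v - u) * dg u| <= e * (v - u)).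
  move=> e0; apply: eventually_fine_mono (x_increment eps01 path e0) => u v _ _ _.
  apply: le_trans; apply: le_trans (coord_le_mx_norm _ j 0).
  by rewrite !mxE /g /dg mulrA mulrAC.
(* A tolerance of [t - s] for the Riemann-Stieltjes sum is enough: after division it is the final
   [+ 1]. *)
have [n2 H2] := RS_integral_grid_sums cf cdg hg s_ge0 st tT ts_gt0.
exists (maxn n1 n2) => n; rewrite geq_max => /andP[n1n n2n].
have [/= _ _ Hc Hd] := H1 n n1n; have /= := H2 n n2n.
have {}Hc := Hc i j; have {}Hd := Hd i j.
have -> : iterated_integral x s t i j = RS_integral s t f g by rewrite mxE.
rewrite -/(node n) in Hc Hd *.
set I := RS_integral _ _ _ _; set Sg := \sum_(k < n.+1) f _ * _ => Hr.
have SgE : \sum_(k < n.+1) (x (node n k) - x s) i 0 *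
    (x (node n k.+1) - x (node n k)) j 0 = Sg.
  apply: eq_bigr => k _; congr (_ * _); rewrite /g.
  by move: (x _) (x _) => a b; rewrite !mxE.
rewrite SgE !step_avg in Hc Hd.
have II : `|I| <= `|Sg| + (t - s).
  rewrite -[I](subrK Sg) addrC; apply: le_trans (ler_normD _ _) _.
  by rewrite lerD2l distrC ltW.
set a1 := `|x t - x s| / r * _; set a2 := n.+1%:R^-1 * _ in Hc *.
set a3 := `|\sum_(k < n.+1) \sum_(q < d) _|.
set a4 := n.+1%:R^-1 * \sum_(k < n.+1) (_ * (r * _)).
set a5 := n.+1%:R^-1 * \sum_(k < n.+1) (_ * (_ + r)).
have dr0 (v : 'cV[R]_d) : 0 <= `|v| / r by rewrite divr_ge0// ltW.
have a10 : 0 <= a1 by apply: mulr_ge0 => //; rewrite !mulr_ge0.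
have a20 : 0 <= a2.
  by apply: avg_ge0 => k; rewrite mulr_ge0 ?exprn_ge0 ?addr_ge0// mulr_ge0.
have a30 : 0 <= a3 by exact: normr_ge0.
have a40 : 0 <= a4.
  apply: avg_ge0 => k; apply: mulr_ge0 => //; apply: mulr_ge0; first exact: ltW.
  exact: slow_rate_ge0 MF _.
have a50 : 0 <= a5.
  by apply: avg_ge0 => k; rewrite mulr_ge0// addr_ge0// ltW.
suff : `|Sg| <= (a1 + a2 + a3 + a4 + a5) * (t - s).
  rewrite ler_pdivrMr// => h; apply: le_trans II _.
  by rewrite [leRHS]mulrDl mul1r lerD2r.
have ts0 := ltW ts_gt0.
have gen0 (a b : R) : 0 <= b -> a <= b -> a * (t - s) <= b * (t - s).
  by move=> *; rewrite ler_wpM2r.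
have [er|re] := leP eps r; last first.
  apply: le_trans Hd _; rewrite -r2 mulrC; apply: ler_wpM2r => //.
  apply: (@le_trans _ _ a5); last by rewrite lerDr !addr_ge0.
  apply: avg_le => k; rewrite -[_ / r * _]mulrA ler_wpM2l// mulrDr mulVf ?gt_eqF//.
  by rewrite lerD2r mulrC ler_wpM2r// lef_pV2 ?posrE// ltW.
apply: le_trans Hc _; apply: (@le_trans _ _ ((a1 + a2 + a3 + a4) * (t - s))); last first.
  by rewrite ler_wpM2r// lerDl.
rewrite !mulrDl; apply: lerD; first apply: lerD; first apply: lerD.
- rewrite /a1 r2 (_ : _ * (r * r) = r * `|x t - x s| * (d%:R * K * `|y t|)); last first.
    by field; rewrite gt_eqF.
  apply: ler_pM; rewrite ?mulr_ge0 ?(ltW eps_gt0)//; first by rewrite ler_wpM2r.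
  exact: corrector_le MF _ _ _.
- by rewrite -r2 mulrC.
- rewrite /a3 -{2}(gtr0_norm ts_gt0) -normrM mulr_suml le_eqVlt; apply/orP; left.
  apply/eqP; congr `|_|; apply: eq_bigr => k _; rewrite [X in _ * X]mxE mulr_sumr mulr_suml.
  apply: eq_bigr => q _; rewrite -/(N _).
  by move: (_ i 0) (N _ j q) (_ q 0) => u v z; field; rewrite gt_eqF.
- rewrite -r2 mulrC ler_wpM2r//; apply: avg_le => k.
  by rewrite mulrA divfK ?gt_eqF.
Qed.

End ScaledBounds.

(** * Moments of the slow variable *)

Lemma measurable_mx_norm (R : realType) (disp : measure_display)
    (S : measurableType disp) (m n : nat) (f : S -> 'M[R]_(m, n)) :
  (forall i j, measurable_fun setT (fun w => f w i j)) ->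
  measurable_fun setT (fun w => `|f w|).
Proof.
move=> mf; under eq_fun do rewrite /Num.norm/= mx_normrE.
elim: (index_enum _) => [|[i j] s IH].
  by under eq_fun do rewrite big_nil; exact: measurable_cst.
under eq_fun do rewrite big_cons.
by apply: measurable_maxr => //; exact: measurableT_comp (@normr_measurable R setT) (mf i j).
Qed.

Section SlowVariable.
Context (R : realType) (T : R) (d : nat).
Context (disp : measure_display) (Omega : measurableType disp).
Variables (P : probability Omega R) (Ft : R -> set (set Omega)).
Variable W : R -> Omega -> 'cV[R]_d.
Variables (M : 'cV[R]_d -> 'M[R]_d) (F : 'cV[R]_d -> 'cV[R]_d) (l K L : R).
Variables X Y : R -> R -> Omega -> 'cV[R]_d.
Hypothesis T_gt0 : 0 < T.
Hypothesis basis : complete_basis T P Ft.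
Hypothesis brownian : is_brownian_motion T P Ft W.
Hypothesis MF : coef_bounds M F l K L.
Hypothesis solution : forall eps : R, 0 < eps <= 1 ->
  is_solution T P Ft W M F eps (X eps) (Y eps).

Let K_ge0 : 0 <= K := coef_K_ge0 MF.
Let L_ge0 : 0 <= L := coef_L_ge0 MF.

(* Uniformity in (eps, s, t) is expressed by families indexed by these triples. *)
Definition time_triple (j : R * R * R) : Prop :=
  [/\ 0 < j.1.1 <= 1, 0 <= j.1.2, j.1.2 < j.2 & j.2 <= T].

Let J : Type := (R * R * R)%type.
Let r (j : J) : R := Num.sqrt (j.2 - j.1.2).
Let step (i : J * nat) : R := (i.1.2 - i.1.1.2) / i.2.+1%:R.
Let node (i : J * nat) (k : nat) : R := grid i.1.1.2 (step i) k.
Let D1 (i : J * nat) : Prop := time_triple i.1.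
Let D2 (ik : J * nat * nat) : Prop := time_triple ik.1.1 /\ (ik.2 < ik.1.2.+1)%N.

Let step_gt0 i : D1 i -> 0 < step i.
Proof. by move=> [_ _ st _]; rewrite divr_gt0// subr_gt0. Qed.

Let node_itv i k : D1 i -> (k <= i.2.+1)%N ->
  i.1.1.2 <= node i k <= i.1.2 /\ 0 <= node i k <= T.
Proof.
move=> Di kn; have h0 := ltW (step_gt0 Di); case: Di => [_ s0 st tT].
have h1 : i.1.1.2 <= node i k by rewrite /node /grid lerDl mulr_ge0.
have h2 : node i k <= i.1.2.
  by rewrite -(grid_last i.1.1.2 i.1.2 i.2); exact: le_grid.
by rewrite h1 h2 (le_trans s0 h1) (le_trans h2 tT).
Qed.

Let r_gt0 j : time_triple j -> 0 < r j.
Proof. by move=> [_ _ st _]; rewrite sqrtr_gt0 subr_gt0. Qed.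

Let r_le j : time_triple j -> 0 <= r j <= Num.sqrt T.
Proof.
move=> [_ s0 st tT]; rewrite sqrtr_ge0 ler_sqrt ?(ltW T_gt0)//.
by rewrite lerBlDr (le_trans tT)// lerDl.
Qed.

Lemma bounded_moments_const (I : Type) (D : I -> Prop) (f : I -> R) (c : R) :
  (forall i, D i -> 0 <= f i <= c) -> bounded_moments P D (fun i _ => f i).
Proof.
move=> fc; have [[i Di]|nD] := pselect (exists i, D i); last first.
  by split=> [i Di|m]; [case: nD; exists i|exists 0 => i Di; case: nD; exists i].
have c0 : 0 <= c by case/andP: (fc i Di) => /le_trans; apply.
by apply: bounded_moments_le (bounded_moments_cst P D c0) => // k _; exact: fc.
Qed.

Let Y_node : bounded_moments P D2
  (fun ik w => `|Y ik.1.1.1.1 (node ik.1 ik.2) w|).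
Proof.
apply: (bounded_moments_reindex (phi := fun ik => (ik.1.1.1.1, node ik.1 ik.2)))
  (Y_bounded_moments T_gt0 basis brownian MF solution).
move=> [i k] [/= Di kn]; split; first by case: Di.
by have [] := node_itv Di (ltnW kn).
Qed.

Let Y_end : bounded_moments P D1 (fun i w => `|Y i.1.1.1 i.1.2 w|).
Proof.
apply: (bounded_moments_reindex (phi := fun i => (i.1.1.1, i.1.2)))
  (Y_bounded_moments T_gt0 basis brownian MF solution).
by move=> i [e01 s0 st tT]; split => //=; rewrite tT (le_trans s0)// ltW.
Qed.

Let Y_start : bounded_moments P D1 (fun i w => `|Y i.1.1.1 i.1.1.2 w|).
Proof.
apply: (bounded_moments_reindex (phi := fun i => (i.1.1.1, i.1.1.2)))
  (Y_bounded_moments T_gt0 basis brownian MF solution).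
by move=> i [e01 s0 st tT]; split => //=; rewrite s0 ltW// (lt_le_trans st).
Qed.

Let r_moments : bounded_moments P D1 (fun i _ => r i.1).
Proof. by apply: (@bounded_moments_const _ _ _ (Num.sqrt T)) => i; exact: r_le. Qed.

Let r_node_moments : bounded_moments P D2 (fun ik _ => r ik.1.1).
Proof. by apply: (@bounded_moments_const _ _ _ (Num.sqrt T)) => i [Di _]; exact: r_le. Qed.

Let sq_node : bounded_moments P D2
  (fun ik w => (`|Y ik.1.1.1.1 (node ik.1 ik.2) w| + 1) ^+ 2).
Proof.
have bY := bounded_momentsD Y_node (bounded_moments_cst P D2 ler01).
exact: (bounded_momentsM bY bY).
Qed.

Let slow_node : bounded_moments P D2
  (fun ik w => slow_rate K L (Y ik.1.1.1.1 (node ik.1 ik.2) w)).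
Proof.
apply: bounded_momentsD.
  by apply: (bounded_moments_cst P D2); rewrite !addr_ge0 ?mulr_ge0 ?exprn_ge0.
by apply: bounded_momentsM sq_node; apply: (bounded_moments_cst P D2); rewrite mulr_ge0.
Qed.

Let measurable_inv eps u a b : 0 < eps <= 1 -> 0 <= u <= T ->
  measurable_wrt (Ft u) (fun w => invmx (M (X eps u w)) a b).
Proof.
move=> e01 uT.
apply: (measurable_X solution (g := fun v => invmx (M v) a b)) => //.
move=> v; apply: (@continuous_comp _ _ _ (fun v => invmx (M v)) (fun A => A a b)).
  exact: (coef_inv_continuous MF).
exact: coord_continuous.
Qed.

Let measurable_Xcoord eps u a : 0 < eps <= 1 -> 0 <= u <= T ->
  measurable_wrt (Ft u) (fun w => X eps u w a 0).
Proof.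
move=> e01 uT; apply: (measurable_X solution (g := fun v => v a 0)) => //.
exact: coord_continuous.
Qed.

Let measurable_increment eps u v : 0 < eps <= 1 -> 0 <= u <= T -> 0 <= v <= T ->
  measurable_fun setT (fun w => `|X eps v w - X eps u w|).
Proof.
move=> e01 uT vT; apply: measurable_mx_norm => a q; rewrite ord1.
under eq_fun do rewrite !mxE; apply: measurable_funB.
  exact: measurable_wrt_measurable (basis_sub basis vT) (measurable_Xcoord a e01 vT).
exact: measurable_wrt_measurable (basis_sub basis uT) (measurable_Xcoord a e01 uT).
Qed.

(** The number of steps times the mesh is t - s = r^2, so coefficients of size c / r produce a
    bracket of order c^2 whatever the grid. *)
Let ito_coef_le (i : J * nat) (v : 'I_d -> R) (c : R) : D1 i ->
  (forall q, `|v q| <= c / r i.1) ->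
  i.2.+1%:R * step i * \sum_(q < d) v q ^+ 2 <= d%:R * c ^+ 2.
Proof.
move=> Di vc; have r0 := r_gt0 Di.
have -> : i.2.+1%:R * step i = r i.1 ^+ 2.
  rewrite sqr_sqrtr; first by rewrite mulrC divfK// pnatr_eq0.
  by case: Di => _ _ st _; rewrite subr_ge0 ltW.
have -> : d%:R * c ^+ 2 = r i.1 ^+ 2 * \sum_(q < d) (c / r i.1) ^+ 2.
  rewrite sumr_const card_ord -[_ ^+ 2 *+ d]mulr_natl [RHS]mulrCA; congr (_ * _).
  by field; rewrite gt_eqF.
rewrite ler_wpM2l ?sqr_ge0// ler_sum// => q _.
by rewrite -real_normK ?num_real// lerXn2r ?nnegrE// (le_trans _ (vc q)).
Qed.

Lemma X_bounded_moments : bounded_moments P time_triple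
  (fun j w => `|X j.1.1 j.2 w - X j.1.1 j.1.2 w| / Num.sqrt (j.2 - j.1.2)).
Proof.
pose a (p : 'I_d) (i : J * nat) k q w :=
  invmx (M (X i.1.1.1 (node i k) w)) p q / r i.1.
pose G (i : J * nat) w := d%:R * K * (`|Y i.1.1.1 i.1.2 w| + `|Y i.1.1.1 i.1.1.2 w|)
   + \sum_(p < d) `|ito_sum W i.1.1.2 (step i) i.2.+1 (a p i) w|
   + r i.1 * (i.2.+1%:R^-1 * \sum_(k < i.2.+1) slow_rate K L (Y i.1.1.1 (node i k) w))
   + (i.2.+1%:R^-1 * \sum_(k < i.2.+1) `|Y i.1.1.1 (node i k) w| + r i.1).
apply: (fatou_bounded_moments_measurable (G := G)).
- by move=> j w _; rewrite divr_ge0.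
- move=> j [e01 s0 st tT]; apply: measurable_funM => //.
  by apply: measurable_increment; rewrite ?s0 ?tT ?(le_trans s0 (ltW st))//=
    (le_trans (ltW st)).
- rewrite -/D1 /G; apply: bounded_momentsD; first apply: bounded_momentsD;
    first apply: bounded_momentsD.
  + apply: bounded_momentsM (bounded_momentsD Y_end Y_start).
    by apply: (bounded_moments_cst P D1); rewrite mulr_ge0.
  + apply: (bounded_moments_sum (D := D1) _ (f := fun p i w =>
      `|ito_sum W i.1.1.2 (step i) i.2.+1 (a p i) w|)) => p.
    have cK : 0 <= d%:R * K ^+ 2 by rewrite mulr_ge0 ?exprn_ge0.
    apply: (bounded_moments_ito basis brownian (D := D1) (n := snd)
      (A := fun _ _ => d%:R * K ^+ 2)).
    * move=> i Di; split; [by case: Di|exact: step_gt0|].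
      by have [_ /andP[]] := node_itv Di (leqnn _).
    * move=> i k q Di kn; apply: measurable_funM; last exact: measurable_cst.
      apply: measurable_inv; first by case: Di.
      by have [] := node_itv Di (ltnW kn).
    * move=> i k w Di kn; apply: ito_coef_le => // q.
      rewrite /a normrM normfV (gtr0_norm (r_gt0 Di)) ler_wpM2r//.
        by rewrite invr_ge0 ltW// r_gt0.
      apply: le_trans (coord_le_mx_norm _ _ _) _; exact: coef_inv_bounded MF _.
    * exact: (bounded_moments_cst P _ cK).
  + apply: bounded_momentsM; first exact: r_moments.
    exact: (bounded_moments_avg (n := snd) (D := D1) slow_node).
  + apply: bounded_momentsD; last exact: r_moments.
    exact: (bounded_moments_avg (n := snd) (D := D1) Y_node).
- move=> j [e01 s0 st tT].
  apply: filterS (ae_is_path brownian solution e01) => w pw.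
  exact: (scaled_increment_le MF e01 pw s0 st tT).
Qed.

(** The moment bound is applied to the interval from s to the node, whose length is at most t - s.
    The first node is s itself, where the increment vanishes and no [time_triple] is available;
    hence the union with the degenerate triples. *)
Let X_node : bounded_moments P D2 (fun ik w =>
  `|X ik.1.1.1.1 (node ik.1 ik.2) w - X ik.1.1.1.1 ik.1.1.1.2 w| / r ik.1.1).
Proof.
pose f (j : J) w := `|X j.1.1 j.2 w - X j.1.1 j.1.2 w| / r j.
have f0 (j : J) w : j.1.2 = j.2 -> f j w = 0.
  by move=> e; rewrite /f e subrr normr0 mul0r.
have b0 : bounded_moments P (fun j : J => j.1.2 = j.2) f.
  apply: bounded_moments_le (bounded_moments_cst P _ (lexx 0)) => [j e|j w e].
    rewrite (_ : f j = cst 0); first exact: measurable_cst.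
    by apply/funext => w; exact: f0.
  by rewrite f0// lexx.
have phiD ik : D2 ik -> let j := (ik.1.1.1.1, ik.1.1.1.2, node ik.1 ik.2) in
    time_triple j \/ j.1.2 = j.2.
  move=> [Di kn] /=; have [/andP[sn nt] /andP[n0 nT]] := node_itv Di (ltnW kn).
  move: sn; rewrite le_eqVlt => /predU1P[e|sn]; [by right|left].
  by case: Di => e01 s0 st tT; split.
apply: bounded_moments_le
  (bounded_moments_reindex phiD (bounded_moments_union X_bounded_moments b0)).
  move=> [i k] [/= Di kn]; apply: measurable_funM => //.
  have [_ nT] := node_itv Di (ltnW kn); case: Di => /= e01 s0 st tT.
  by apply: measurable_increment => //; rewrite s0 ltW// (lt_le_trans st).
move=> [i k] w [/= Di kn]; rewrite divr_ge0 ?sqrtr_ge0//=.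
have [/andP[sn nt] _] := node_itv Di (ltnW kn).
move: sn; rewrite le_eqVlt => /predU1P[<-|sn]; first by rewrite subrr normr0 !mul0r.
have rn0 : 0 < Num.sqrt (node i k - i.1.1.2) by rewrite sqrtr_gt0 subr_gt0.
have ri0 := r_gt0 Di.
apply: ler_wpM2l => //; rewrite lef_pV2 ?posrE//.
by rewrite ler_wsqrtr// lerD2r.
Qed.

(** The coefficients of the stochastic sum are now random, but the moments of X at every node
    control them: after scaling they are at most K [xi] / r. The [+ 1] under the power prepares the
    passage to real exponents. *)
Lemma iterated_integral_moments (m : nat) : exists C, forall j, time_triple j ->
  (\int[P]_w ((`|iterated_integral (fun u => X j.1.1 u w) j.1.2 j.2|
     / (j.2 - j.1.2) + 1) ^+ m)%:E <= C%:E)%E.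
Proof.
pose b (p p' : 'I_d) (i : J * nat) k q w :=
  (X i.1.1.1 (node i k) w - X i.1.1.1 i.1.1.2 w) p 0
  * invmx (M (X i.1.1.1 (node i k) w)) p' q / (i.1.2 - i.1.1.2).
pose xi (ik : J * nat * nat) w :=
  `|X ik.1.1.1.1 (node ik.1 ik.2) w - X ik.1.1.1.1 ik.1.1.1.2 w| / r ik.1.1.
pose G (p p' : 'I_d) (i : J * nat) w :=
   `|X i.1.1.1 i.1.2 w - X i.1.1.1 i.1.1.2 w| / r i.1 * (d%:R * K * `|Y i.1.1.1 i.1.2 w|)
   + i.2.+1%:R^-1 * \sum_(k < i.2.+1)
       (d%:R * K * (`|Y i.1.1.1 (node i k) w| + 1) ^+ 2)
   + `|ito_sum W i.1.1.2 (step i) i.2.+1 (b p p' i) w|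
   + i.2.+1%:R^-1 * \sum_(k < i.2.+1)
       (xi (i, nat_of_ord k) w * (r i.1 * slow_rate K L (Y i.1.1.1 (node i k) w)))
   + i.2.+1%:R^-1 * \sum_(k < i.2.+1)
       (xi (i, nat_of_ord k) w * (`|Y i.1.1.1 (node i k) w| + r i.1))
   + 1.
have dK0 : 0 <= d%:R * K by rewrite mulr_ge0.
have cK1 : bounded_moments P D1 (fun _ _ => d%:R * K) by exact: bounded_moments_cst.
have cK2 : bounded_moments P D2 (fun _ _ => d%:R * K) by exact: bounded_moments_cst.
have quot_le (u U z q : R) : 0 < q -> `|u| <= U -> `|z| <= K ->
    `|u * z / (q * q)| <= K * (U / q) / q.
  move=> q0 uU zK; have -> : K * (U / q) / q = U * K / (q * q).
    by field; rewrite gt_eqF.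
  rewrite normrM normrM normfV (gtr0_norm (mulr_gt0 q0 q0)).
  by rewrite ler_wpM2r ?invr_ge0 ?mulr_ge0 ?(ltW q0)// ler_pM.
have GM p p' : bounded_moments P D1 (G p p').
  rewrite /G; apply: bounded_momentsD; first apply: bounded_momentsD;
    first apply: bounded_momentsD; first apply: bounded_momentsD;
    first apply: bounded_momentsD.
  - apply: bounded_momentsM (bounded_momentsM cK1 Y_end).
    exact: (bounded_moments_reindex (phi := fst) (E := D1) _ X_bounded_moments).
  - exact: (bounded_moments_avg (n := snd) (D := D1) (bounded_momentsM cK2 sq_node)).
  - apply: (bounded_moments_ito basis brownian (D := D1) (n := snd)
      (A := fun ik w => d%:R * (K * xi ik w * (K * xi ik w)))).
    + move=> i Di; split; [by case: Di|exact: step_gt0|].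
      by have [_ /andP[]] := node_itv Di (leqnn _).
    + move=> i k q Di kn; have [/andP[sn nt] nT] := node_itv Di (ltnW kn).
      have [e01 s0 st tT] := Di.
      apply: measurable_funM; last exact: measurable_cst.
      apply: measurable_funM; last exact: measurable_inv.
      under eq_fun do rewrite !mxE; apply: measurable_funB; first exact: measurable_Xcoord.
      apply: (measurable_wrt_later basis s0 sn); first by case/andP: nT.
      by apply: measurable_Xcoord => //; rewrite s0 ltW// (lt_le_trans st).
    + move=> i k w Di kn; apply: ito_coef_le => // q; rewrite /b /xi.
      have r0 := r_gt0 Di.
      have -> : i.1.2 - i.1.1.2 = r i.1 * r i.1.
        by rewrite -expr2 sqr_sqrtr//; case: Di => _ _ st _; rewrite subr_ge0 ltW.
      apply: quot_le => //; first exact: coord_le_mx_norm.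
      by apply: le_trans (coord_le_mx_norm _ _ _) _; exact: coef_inv_bounded MF _.
    + have cK : bounded_moments P D2 (fun _ _ => K) by exact: bounded_moments_cst.
      have cd : bounded_moments P D2 (fun _ _ => d%:R) by exact: bounded_moments_cst.
      have bx := bounded_momentsM cK X_node.
      exact: (bounded_momentsM cd (bounded_momentsM bx bx)).
  - exact: (bounded_moments_avg (n := snd) (D := D1)
      (bounded_momentsM X_node (bounded_momentsM r_node_moments slow_node))).
  - exact: (bounded_moments_avg (n := snd) (D := D1)
      (bounded_momentsM X_node (bounded_momentsD Y_node r_node_moments))).
  - exact: bounded_moments_cst.
apply: (fatou_bounded_moments (D := time_triple)
  (Z := fun j w => `|iterated_integral (fun u => X j.1.1 u w) j.1.2 j.2|
     / (j.2 - j.1.2) + 1)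
  (G := fun i w => \sum_(p < d) \sum_(p' < d) G p p' i w + 1)).
- by move=> j w [_ _ st _]; rewrite addr_ge0// divr_ge0// subr_ge0 ltW.
- apply: bounded_momentsD; last exact: bounded_moments_cst.
  apply: (bounded_moments_sum (D := D1) _ (f := fun p i w => \sum_(p' < d) G p p' i w)) => p.
  exact: (bounded_moments_sum (D := D1) _ (f := fun p' i w => G p p' i w)).
- move=> j Dj; have [e01 s0 st tT] := Dj.
  apply: filterS (ae_is_path brownian solution e01) => w pw.
  have H p p' := scaled_iterated_le MF e01 pw s0 st tT p p'.
  (* One threshold for all matrix entries: the maximum of the finitely many ranks chosen entry by
     entry. *)
  exists (\max_p \max_p' sval (cid (H p p'))) => n nn.
  have ts0 : 0 < j.2 - j.1.2 by rewrite subr_gt0.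
  have Hn p p' : `|iterated_integral (X j.1.1 ^~ w) j.1.2 j.2 p p'| / (j.2 - j.1.2)
      <= G p p' (j, n) w.
    apply: (svalP (cid (H p p'))); apply: leq_trans nn.
    apply: leq_trans (leq_bigmax p).
    exact: (leq_bigmax (F := fun p' => sval (cid (H p p'))) p').
  have G0 p p' : 0 <= G p p' (j, n) w by exact: (proj1 (GM p p')) (j, n) Dj w.
  rewrite lerD2r ler_pdivrMr//; apply: mx_norm_le => [|p p'].
    by apply: mulr_ge0; [apply: sumr_ge0 => p _; exact: sumr_ge0|exact: ltW].
  rewrite -ler_pdivrMr//; apply: le_trans (Hn p p') _.
  rewrite (bigD1 p)//= (bigD1 p')//= -addrA lerDl addr_ge0 ?sumr_ge0//.
  by move=> q _; exact: sumr_ge0.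
Qed.

End SlowVariable.

(** * From integer moments to real powers *)

Section Powers.
Context (disp : measure_display) (R : realType) (Omega : measurableType disp).
Variable P : probability Omega R.

(** A simple function below k f, divided by k, lies below f; the supremum definition of the integral
    then suffices without measurability. *)
Lemma integralZl_nonmeasurable_le (k : R) (f : Omega -> R) :
  0 < k -> (forall w, 0 <= f w) ->
  (\int[P]_w (k * f w)%:E <= k%:E * \int[P]_w (f w)%:E)%E.
Proof.
move=> k0 f0; have kf0 w : (0 <= (k * f w)%:E)%E by rewrite lee_fin mulr_ge0// ltW.
rewrite ge0_integralTE//; apply: ge_ereal_sup => _ [h /= hf <-].
have ki0 : 0 <= k^-1 by rewrite invr_ge0 ltW.
rewrite -lee_pdivrMl// -sintegralrM.
rewrite ge0_integralTE//; apply: ereal_sup_ubound.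
exists (scale_nnsfun h ki0) => //= w.
by rewrite lee_fin -ler_pdivlMl ?invr_gt0// invrK -lee_fin; exact: hf.
Qed.

(** The shift by 1 covers x < 1, where raising the exponent lowers the power. *)
Lemma powR_le_expr1D (x p : R) (m : nat) : 0 <= x -> 0 <= p -> p <= m%:R ->
  x `^ p <= (x + 1) ^+ m.
Proof.
move=> x0 p0 pm; rewrite -powR_mulrn ?addr_ge0//.
apply: (@le_trans _ _ ((x + 1) `^ p)).
  by apply: ge0_ler_powR; rewrite ?nnegrE ?addr_ge0// lerDl.
by apply: ler_powR => //; rewrite lerDr.
Qed.

(** Here [N] is a Euclidean norm, [c] compares it with the sup norm, [q] is the scale sqrt (t - s)
    or t - s, and [Z] is the normalised quantity. The absolute value of [C] supplies the sign needed
    when constants are enlarged. *)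
Lemma expectation_powR_le (N Z : Omega -> R) (c q p C : R) (m : nat) :
  0 < c -> 0 < q -> 0 <= p -> p <= m%:R ->
  (forall w, 0 <= Z w) -> (forall w, 0 <= N w <= c * (q * Z w)) ->
  (\int[P]_w ((Z w + 1) ^+ m)%:E <= C%:E)%E ->
  ('E_P[fun w => (N w `^ p)%R] <= (c `^ p * `|C| * q `^ p)%:E)%E.
Proof.
move=> c0 q0 p0 pm Z0 NZ ZC; rewrite unlock.
have k0 : 0 < c `^ p * q `^ p by rewrite mulr_gt0// powR_gt0.
apply: (@le_trans _ _ (\int[P]_w (c `^ p * q `^ p * (Z w + 1) ^+ m)%:E)%E).
  apply: le_integral_nonmeasurable => w; first by rewrite lee_fin powR_ge0.
  rewrite lee_fin; have /andP[N0 NC] := NZ w.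
  apply: (@le_trans _ _ ((c * (q * Z w)) `^ p)).
    by apply: ge0_ler_powR => //; rewrite nnegrE// (le_trans N0).
  have Zw := Z0 w; have qw : 0 <= q * Z w by rewrite mulr_ge0// ltW.
  rewrite !powRM ?(ltW c0) ?(ltW q0)// mulrA ler_wpM2l ?(ltW k0)//.
  exact: powR_le_expr1D.
apply: le_trans (integralZl_nonmeasurable_le k0 _) _.
  by move=> w; rewrite exprn_ge0// addr_ge0.
rewrite mulrAC (EFinM (_ * _) `|C|) lee_pmul2l ?fin_numE//.
by apply: le_trans ZC _; rewrite lee_fin ler_norm.
Qed.

End Powers.

(** The empty list is a partition with sum 0, which excludes every nonzero limit; the default value
    is 0 too. *)
Lemma RS_integral_refl (R : realType) (s : R) (f g : R -> R) :
  RS_integral s s f g = 0.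
Proof.
rewrite /RS_integral; case: xgetP => // I _ HI; apply/eqP/negPn/negP => I0.
have I1 : 0 < `|I| by rewrite normr_gt0.
have [delta _ H] := HI _ I1.
have part : itv_partition s s [::] by split.
have := H [::] (fun=> 0) part; rewrite big_nil sub0r normrN ltxx => {}H.
by suff : false by []; apply: H.
Qed.

Lemma enorm0 (R : realType) (m n : nat) : enorm (0 : 'M[R]_(m, n)) = 0.
Proof.
rewrite /enorm big1 ?sqrtr0// => i _; rewrite big1// => j _.
by rewrite mxE expr0n.
Qed.

Theorem proposition3p2 (R : realType) (T : R) (d : nat)
    (disp : measure_display) (Omega : measurableType disp)
    (P : probability Omega R) (Ft : R -> set (set Omega))
    (W : R -> Omega -> 'cV[R]_d)
    (M : 'cV[R]_d -> 'M[R]_d) (F : 'cV[R]_d -> 'cV[R]_d)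
    (X Y : R -> R -> Omega -> 'cV[R]_d)
    (T_gt0 : 0 < T) (d_ge1 : (1 <= d)%N)
    (basis : complete_basis T P Ft)
    (brownian : is_brownian_motion T P Ft W)
    (A1 : assumption_A1 M) (A2 : assumption_A2 M)
    (A3 : assumption_A3 M) (A4 : assumption_A4 F)
    (solution : forall eps : R, 0 < eps <= 1 ->
       is_solution T P Ft W M F eps (X eps) (Y eps))
    (p : R) (p_ge1 : 1 <= p) :
  exists C : R, forall eps s t : R,
    0 < eps <= 1 -> 0 <= s -> s <= t -> t <= T ->
    ('E_P[fun w => (enorm (increment (X eps) s t w) `^ p)%R]
       <= (C * `|t - s| `^ (p / 2))%:E)%E /\
    ('E_P[fun w => (enorm (iterated_integral (fun u => X eps u w) s t) `^ p)%R]
       <= (C * `|t - s| `^ p)%:E)%E.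
Proof.
have [l [K [L MF]]] := assumptions_coef_bounds A1 A2 A3 A4.
have p0 : 0 < p by lra.
pose m := Num.bound p.
have pm : p <= m%:R by rewrite ltW// archi_boundP// ltW.
have [C1 HC1] : exists C, forall j, time_triple T j -> mean_le P (fun w =>
    (`|X j.1.1 j.2 w - X j.1.1 j.1.2 w| / Num.sqrt (j.2 - j.1.2) + 1) ^+ m) C.
  have b1 := bounded_moments_cst P (time_triple T) ler01.
  exact: (proj2 (bounded_momentsD
    (X_bounded_moments T_gt0 basis brownian MF solution) b1) m).
have [C2 HC2] := iterated_integral_moments T_gt0 basis brownian MF solution m.
(* Comparison constants between the Euclidean and sup norms, for columns and for square matrices. *)
pose c1 : R := (d * 1)%:R; pose c2 : R := (d * d)%:R.
have c10 : 0 < c1 by rewrite ltr0n muln1.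
have c20 : 0 < c2 by rewrite ltr0n muln_gt0 d_ge1.
have k1 : 0 <= c1 `^ p * `|C1| by rewrite mulr_ge0 ?powR_ge0.
have k2 : 0 <= c2 `^ p * `|C2| by rewrite mulr_ge0 ?powR_ge0.
exists (c1 `^ p * `|C1| + c2 `^ p * `|C2|) => eps s t e01 s0 st tT.
(* The normalised bounds divide by t - s. For s = t both expectations vanish, and so do the
   right-hand sides because the exponents are nonzero. *)
move: st; rewrite le_eqVlt => /predU1P[<-|st].
  have p2 : p / 2 != 0 by rewrite gt_eqF// divr_gt0.
  rewrite subrr normr0 !powR0 ?(gt_eqF p0)// mulr0 !unlock; split.
    rewrite integral0_eq// => w _.
    by rewrite /increment subrr enorm0 powR0 ?(gt_eqF p0).
  rewrite integral0_eq// => w _; rewrite (_ : iterated_integral _ _ _ = 0).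
    by rewrite enorm0 powR0 ?(gt_eqF p0).
  by apply/matrixP => i j; rewrite !mxE RS_integral_refl.
have ts0 : 0 < t - s by rewrite subr_gt0.
have r0 : 0 < Num.sqrt (t - s) by rewrite sqrtr_gt0.
rewrite (gtr0_norm ts0).
have e0 (a b : nat) (A : 'M[R]_(a, b)) : 0 <= enorm A by exact: sqrtr_ge0.
have tj : time_triple T (eps, s, t) by split.
split.
  have -> : (t - s) `^ (p / 2) = Num.sqrt (t - s) `^ p.
    by rewrite -(powR12_sqrt (ltW ts0)) -powRrM; congr (_ `^ _); rewrite mulrC.
  have [_ _ HC] := HC1 _ tj.
  apply: le_trans (expectation_powR_le c10 r0 (ltW p0) pm _ _ HC) _.
  - by move=> w /=; rewrite divr_ge0// sqrtr_ge0.
  - move=> w; rewrite e0 /= [_ * (_ / _)]mulrCA divff ?gt_eqF// mulr1.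
    exact: enorm_le_mx_norm.
  - by rewrite lee_fin ler_wpM2r ?powR_ge0// lerDl.
apply: le_trans (expectation_powR_le c20 ts0 (ltW p0) pm _ _ (HC2 _ tj)) _.
- by move=> w /=; rewrite divr_ge0// ltW.
- move=> w; rewrite e0 /= [_ * (_ / _)]mulrCA divff ?gt_eqF// mulr1.
  exact: enorm_le_mx_norm.
- by rewrite lee_fin ler_wpM2r ?powR_ge0// lerDr.
Qed.
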